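(* Let $L$ be a Tonelli Lagrangian with $L\geq\alpha$ for some constant $\alpha>0$. Let $\Omega\subset\mathbb{R}^n$ be a bounded Lipschitz domain satisfying the exterior sphere condition: there exists $\rho>0$ such that for every $x\in\partial\Omega$ there exists $x_0\in\mathbb{R}^n\setminus\Omega$ with $x\in\overline{B(x_0,\rho)}\subset\mathbb{R}^n\setminus\Omega$. Let $g:\partial\Omega\to\mathbb{R}$ satisfy: (G1) there is $\nu\in[0,1)$ such that $g(y_1)-g(y_2)\leq\nu\,\Phi^{\Omega}_L(y_2,y_1)$ for all $y_1,y_2\in\partial\Omega$; (G2) there exists $G\in C^{1,1}(\Gamma_\delta)$ for some $\delta>0$, where $\Gamma=\partial\Omega$ and $\Gamma_\delta$ is the $\delta$-neighborhood of $\Gamma$, such that $g=G|_{\Gamma}$, and there is $\breve C>0$ such that $\langle\nabla G(x),x-y\rangle\leq\breve C|x-y|^2$ for all $x,y\in\Gamma$. Let $u(x)=\inf_{y\in\partial\Omega}\{g(y)+\Phi^{\Omega}_L(y,x)\}$, $x\in\overline\Omega$. Then $u$ is semiconcave on $\overline\Omega$.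
   Context: A Tonelli Lagrangian is a $C^2$ function $L:\mathbb{R}^n\times\mathbb{R}^n\to\mathbb{R}$ such that $\frac{\partial^2L}{\partial v^2}(x,v)$ is positive definite for all $(x,v)$, and there exist nondecreasing superlinear functions $\theta_1,\theta_2:[0,+\infty)\to[0,+\infty)$ (superlinear means $\theta(r)/r\to+\infty$ as $r\to+\infty$) and $c_0>0$ with $\theta_2(|v|)\geq L(x,v)\geq\theta_1(|v|)-c_0$ for all $(x,v)$. A Lipschitz domain is a domain whose boundary is locally the graph of a Lipschitz function. For $x,y\in\overline{\Omega}$ and $s<t$, $\Gamma^{s,t}_{x,y}(\overline{\Omega})$ is the set of $\xi\in W^{1,1}([s,t];\mathbb{R}^n)$ with $\xi(\tau)\in\overline\Omega$ for all $\tau\in[s,t]$, $\xi(s)=x$, $\xi(t)=y$. For $t>0$, $A^{\Omega}_t(x,y)=\inf_{\xi\in\Gamma^{0,t}_{x,y}(\overline{\Omega})}\int_0^tL(\xi,\dot\xi)\,ds$ and $\Phi^{\Omega}_L(x,y)=\inf_{t>0}A^{\Omega}_t(x,y)$. A function $u:S\to\mathbb{R}$ on a set $S\subset\mathbb{R}^n$ is semiconcave if there is a constant $C>0$ such that $\lambda u(x)+(1-\lambda)u(y)-u(\lambda x+(1-\lambda)y)\leq\frac C2\lambda(1-\lambda)|x-y|^2$ for all $\lambda\in[0,1]$ and all $x,y\in S$ such that the segment $[x,y]$ is contained in $S$. *)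

(* Defs.v *)
From HB Require Import structures.
From mathcomp Require Import all_boot all_order all_algebra.
From mathcomp Require Import all_classical all_reals all_analysis.

Set Implicit Arguments.
Unset Strict Implicit.
Unset Printing Implicit Defensive.

Import Order.TTheory GRing.Theory Num.Theory.
Import numFieldNormedType.Exports.

Local Open Scope classical_set_scope.
Local Open Scope ring_scope.

(* The library norm on 'rV[R]_n is the sup norm: it is only used for the
   topology and differentiability, the metric notions below being Euclidean. *)
Definition dotp (R : realType) (n : nat) (u v : 'rV[R]_n) : R :=
  \sum_(i < n) u 0 i * v 0 i.

Definition enorm (R : realType) (n : nat) (u : 'rV[R]_n) : R :=
  Num.sqrt (dotp u u).

Definition frontier (T : topologicalType) (A : set T) : set T :=
  closure A `\` interior A.

Definition grad (R : realType) (n : nat) (f : 'rV[R]_n -> R) (x : 'rV[R]_n) :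
    'rV[R]_n :=
  \row_(i < n) 'D_(delta_mx 0 i) f x.

(* C1 and C2 are used on finite-dimensional spaces only, where continuity of
   x |-> 'd f x amounts to that of x |-> 'D_v f x for each v. *)
Definition C1 (R : realType) (V : normedModType R) (f : V -> R) : Prop :=
  (forall x, differentiable f x) /\ (forall v, continuous ('D_v f)).

Definition C2 (R : realType) (V : normedModType R) (f : V -> R) : Prop :=
  C1 f /\ (forall v, C1 ('D_v f)).

Definition C11_on (R : realType) (n : nat) (U : set 'rV[R]_n)
    (f : 'rV[R]_n -> R) : Prop :=
  (forall x, U x -> differentiable f x) /\
  (exists K : R, forall x y, U x -> U y ->
     enorm (grad f x - grad f y) <= K * enorm (x - y)).

Definition tube (R : realType) (n : nat) (A : set 'rV[R]_n) (delta : R) :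
    set 'rV[R]_n :=
  [set x | exists2 y, A y & enorm (x - y) < delta].

Definition eclosed_ball (R : realType) (n : nat) (c : 'rV[R]_n) (r : R) :
    set 'rV[R]_n :=
  [set x | enorm (x - c) <= r].

(* L (x, v): x is the position, v the velocity. *)
Definition hess_v (R : realType) (n : nat) (L : 'rV[R]_n * 'rV[R]_n -> R)
    (x v : 'rV[R]_n) : 'M[R]_n :=
  \matrix_(i < n, j < n)
    'D_((0 : 'rV[R]_n), (delta_mx 0 i : 'rV[R]_n))
      ('D_((0 : 'rV[R]_n), (delta_mx 0 j : 'rV[R]_n)) L) (x, v).

Definition positive_definite (R : realType) (n : nat) (H : 'M[R]_n) : Prop :=
  forall w : 'rV[R]_n, w != 0 -> 0 < (w *m H *m w^T) 0 0.

(* theta : [0, +oo) -> [0, +oo) is encoded by a total function whose values at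
   negative reals are irrelevant. *)
Definition nondecreasing_superlinear (R : realType) (theta : R -> R) : Prop :=
  [/\ forall r, 0 <= r -> 0 <= theta r,
      forall r s, 0 <= r -> r <= s -> theta r <= theta s &
      theta r / r @[r --> +oo] --> +oo].

Definition tonelli (R : realType) (n : nat) (L : 'rV[R]_n * 'rV[R]_n -> R) :
    Prop :=
  [/\ C2 L,
      forall x v, positive_definite (hess_v L x v) &
      exists theta1 theta2 : R -> R, exists c0 : R,
        [/\ nondecreasing_superlinear theta1,
            nondecreasing_superlinear theta2,
            0 < c0 &
            forall x v, theta1 (enorm v) - c0 <= L (x, v) <= theta2 (enorm v)]].

(* Near p, A is the graph, over the hyperplane orthogonal to the unit vector e,
   of a Lipschitz function gam; only the values of gam on that hyperplane are
   constrained. *)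
Definition lipschitz_graph_near (R : realType) (n : nat) (A : set 'rV[R]_n)
    (p : 'rV[R]_n) : Prop :=
  exists e : 'rV[R]_n, exists gam : 'rV[R]_n -> R, exists K : R,
    [/\ enorm e = 1,
        forall z w, dotp z e = 0 -> dotp w e = 0 ->
          `|gam z - gam w| <= K * enorm (z - w) &
        \forall y \near p, A y <-> dotp y e = gam (y - dotp y e *: e)].

Definition lipschitz_domain (R : realType) (n : nat) (Om : set 'rV[R]_n) :
    Prop :=
  [/\ open Om, connected Om, Om !=set0 &
      forall p, frontier Om p -> lipschitz_graph_near (frontier Om) p].

Definition exterior_sphere (R : realType) (n : nat) (Om : set 'rV[R]_n) :
    Prop :=
  exists2 rho : R, 0 < rho & forall x, frontier Om x ->
    exists x0 : 'rV[R]_n,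
      [/\ ~ Om x0, eclosed_ball x0 rho x & eclosed_ball x0 rho `<=` ~` Om].

Definition test_fun (R : realType) (s t : R) (phi : R -> R) : Prop :=
  C1 phi /\ (exists a b : R, [/\ s < a, b < t &
               forall tau, tau \notin `[a, b] -> phi tau = 0]).

(* xi is the continuous representative of an element of W^{1,1}([s,t]; R^n)
   and eta is (a representative of) its weak derivative. *)
Definition W11 (R : realType) (n : nat) (s t : R) (xi eta : R -> 'rV[R]_n) :
    Prop :=
  {within `[s, t], continuous xi} /\
  forall i : 'I_n,
    lebesgue_measure.-integrable `[s, t] (fun tau => (eta tau 0 i)%:E) /\
    (forall phi, test_fun s t phi ->
       \int[lebesgue_measure]_(tau in `[s, t]) (xi tau 0 i * derive1 phi tau) =
       - \int[lebesgue_measure]_(tau in `[s, t]) (eta tau 0 i * phi tau)).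

(* Gamma^{s,t}_{x,y}(closure Om), each curve being paired with its weak
   derivative (unique up to null sets). *)
Definition curves (R : realType) (n : nat) (Om : set 'rV[R]_n) (s t : R)
    (x y : 'rV[R]_n) : set ((R -> 'rV[R]_n) * (R -> 'rV[R]_n)) :=
  [set c | [/\ W11 s t c.1 c.2,
               forall tau, s <= tau <= t -> closure Om (c.1 tau),
               c.1 s = x & c.1 t = y]].

Definition action (R : realType) (n : nat) (L : 'rV[R]_n * 'rV[R]_n -> R)
    (Om : set 'rV[R]_n) (t : R) (x y : 'rV[R]_n) : \bar R :=
  ereal_inf [set (\int[lebesgue_measure]_(tau in `[0%R, t])
                    (L (c.1 tau, c.2 tau))%:E)%E | c in curves Om 0 t x y].

Definition Phi (R : realType) (n : nat) (L : 'rV[R]_n * 'rV[R]_n -> R)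
    (Om : set 'rV[R]_n) (x y : 'rV[R]_n) : \bar R :=
  ereal_inf [set action L Om t x y | t in [set t : R | 0 < t]].

Definition value (R : realType) (n : nat) (L : 'rV[R]_n * 'rV[R]_n -> R)
    (Om : set 'rV[R]_n) (g : 'rV[R]_n -> R) (x : 'rV[R]_n) : \bar R :=
  ereal_inf [set ((g y)%:E + Phi L Om y x)%E | y in frontier Om].

Definition semiconcave (R : realType) (n : nat) (S : set 'rV[R]_n)
    (u : 'rV[R]_n -> R) : Prop :=
  exists2 C : R, 0 < C & forall (lam : R) (x y : 'rV[R]_n),
    0 <= lam <= 1 -> S x -> S y ->
    (forall mu : R, 0 <= mu <= 1 -> S (mu *: x + (1 - mu) *: y)) ->
    lam * u x + (1 - lam) * u y - u (lam *: x + (1 - lam) *: y)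
      <= C / 2 * lam * (1 - lam) * enorm (x - y) ^+ 2.

(* Main.v *)
(* Only a consequence of (G2) matters: exchanging [x] and [y] in it and using
   that [grad G] is Lipschitz, [|g x - g y| <= C |x - y|^2] on the boundary.

   No minimizer is needed. For every [z] in [Om] and [eps > 0] there is a
   polygon from a boundary point to [z], of bounded speed and inside [Om] apart
   from its start, whose cost is [eps]-close to the value at [z]: an almost
   optimal curve may be started at its last boundary point by (G1), and on a
   short time interval the momentum of the zero-energy velocity in the direction
   of the chord is a linear lower bound of [L], so that replacing the curve by
   its chord multiplies the action by at most [1 + kap].

   Since [nu < 1], such a polygon is at time [t] at distance at least [t / c1]
   from the boundary. Hence its displacement over a short initial time is
   transversal to the exterior ball at its start. To reach [z + h], the initial
   part is dilated (same velocities, durations multiplied by [kap]) so that it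
   starts in that ball, and the rest is translated by [h]. The variation of the
   cost is linear in [h] up to [O(|h|^2)], with no derivative of [L] in [v], and
   the part outside [Om] is dropped at second-order cost by the flatness of [g].
   This gives a supporting paraboloid from above with uniform opening at each
   point of [Om]; at boundary points, segments contained in the closure are
   tangent to the exterior ball, and the flatness of [g] suffices. *)

(* The obstacle is uniformity in [z]: near the boundary the duration [T] of the dilated part may be
   small compared with [|h|], and then nothing bounds the dilation factor. The opening only sees the
   product [|kap - 1| * T], which is at most a constant times [|h|]; a bound on [kap] itself enters
   only in the choice of [eps], which may depend on [z].

   The dilated part is cut at a time between [T0 / 2] and [T0], or at the end of a shorter polygon.
   After the cut the distance to the boundary is bounded below, so a translation by a small [h]
   remains in the closure; this fixes a radius valid for all [z].

   Keeping the velocities and changing the durations means that [L] is only expanded in the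
   position, where the [C2] bound on a compact set gives a quadratic remainder.

   The linear coefficient [Q] depends on the accuracy [err]. In the semiconcavity inequality the two
   terms in [Q] cancel for each fixed [err], and only then does [err] tend to zero. *)
Require Import Defs.
From HB Require Import structures.
From mathcomp Require Import all_boot all_order all_algebra.
From mathcomp Require Import all_classical all_reals all_analysis.
From mathcomp Require Import measurable_realfun.
From mathcomp Require Import ring lra.

Import Order.TTheory GRing.Theory Num.Theory.
Import numFieldNormedType.Exports.

Local Open Scope classical_set_scope.
Local Open Scope ring_scope.

Set Implicit Arguments.
Unset Strict Implicit.
Unset Printing Implicit Defensive.

(** * Euclidean norm and its comparison with the library topology *)

Section Euclid.
Variables (R : realType) (n : nat).
Implicit Types (u v w x y : 'rV[R]_n) (a : R).

Lemma dotpC u v : dotp u v = dotp v u.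
Proof. by apply: eq_bigr => i _; rewrite mulrC. Qed.

Lemma dotpDl u v w : dotp (u + v) w = dotp u w + dotp v w.
Proof.
by rewrite /dotp -big_split; apply: eq_bigr => i _; rewrite mxE mulrDl.
Qed.

Lemma dotpZl a u w : dotp (a *: u) w = a * dotp u w.
Proof.
by rewrite /dotp mulr_sumr; apply: eq_bigr => i _; rewrite mxE mulrA.
Qed.

Lemma dotpDr u v w : dotp w (u + v) = dotp w u + dotp w v.
Proof. by rewrite dotpC dotpDl ![dotp w _]dotpC. Qed.

Lemma dotpZr a u w : dotp w (a *: u) = a * dotp w u.
Proof. by rewrite dotpC dotpZl dotpC. Qed.

Lemma dotpNl u w : dotp (- u) w = - dotp u w.
Proof. by rewrite -scaleN1r dotpZl mulN1r. Qed.

Lemma dotpNr u w : dotp w (- u) = - dotp w u.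
Proof. by rewrite dotpC dotpNl dotpC. Qed.

Lemma dotpBl u v w : dotp (u - v) w = dotp u w - dotp v w.
Proof. by rewrite dotpDl dotpNl. Qed.

Lemma dotpBr u v w : dotp w (u - v) = dotp w u - dotp w v.
Proof. by rewrite dotpDr dotpNr. Qed.

Lemma dotp0r u : dotp u 0 = 0.
Proof. by rewrite -(scale0r 0) dotpZr mul0r. Qed.

Lemma dotp_sumr (I : finType) (P : pred I) (F : I -> 'rV[R]_n) u :
  dotp u (\sum_(i | P i) F i) = \sum_(i | P i) dotp u (F i).
Proof.
by apply: (big_morph (dotp u)) => [a b|]; [exact: dotpDr|exact: dotp0r].
Qed.

Lemma dotp_ge0 u : 0 <= dotp u u.
Proof. by apply: sumr_ge0 => i _; rewrite -expr2 sqr_ge0. Qed.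

Lemma enorm_ge0 u : 0 <= enorm u.
Proof. exact: sqrtr_ge0. Qed.

Lemma sqr_enorm u : enorm u ^+ 2 = dotp u u.
Proof. by rewrite sqr_sqrtr ?dotp_ge0. Qed.

Lemma enormZ a u : enorm (a *: u) = `|a| * enorm u.
Proof.
by rewrite /enorm dotpZl dotpZr mulrA -expr2 sqrtrM ?sqr_ge0// sqrtr_sqr.
Qed.

Lemma enormN u : enorm (- u) = enorm u.
Proof. by rewrite -scaleN1r enormZ normrN1 mul1r. Qed.

Lemma enormBC u v : enorm (u - v) = enorm (v - u).
Proof. by rewrite -enormN opprB. Qed.

Lemma enorm0 : enorm (0 : 'rV[R]_n) = 0.
Proof. by rewrite -(scale0r 0) enormZ normr0 mul0r. Qed.

Lemma dotp_eq0 u : dotp u u = 0 -> u = 0.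
Proof.
move=> /eqP; rewrite psumr_eq0 => [/allP h|i _]; last by rewrite -expr2 sqr_ge0.
apply/rowP => i; rewrite mxE; apply/eqP.
by have := h i (mem_index_enum i); rewrite /= mulf_eq0 orbb.
Qed.

Lemma enorm_eq0 u : enorm u = 0 -> u = 0.
Proof. by move=> h; apply: dotp_eq0; rewrite -sqr_enorm h expr0n. Qed.

Lemma enorm_gt0 u : u != 0 -> 0 < enorm u.
Proof.
by rewrite lt_neqAle enorm_ge0 andbT; apply: contra_neq => /esym/enorm_eq0.
Qed.

Lemma dotp_le u v : dotp u v <= enorm u * enorm v.
Proof.
have [->|v0] := eqVneq v 0; first by rewrite dotp0r enorm0 mulr0.
have vp := enorm_gt0 v0.
have [->|u0] := eqVneq u 0; first by rewrite dotpC dotp0r enorm0 mul0r.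
have up := enorm_gt0 u0.
have := dotp_ge0 (enorm v *: u - enorm u *: v).
rewrite dotpBl !dotpBr !dotpZl !dotpZr -!sqr_enorm (dotpC v u) => h.
have : 0 <= enorm u * enorm v * (enorm u * enorm v - dotp u v) by lra.
by rewrite pmulr_rge0 ?mulr_gt0// subr_ge0.
Qed.

Lemma ler_norm_dotp u v : `|dotp u v| <= enorm u * enorm v.
Proof.
by rewrite ler_norml dotp_le andbT lerNl -dotpNl -(enormN u) dotp_le.
Qed.

Lemma enormD u v : enorm (u + v) <= enorm u + enorm v.
Proof.
rewrite -(@ler_pXn2r _ 2)// ?nnegrE ?addr_ge0 ?enorm_ge0//.
rewrite sqr_enorm dotpDl !dotpDr (dotpC v u) -!sqr_enorm.
by have := dotp_le u v; lra.
Qed.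

Lemma enormB u v : enorm (u - v) <= enorm u + enorm v.
Proof. by rewrite -(enormN v) enormD. Qed.

Lemma enorm_tri x u v : enorm (u - v) <= enorm (u - x) + enorm (x - v).
Proof. by rewrite -{1}(subrK x u) -addrA enormD. Qed.

Lemma enorm_coord u i : `|u 0 i| <= enorm u.
Proof.
rewrite -sqrtr_sqr ler_sqrt ?dotp_ge0// /dotp (bigD1 i)//= expr2 lerDl.
by apply: sumr_ge0 => j _; rewrite -expr2 sqr_ge0.
Qed.

Lemma enorm_delta i : enorm (delta_mx 0 i : 'rV[R]_n) = 1.
Proof.
rewrite /enorm /dotp (bigD1 i)//= mxE !eqxx mulr1 big1 ?addr0 ?sqrtr1//.
by move=> j ji; rewrite mxE (negbTE ji) andbF mulr0.
Qed.

Lemma norm_le_enorm u : `|u| <= enorm u.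
Proof.
rewrite [leLHS]/Num.norm /= mx_normrE.
apply: bigmax_le => [|[i j] _ /=]; first exact: enorm_ge0.
by rewrite ord1 enorm_coord.
Qed.

Lemma ler_coord_norm u i : `|u 0 i| <= `|u|.
Proof.
rewrite [leRHS]/Num.norm /= mx_normrE.
by apply: (le_bigmax _ (fun ij : 'I_1 * 'I_n => `|u ij.1 ij.2|) (0, i)).
Qed.

(** The crude factor [n.+1] is positive even for [n = 0], so that [near_enorm] can divide by it. *)
Lemma enorm_le_norm u : enorm u <= n.+1%:R * `|u|.
Proof.
have N0 : 0 <= n.+1%:R * `|u| by rewrite mulr_ge0 ?normr_ge0// ler0n.
rewrite -(@ler_pXn2r _ 2)// ?nnegrE ?enorm_ge0//.
rewrite sqr_enorm (@le_trans _ _ (\sum_(i < n) `|u| ^+ 2))//.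
  apply: ler_sum => i _.
  by rewrite -expr2 -real_normK ?num_real// ler_pXn2r ?nnegrE ?normr_ge0 ?ler_coord_norm.
rewrite sumr_const card_ord -[leLHS]mulr_natl exprMn ler_wpM2r ?sqr_ge0//.
by rewrite -natrX ler_nat (leq_trans (leqnSn _))// expnS expn1 leq_pmulr.
Qed.

Lemma near_enorm x (e : R) : 0 < e -> \forall y \near x, enorm (y - x) < e.
Proof.
move=> e0.
have e1 : 0 < e / n.+1%:R by rewrite divr_gt0 ?ltr0n.
have := nbhsx_ballx x _ e1; apply: filterS => y.
rewrite -ball_normE /= distrC => h.
by rewrite (le_lt_trans (enorm_le_norm _))// mulrC -ltr_pdivlMr ?ltr0n.
Qed.

Lemma open_enorm (A : set 'rV[R]_n) x : open A -> A x ->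
  exists2 e : R, 0 < e & forall y, enorm (y - x) < e -> A y.
Proof.
rewrite openE => h /h /nbhs_ballP[e e0 sub]; exists e => // y hy.
apply: sub; rewrite -ball_normE /= distrC.
exact: le_lt_trans (norm_le_enorm _) hy.
Qed.

Lemma closure_enorm (A : set 'rV[R]_n) x :
  closure A x <-> forall e : R, 0 < e -> exists2 y, A y & enorm (y - x) < e.
Proof.
split=> [h e e0|h U /nbhs_ballP[e e0 sub]].
  by have [y [Ay hy]] := h _ (near_enorm x e0); exists y.
have [y Ay hy] := h _ e0; exists y; split=> //; apply: sub.
rewrite -ball_normE /= distrC.
exact: le_lt_trans (norm_le_enorm _) hy.
Qed.

Lemma cvg_enorm T (F : set_system T) {FF : Filter F} (f : T -> 'rV[R]_n) x :
  (forall e : R, 0 < e -> \forall t \near F, enorm (f t - x) < e) <-> f @ F --> x.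
Proof.
split=> [h|h e e0]; last exact: h (near_enorm x e0).
apply/cvgrPdist_lt => e e0; have := h e e0; apply: filterS => t.
by rewrite enormBC; apply: le_lt_trans; exact: norm_le_enorm.
Qed.

End Euclid.

(** * Last exits from an open set, along curves and along segments *)

Section Exit.
Variables (R : realType) (n : nat).
Implicit Types (x q b : 'rV[R]_n) (Om : set 'rV[R]_n).

Lemma within_cont_enorm (f : R -> 'rV[R]_n) (a b : R) :
  {within `[a, b], continuous f} <->
  forall s, a <= s <= b -> forall e, 0 < e -> exists2 d, 0 < d &
    forall t, a <= t <= b -> `|t - s| < d -> enorm (f t - f s) < e.
Proof.
split.
  move/subspace_continuousP => h s sab e e0.
  have /h/cvg_enorm/(_ _ e0) : `[a, b]%classic s by rewrite /= in_itv.
  move=> /nbhs_ballP[d d0 sub]; exists d => // t tab ts.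
  by apply: sub; rewrite /= ?in_itv//= -ball_normE /= distrC.
move=> h; apply/subspace_continuousP => s; rewrite /= in_itv/= => sab.
apply/cvg_enorm => e e0.
have [d d0 hd] := h s sab e e0.
apply/nbhs_ballP; exists d => //= t.
by rewrite -ball_normE /= distrC in_itv/= => ts tab; exact: hd.
Qed.

(** The time is the supremum of the times at which [f] is outside [Om]. Since [Om] is open this
    supremum is attained, hence differs from [b]; the points of [Om] reached just after it put [f s]
    in the closure. *)
Lemma last_exit Om (f : R -> 'rV[R]_n) (a b : R) : open Om -> a <= b ->
  {within `[a, b], continuous f} -> ~ Om (f a) -> Om (f b) ->
  exists s, [/\ a <= s, s < b, frontier Om (f s) &
             forall t, s < t -> t <= b -> Om (f t)].
Proof.
move=> oOm ab /within_cont_enorm cf na Ob.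
pose S := [set s | a <= s <= b /\ ~ Om (f s)].
have Sa : S a by split; rewrite ?lexx.
have Sub : ubound S b by move=> s [/andP[]].
have supS : has_sup S by split; [exists a|exists b].
set s := sup S.
have as_ : a <= s by exact: sup_upper_bound.
have sb : s <= b by apply: ge_sup => //; exists a.
have Ot t : s < t -> t <= b -> Om (f t).
  move=> st tb; apply: contrapT => nt.
  suff : t <= s by rewrite leNgt st.
  have St : S t.
    by split => //; apply/andP; split => //; exact: le_trans as_ (ltW st).
  exact: sup_upper_bound.
have ns : ~ Om (f s).
  move=> Os; have [e e0 he] := open_enorm oOm Os.
  have [|d d0 hd] := cf s _ e e0; first by rewrite as_ sb.
  have [t [tab nt] ts] := sup_adherent d0 supS.
  have ts' : t <= s by exact: sup_upper_bound.
  apply: nt; apply/he/hd => //; rewrite ler0_norm.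
    by rewrite opprB ltrBlDr addrC -ltrBlDr.
  by rewrite subr_le0.
have sltb : s < b.
  by rewrite lt_neqAle sb andbT; apply/eqP => sbE; apply: ns; rewrite sbE.
exists s; split => //; split; last by move=> /interior_subset.
apply/closure_enorm => e e0.
have [|d d0 hd] := cf s _ e e0; first by rewrite as_ sb.
pose t := Num.min b (s + d / 2).
have st : s < t by rewrite lt_min sltb ltrDl divr_gt0.
exists (f t); first by apply: Ot => //; rewrite ge_min lexx.
apply: hd; first by rewrite (le_trans as_ (ltW st))//= ge_min lexx.
rewrite gtr0_norm ?subr_gt0//.
have : t <= s + d / 2 by rewrite ge_min lexx orbT.
by lra.
Qed.

(** Last exit on the way from [q] to [x]. When [x] is not in [Om] it is itself on the frontier and
    [t = 1], which is why the conclusion about the open set is conditional on [Om x]. *)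
Lemma seg_exit Om x q : open Om -> closure Om x -> ~ Om q ->
  exists t : R, [/\ 0 <= t <= 1, frontier Om (q + t *: (x - q)),
    forall s : R, t <= s <= 1 -> closure Om (q + s *: (x - q)) &
    Om x -> forall s : R, t < s <= 1 -> Om (q + s *: (x - q))].
Proof.
move=> oOm cx nq.
have [Ox|nx] := pselect (Om x); last first.
  exists 1; rewrite ler01 lexx scale1r subrKC; split => //.
    by split => // /interior_subset.
  by move=> s; rewrite -eq_le => /eqP <-; rewrite scale1r subrKC.
have cf : {within `[0, 1], continuous (fun s : R => q + s *: (x - q))}.
  apply/within_cont_enorm => s _ e e0.
  exists (e / (1 + enorm (x - q))).
    by rewrite divr_gt0// ltr_wpDr// enorm_ge0.
  move=> t _; rewrite ltr_pdivlMr; last by rewrite ltr_wpDr// enorm_ge0.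
  rewrite opprD addrACA subrr add0r -scalerBl enormZ.
  apply: le_lt_trans; apply: ler_wpM2l; rewrite ?normr_ge0//.
  by rewrite lerDr.
have [||s [s0 s1 fs Os]] := last_exit oOm (@ler01 R) cf.
- by rewrite scale0r addr0.
- by rewrite scale1r subrKC.
exists s; split => //.
- by rewrite s0 ltW.
- move=> t /andP[]; rewrite le_eqVlt => /predU1P[<- _|st t1].
    by case: fs.
  by apply: subset_closure; exact: Os.
- by move=> _ t /andP[]; exact: Os.
Qed.

(** The form used later: a point outside [Om] close to [x] yields a frontier point no farther from
    [x], joined to [x] by a segment of the closure that can be travelled at bounded cost. *)
Lemma seg_exit_dist Om x q : open Om -> closure Om x -> ~ Om q ->
  exists b, [/\ frontier Om b, enorm (x - b) <= enorm (x - q),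
    forall s : R, 0 <= s <= 1 -> closure Om (b + s *: (x - b)) &
    Om x -> forall s : R, 0 < s <= 1 -> Om (b + s *: (x - b))].
Proof.
move=> oOm cx nq; have [t [t01 fb cb Ob]] := seg_exit oOm cx nq.
exists (q + t *: (x - q)); split => //.
- have -> : x - (q + t *: (x - q)) = (1 - t) *: (x - q).
    by rewrite scalerBl scale1r opprD addrA.
  rewrite enormZ ger0_norm ?subr_ge0//; last by case/andP: t01.
  by rewrite ler_piMl ?enorm_ge0//; lra.
(* [t + s * (1 - t)] is the parameter, on the segment from [q] to [x], of the point of parameter [s]
   on the segment from the exit point to [x]. *)
- move=> s s01; have := cb (t + s * (1 - t)).
  have -> : q + (t + s * (1 - t)) *: (x - q) =
      q + t *: (x - q) + s *: (x - (q + t *: (x - q))).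
    rewrite scalerDl -addrA; congr (_ + (_ + _)).
    rewrite -scalerA; congr (_ *: _).
    by rewrite scalerBl scale1r opprD addrA.
  apply; case/andP: t01 => t0 t1; case/andP: s01 => s0 s1.
  have := mulr_ge0 s0 (_ : 0 <= 1 - t); have := mulr_ge0 (_ : 0 <= 1 - s) (_ : 0 <= 1 - t).
  rewrite !subr_ge0 => /(_ s1 t1) h1 /(_ t1) h2; apply/andP; split; lra.
- move=> Ox s s01.
  have [t1|t1] := eqVneq t 1.
    by rewrite t1 scale1r subrKC subrr scaler0 addr0.
  have := Ob Ox (t + s * (1 - t)).
  have -> : q + (t + s * (1 - t)) *: (x - q) =
      q + t *: (x - q) + s *: (x - (q + t *: (x - q))).
    rewrite scalerDl -addrA; congr (_ + (_ + _)).
    rewrite -scalerA; congr (_ *: _).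
    by rewrite scalerBl scale1r opprD addrA.
  have t1' : t < 1 by rewrite lt_neqAle t1; case/andP: t01.
  apply; case/andP: s01 => s0 s1.
  have := mulr_gt0 s0 (_ : 0 < 1 - t); have := mulr_ge0 (_ : 0 <= 1 - s) (_ : 0 <= 1 - t).
  by rewrite !subr_ge0 !subr_gt0 => /(_ s1 (ltW t1')) h1 /(_ t1') h2; apply/andP; split; lra.
Qed.

Lemma closure_out_ball Om x0 (rho : R) x :
  eclosed_ball x0 rho `<=` ~` Om -> closure Om x -> rho <= enorm (x - x0).
Proof.
move=> sub /closure_enorm cx; rewrite leNgt; apply/negP => h.
have [|y Oy hy] := cx (rho - enorm (x - x0)); first by rewrite subr_gt0.
apply: (sub y) => //; rewrite /eclosed_ball /=.
  by have := enorm_tri x y x0; lra.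
Qed.

End Exit.

(** The sequences are total on [nat], only the first [N] edges being constrained. Edges last at most
    [eps], so that freezing [L] at the start of an edge costs [O(M * eps)] per unit of time. *)
Definition polygon (R : realType) (n : nat) (Om : set 'rV[R]_n) (M eps : R)
    (p : nat -> 'rV[R]_n) (tau : nat -> R) (v : nat -> 'rV[R]_n) (N : nat) :=
  frontier Om (p 0) /\ forall i, (i < N)%N ->
    [/\ 0 <= tau i <= eps, enorm (v i) <= M, p i.+1 = p i + tau i *: v i &
        forall s : R, 0 <= s <= tau i -> closure Om (p i + s *: v i)].

(** * Dilation into the exterior ball, and segments travelled at unit speed *)

Lemma sqr_enormD (R : realType) (n : nat) (u v : 'rV[R]_n) :
  enorm (u + v) ^+ 2 = enorm u ^+ 2 + 2 * dotp u v + enorm v ^+ 2.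
Proof. by rewrite !sqr_enorm dotpDl !dotpDr (dotpC v u); ring. Qed.

Lemma sqr_enormD_le (R : realType) (n : nat) (u v : 'rV[R]_n) (a b : R) :
  enorm u <= a -> enorm v <= b -> enorm (u + v) ^+ 2 <= 2 * a ^+ 2 + 2 * b ^+ 2.
Proof.
move=> ua vb; have := enormD u v; have := enorm_ge0 (u + v).
have := enorm_ge0 u; have := enorm_ge0 v => *.
have : enorm (u + v) ^+ 2 <= (a + b) ^+ 2.
  by rewrite ler_pXn2r// ?nnegrE; lra.
by have := sqr_ge0 (a - b); lra.
Qed.

(* The dilation factor is corrected at second order so that the image of the
   starting point falls inside the exterior ball. *)
Lemma tangent_dilation (R : realType) (n : nat) (rho M c T : R)
    (N w h : 'rV[R]_n) (C := 1 + M * rho / c)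
    (kap := 1 + dotp h N / dotp w N + 2 * C ^+ 2 / c * enorm h ^+ 2 / T) :
  0 < rho -> 1 <= M -> 0 < c -> 0 < T -> enorm N = rho ->
  c * T <= dotp w N -> enorm w <= M * T -> 0 < enorm h ->
  2 * C / c * M * enorm h <= 1 -> rho <= enorm (N + w + h) ->
  [/\ 0 < kap, enorm (N + w + h - kap *: w) <= rho &
      `|dotp h N / dotp w N| * T <= rho / c * enorm h].
Proof.
move=> rho0 M1 c0 T0 EN wN wM h0 hs out.
have wN0 : 0 < dotp w N by apply: lt_le_trans wN; exact: mulr_gt0.
set bet := dotp h N / dotp w N in kap *.
have C1 : 1 <= C by rewrite /C lerDl divr_ge0 ?mulr_ge0 ?ltW//; lra.
set gam := 2 * C ^+ 2 / c * enorm h ^+ 2 / T in kap *.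
have gamT : gam * (c * T) = 2 * C ^+ 2 * enorm h ^+ 2.
  by rewrite /gam; field; rewrite !gt_eqF.
have gam0 : 0 < gam.
  by rewrite /gam !(divr_gt0, mulr_gt0, exprn_gt0)//; lra.
have gamw : 2 * C ^+ 2 * enorm h ^+ 2 <= gam * dotp w N.
  by rewrite -gamT ler_wpM2l// ltW.
have betw : bet * dotp w N = dotp h N by rewrite /bet divfK// gt_eqF.
have betT : `|bet| * T <= rho / c * enorm h.
  rewrite mulrAC ler_pdivlMr// -mulrA (mulrC T).
  apply: (@le_trans _ _ (`|bet| * dotp w N)); first exact: ler_wpM2l.
  rewrite -{1}(gtr0_norm wN0) -normrM betw.
  by apply: (le_trans (ler_norm_dotp _ _)); rewrite EN mulrC.
have Eh : M * (rho / c * enorm h) + enorm h = C * enorm h by rewrite /C; ring.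
have kap0 : 0 < kap.
  (* If [1 + bet] is negative then [|bet| > 1], so [T] and hence [w + h] are of order [|h|]. As
     [N + w + h] is outside the ball, [2 * (1 + bet) * dotp w N] is at least [- C ^+ 2 * |h|^2],
     which the correction [gam] outweighs. *)
  rewrite /kap; have [b1|b1] := lerP 0 (1 + bet); first by lra.
  have bT : T <= rho / c * enorm h.
    apply: le_trans betT; rewrite ler_peMl// ?ltW// ltr0_norm; lra.
  have nwh : enorm (w + h) <= C * enorm h.
    apply: (le_trans (enormD _ _)).
    rewrite -Eh lerD2r; apply: (le_trans wM); rewrite ler_wpM2l//; lra.
  have nwh2 : enorm (w + h) ^+ 2 <= C ^+ 2 * enorm h ^+ 2.
    by rewrite -exprMn ler_pXn2r ?nnegrE ?mulr_ge0 ?enorm_ge0//; lra.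
  have out2 : rho ^+ 2 <= enorm (N + (w + h)) ^+ 2.
    by rewrite addrA ler_pXn2r ?nnegrE ?enorm_ge0 ?(ltW rho0).
  rewrite sqr_enormD EN dotpDr (dotpC N w) (dotpC N h) -betw in out2.
  have Ch0 : 0 < C ^+ 2 * enorm h ^+ 2 by rewrite mulr_gt0 ?exprn_gt0//; lra.
  suff : 0 < (1 + bet + gam) * dotp w N by rewrite pmulr_lgt0.
  by lra.
split => //.
(* [e] is orthogonal to [N], so the squared norm of [N + (e - f)] differs from that of [N] by
   [- 2 * gam * dotp w N] plus the square of [e - f]. Both [e] and [f] are at most [C * |h|], and
   the factor 2 in [gam] makes these two contributions balance. *)
pose e := h - bet *: w; pose f := gam *: w.
have -> : N + w + h - kap *: w = N + (e - f).
  by apply/rowP => i; rewrite /e /f /kap !mxE; ring.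
have eN : dotp N e = 0.
  by rewrite /e dotpBr dotpZr (dotpC N w) betw dotpC subrr.
have ne : enorm e <= C * enorm h.
  apply: (le_trans (enormB _ _)); rewrite enormZ -Eh addrC lerD2r.
  apply: (@le_trans _ _ (`|bet| * (M * T))); first by rewrite ler_wpM2l.
  by rewrite mulrCA ler_wpM2l//; lra.
have nf : enorm (- f) <= C * enorm h.
  rewrite enormN enormZ (gtr0_norm gam0).
  apply: (@le_trans _ _ (gam * (M * T))); first by rewrite ler_wpM2l// ltW.
  have -> : gam * (M * T) = (2 * C / c * M * enorm h) * (C * enorm h).
    by rewrite /gam; field; rewrite !gt_eqF.
  by rewrite ler_piMl// mulr_ge0 ?enorm_ge0//; lra.
have ef := sqr_enormD_le ne nf.
rewrite -(@ler_pXn2r _ 2)// ?nnegrE ?enorm_ge0 ?(ltW rho0)//.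
rewrite sqr_enormD EN dotpBr eN /f dotpZr (dotpC N w).
rewrite !exprMn in ef; move: ef gamw; rewrite /f.
set E := enorm (_ - _) ^+ 2.
by lra.
Qed.

(** At unit speed the duration is the length, so an upper bound of [L] becomes a cost per unit of
    length. The velocity is [0] when the two points coincide. *)
Lemma unit_param (R : realType) (n : nat) (x y : 'rV[R]_n) :
  exists2 v, enorm v <= 1 & y = x + enorm (y - x) *: v /\
  forall s : R, 0 <= s <= enorm (y - x) ->
    exists2 r : R, 0 <= r <= 1 & x + s *: v = x + r *: (y - x).
Proof.
have [->|yx] := eqVneq y x.
  exists 0; first by rewrite enorm0 ler01.
  split; first by rewrite scaler0 addr0.
  by move=> s _; exists 0; rewrite ?lexx ?ler01// !(scaler0, scale0r).
have d0 : 0 < enorm (y - x) by rewrite enorm_gt0// subr_eq0.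
exists ((enorm (y - x))^-1 *: (y - x)).
  by rewrite enormZ gtr0_norm ?invr_gt0// mulVf// gt_eqF.
split; first by rewrite scalerA divff ?gt_eqF// scale1r subrKC.
move=> s /andP[s0 s1]; exists (s / enorm (y - x)).
  by rewrite divr_ge0 ?(ltW d0)//= ler_pdivrMr// mul1r.
by rewrite scalerA.
Qed.

Lemma small_shift (R : realType) (c h t T : R) : 0 < T -> 8 * c * h <= T ->
  16 * c * t <= T / 2 -> c * (h + 2 * t) < T / 2.
Proof. by move=> *; lra. Qed.

Lemma small_time (R : realType) (c t T1 T2 : R) : 0 <= c * t ->
  16 * c * t <= T1 -> T1 <= T2 -> t * (2 * c) <= T2.
Proof. by move=> *; lra. Qed.

Lemma lerD_swap (R : realType) (a b c d e f : R) : c <= e -> d <= f ->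
  a + b + c + d <= a + f + b + e.
Proof. by move=> *; lra. Qed.

(** * Supporting paraboloids, from abstract properties of the value function *)

Section Touching.
Variables (R : realType) (n : nat) (Om : set 'rV[R]_n).
Variables (L : 'rV[R]_n * 'rV[R]_n -> R) (g u : 'rV[R]_n -> R).
(** [W y x c] stands for the inequality between [Phi] from [y] to [x] and the real [c]; as a
    relation it keeps extended reals out of this section. [q] will be the gradient of [L] in the
    position. *)
Variables (W : 'rV[R]_n -> 'rV[R]_n -> R -> Prop).
Variables (q : 'rV[R]_n -> 'rV[R]_n -> 'rV[R]_n).
Variables (M B K alpha nu rho C2 Ub : R).
Implicit Types (x y v h D : 'rV[R]_n).
Hypothesis oOm : open Om.
Hypothesis M1 : 1 <= M.
Hypothesis K0 : 0 < K.
Hypothesis alpha0 : 0 < alpha.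
Hypothesis nu01 : 0 <= nu < 1.
Hypothesis rho0 : 0 < rho.
Hypothesis C20 : 0 <= C2.
Hypothesis LA : forall x v, alpha <= L (x, v).
Hypothesis LB : forall x v, enorm v <= M -> L (x, v) <= B.
Hypothesis LT : forall x v D, closure Om x -> enorm v <= M -> enorm D <= 2 ->
  L (x + D, v) <= L (x, v) + dotp (q x v) D + K * enorm D ^+ 2.
Hypothesis qK : forall x v, closure Om x -> enorm v <= M -> enorm (q x v) <= K.
Hypothesis gflat : forall x y, frontier Om x -> frontier Om y ->
  g x <= g y + C2 * enorm (x - y) ^+ 2.
Hypothesis ufr : forall y, frontier Om y -> u y = g y.
Hypothesis uUb : forall x, closure Om x -> `|u x| <= Ub.
Hypothesis ustep : forall x v (t b : R), 0 <= t ->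
  (forall s : R, 0 <= s <= t -> closure Om (x + s *: v)) ->
  (forall s : R, 0 <= s <= t -> L (x + s *: v, v) <= b) ->
  u (x + t *: v) <= u x + t * b.
Hypothesis Wrefl : forall y, frontier Om y -> W y y 0.
Hypothesis Wstep : forall y x v (c t b : R), W y x c -> 0 <= t ->
  (forall s : R, 0 <= s <= t -> closure Om (x + s *: v)) ->
  (forall s : R, 0 <= s <= t -> L (x + s *: v, v) <= b) ->
  W y (x + t *: v) (c + t * b).
Hypothesis Wg : forall y1 y2 (c : R), frontier Om y1 -> frontier Om y2 ->
  W y2 y1 c -> g y1 <= g y2 + nu * c.
Hypothesis ext : forall x, frontier Om x -> exists x0,
  enorm (x - x0) <= rho /\ eclosed_ball x0 rho `<=` ~` Om.

Ltac slra := move: M1 K0 alpha0 rho0 C20; lra.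

Lemma frontier_closure x : frontier Om x -> closure Om x.
Proof. by case. Qed.

Lemma frontier_notin x : frontier Om x -> ~ Om x.
Proof. by move=> [_ h] Ox; apply: h; rewrite /interior; apply: open_nbhs_nbhs. Qed.

Lemma frontierP x : closure Om x -> ~ Om x -> frontier Om x.
Proof. by move=> cx nx; split => // /interior_subset. Qed.

Lemma B_gt0 : 0 < B.
Proof.
have /(LB 0) : enorm (0 : 'rV[R]_n) <= M.
  by rewrite enorm0; move: M1; slra.
by have := LA 0 0; move: alpha0; slra.
Qed.

Lemma u_unit x y : (forall s : R, 0 <= s <= 1 -> closure Om (x + s *: (y - x))) ->
  u y <= u x + B * enorm (y - x).
Proof.
move=> cl; have [v v1 [yE sv]] := unit_param x y; have vM := le_trans v1 M1.
rewrite {1}yE (mulrC B); apply: ustep; first exact: enorm_ge0.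
  by move=> s /sv[r r01 ->]; exact: cl.
by move=> s _; exact: LB.
Qed.

Lemma W_unit y0 x y (c : R) : W y0 x c ->
  (forall s : R, 0 <= s <= 1 -> closure Om (x + s *: (y - x))) ->
  W y0 y (c + B * enorm (y - x)).
Proof.
move=> Wc cl; have [v v1 [yE sv]] := unit_param x y; have vM := le_trans v1 M1.
rewrite {1}yE (mulrC B); apply: Wstep => //; first exact: enorm_ge0.
  by move=> s /sv[r r01 ->]; exact: cl.
by move=> s _; exact: LB.
Qed.

Lemma seg_rev x b : (forall s : R, 0 <= s <= 1 -> closure Om (b + s *: (x - b))) ->
  forall s : R, 0 <= s <= 1 -> closure Om (x + s *: (b - x)).
Proof.
move=> cl s s01; have := cl (1 - s).
have -> : b + (1 - s) *: (x - b) = x + s *: (b - x).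
  by apply/rowP => i; rewrite !mxE; ring.
by apply; slra.
Qed.

(** Taylor expansion for the increment [D + s *: v]. Its linear part in [s *: v] is at most
    [K * eta], its quadratic part at most [2 * K * (d ^+ 2 + eta ^+ 2)], and [eta ^+ 2 <= eta]; this
    is the origin of the 3. *)
Lemma seg_cost x v D (s d eta : R) : closure Om x -> enorm v <= M ->
  enorm D <= d -> d <= 1 -> 0 <= s -> s * M <= eta -> eta <= 1 ->
  L (x + D + s *: v, v) <=
    L (x, v) + dotp (q x v) D + K * (3 * eta + 2 * d ^+ 2).
Proof.
move=> cx vM Dd d1 s0 sM e1.
have sv : enorm (s *: v) <= eta.
  by rewrite enormZ ger0_norm// (le_trans _ sM)// ler_wpM2l.
have DD : enorm (D + s *: v) <= 2.
  by apply: (le_trans (enormD _ _)); slra.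
have := LT cx vM DD; rewrite addrA dotpDr.
have qs : dotp (q x v) (s *: v) <= K * eta.
  apply: (le_trans (dotp_le _ _)); apply: ler_pM; rewrite ?enorm_ge0//.
  exact: qK.
have := sqr_enormD_le Dd sv => h1.
have eta0 : 0 <= eta by apply: le_trans sv; exact: enorm_ge0.
have h2 : K * enorm (D + s *: v) ^+ 2 <= K * (2 * d ^+ 2 + 2 * eta).
  rewrite ler_pM2l//; apply: (le_trans h1); rewrite lerD2l ler_pM2l//.
  by rewrite expr2 ler_piMr.
by move=> h; slra.
Qed.

(** Bounds the duration [T] of an almost optimal polygon, whose cost lies between [alpha * T] and
    [2 * Ub + 1]. *)
Definition Tmax := (2 * Ub + 1) / alpha.
(* A point reached at time [t] lies at distance at least [t / c1] from the
   boundary, up to the accuracy of the polygon. *)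
Definition c1 := (3 + 2 * B) / (alpha * (1 - nu)).
(* Below [T0] the time makes the displacement transversal to the exterior ball,
   with slope [c3]; [C4] is the second-order correction of the dilation factor,
   [c6] and [c7] bound the change of duration and the displacement, per unit of
   [h]; [E1] and [E2] collect the errors in [|h|^2] and in [theta]. *)
Definition c3 := rho / (4 * c1).
Definition cc := 1 + M * rho / c3.
Definition C4 := 2 * cc ^+ 2 / c3.
Definition T0 := rho / (2 * c1 * M ^+ 2).
Definition c6 := rho / c3 + C4.
Definition c7 := 1 + M * c6.
(** [x1] and [x2] are the coefficients of [|h|] and of [theta] in the bound [X] of [exit_poly], for
    [d = c7 * |h|] and [eta = theta]. *)
Definition x1 := c7 * (1 + M * c1).
Definition x2 := 1 + 2 * M * c1.
Definition E1 := 2 * C2 * x1 ^+ 2 + B * C4 + C4 * K * M * T0 + K * c6 + K * M * c6 ^+ 2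
  + 2 * (T0 + c6) * K * c7 ^+ 2.
Definition E2 := 2 * C2 * x2 ^+ 2 + 3 * K * (T0 + c6).

Lemma c1_gt0 : 0 < c1.
Proof.
case/andP: nu01 => nu0 nu1; have := B_gt0 => b0.
by rewrite /c1 divr_gt0 ?mulr_gt0//; slra.
Qed.

Lemma consts_gt0 : [/\ 0 < c1, 0 < c3, 1 <= cc, 0 < C4 & 0 < T0].
Proof.
have M0 : 0 < M by slra.
have cp := c1_gt0; have c30 : 0 < c3 by rewrite /c3 divr_gt0// mulr_gt0.
have c1_ : 1 <= cc by rewrite /cc lerDl ltW// divr_gt0// mulr_gt0.
split => //; first by rewrite /C4 divr_gt0// mulr_gt0// exprn_gt0//; lra.
by rewrite /T0; apply: divr_gt0 => //; apply: mulr_gt0; [exact: mulr_gt0|exact: exprn_gt0].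
Qed.

Lemma consts2 : [/\ 0 < c6, 1 <= c7, 0 < x1, 0 < x2 & 0 < M].
Proof.
have M0 : 0 < M by slra.
have [cp c30 cc1 C40 T00] := consts_gt0.
have c60 : 0 < c6 by rewrite /c6 addr_gt0// divr_gt0.
have c71 : 1 <= c7 by rewrite /c7 lerDl mulr_ge0// ltW.
have Mc : 0 < M * c1 by rewrite mulr_gt0.
split => //; first by rewrite /x1 mulr_gt0//; lra.
by rewrite /x2; lra.
Qed.

(** * Estimates along one almost optimal polygon *)

Section Path.
(** Two scales: [eps] bounds the durations of the edges and the gap to optimality, while [theta]
    dominates every accumulated error. Both may be taken small depending on the end point of the
    polygon. *)
Variables (eps theta : R) (p v : nat -> 'rV[R]_n) (tau : nat -> R) (N : nat).
Hypothesis poly : polygon Om M eps p tau v N.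
Hypothesis epsM : M * eps <= theta.
Hypothesis theta1 : theta <= 1.
Hypothesis eps0 : 0 < eps.
Hypothesis smallerr : 3 * K * (M * eps) * Tmax <= theta.

Definition Ti i := \sum_(j < i) tau j.
(** Cost with [L] frozen at the start of each edge; by [step_cost] the true action exceeds it by at
    most [3 * K * (M * eps)] per unit of time. *)
Definition Si i := \sum_(j < i) tau j * L (p j, v j).
Hypothesis opt : g (p 0) + Si N <= u (p N) + eps.

Ltac plra := move: M1 K0 alpha0 rho0 C20 epsM theta1 eps0 opt; lra.

Lemma TiS i : Ti i.+1 = Ti i + tau i.
Proof. by rewrite /Ti big_ord_recr. Qed.

Lemma SiS i : Si i.+1 = Si i + tau i * L (p i, v i).
Proof. by rewrite /Si big_ord_recr. Qed.

Lemma tau_ge0 i : (i < N)%N -> 0 <= tau i.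
Proof. by move=> iN; have [_ /(_ i iN)[/andP[]]] := poly. Qed.

Lemma p_closure i : (i <= N)%N -> closure Om (p i).
Proof.
case: i => [_|i iN]; first by case: poly => [[]].
have [_ /(_ i iN)[t0e _ -> cl]] := poly.
by apply: cl; case/andP: t0e => -> _; rewrite lexx.
Qed.

Lemma Ti_mono i j : (i <= j)%N -> (j <= N)%N -> Ti i <= Ti j.
Proof.
elim: j => [|j IH]; first by rewrite leqn0 => /eqP ->.
rewrite leq_eqVlt => /predU1P[->//|]; rewrite ltnS => ij jN.
by rewrite TiS ler_wpDr ?tau_ge0// IH// ltnW.
Qed.

Lemma Ti_ge0 i : (i <= N)%N -> 0 <= Ti i.
Proof. by move=> iN; have := Ti_mono (leq0n i) iN; rewrite {1}/Ti big_ord0. Qed.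

Lemma Si_incr i j : (i <= j)%N -> (j <= N)%N ->
  alpha * (Ti j - Ti i) <= Si j - Si i.
Proof.
elim: j => [|j IH]; first by rewrite leqn0 => /eqP -> _; rewrite !subrr mulr0.
rewrite leq_eqVlt => /predU1P[-> _|]; first by rewrite !subrr mulr0.
rewrite ltnS => ij jN; have := IH ij (ltnW jN).
rewrite TiS SiS; have := ler_wpM2l (tau_ge0 jN) (LA (p j) (v j)); plra.
Qed.

Lemma Si_ge i : (i <= N)%N -> alpha * Ti i <= Si i.
Proof.
by move=> /(Si_incr (leq0n i)); rewrite /Ti /Si !big_ord0 !subr0.
Qed.

Lemma TN_le : Ti N <= Tmax.
Proof.
rewrite ler_pdivlMr// mulrC; apply: (le_trans (Si_ge (leqnn N))).
have := uUb (p_closure (leqnn N)); have := uUb (p_closure (leq0n N)).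
have [f0 _] := poly; rewrite (ufr f0) !ler_norml => /andP[h1 _] /andP[_ h2].
have eps1 : eps <= 1 by have := ler_peMl (ltW eps0) M1; plra.
by plra.
Qed.

Lemma err_le i : (i <= N)%N -> 3 * K * (M * eps) * Ti i <= theta.
Proof.
move=> iN; apply: le_trans smallerr; rewrite ler_wpM2l//.
  by rewrite !mulr_ge0// ?(ltW K0) ?(ltW eps0)//; plra.
by apply: le_trans TN_le; exact: Ti_mono.
Qed.

Lemma step_cost i (s : R) : (i < N)%N -> 0 <= s <= tau i ->
  L (p i + s *: v i, v i) <= L (p i, v i) + 3 * K * (M * eps).
Proof.
move=> iN /andP[s0 st]; have [_ /(_ i iN)[/andP[t0 te] vM _ _]] := poly.
have := @seg_cost (p i) (v i) 0 s 0 (M * eps) (p_closure (ltnW iN)) vM.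
rewrite enorm0 addr0 dotp0r expr0n /= mulr0 !addr0 => h.
apply: (le_trans (h _ _ s0 _ _)) => //; last by plra.
- by rewrite mulrC ler_wpM2l//; [plra|exact: le_trans te].
- by have := epsM; plra.
Qed.

Lemma W_poly i : (i <= N)%N -> W (p 0) (p i) (Si i + 3 * K * (M * eps) * Ti i).
Proof.
elim: i => [_|i IH iN].
  by rewrite /Si /Ti !big_ord0 mulr0 addr0; apply: Wrefl; case: poly.
have [_ /(_ i iN)[/andP[t0 te] vM -> cl]] := poly.
have := Wstep (IH (ltnW iN)) t0 cl (fun s => @step_cost i s iN).
by rewrite SiS TiS; congr W; ring.
Qed.

Lemma u_poly i j : (i <= j)%N -> (j <= N)%N ->
  u (p j) <= u (p i) + (Si j - Si i) + 3 * K * (M * eps) * (Ti j - Ti i).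
Proof.
elim: j => [|j IH]; first by rewrite leqn0 => /eqP -> _; rewrite !subrr; plra.
rewrite leq_eqVlt => /predU1P[-> _|]; first by rewrite !subrr; plra.
rewrite ltnS => ij jN; have {}IH := IH ij (ltnW jN).
have [_ /(_ j jN)[/andP[t0 te] vM -> cl]] := poly.
have := ustep t0 cl (fun s => @step_cost j s jN).
by rewrite SiS TiS; plra.
Qed.

(* By (G1) with [nu < 1], leaving through a nearby boundary point instead of
   following the polygon would otherwise be cheaper. *)
Lemma Ti_dist i b : (i <= N)%N -> frontier Om b ->
  (forall s : R, 0 <= s <= 1 -> closure Om (b + s *: (p i - b))) ->
  Ti i <= c1 * (enorm (p i - b) + theta).
Proof.
move=> iN fb cl; case/andP: nu01 => nu0 nu1.
have := u_unit cl; rewrite (ufr fb); set d := enorm (p i - b) => h1.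
have := W_unit (W_poly iN) (seg_rev cl); rewrite enormBC -/d.
case: (poly) => f0 _ /(Wg fb f0) h2.
have h3 := u_poly iN (leqnn N).
have h4 := err_le iN; have h5 := err_le (leqnn N); have h6 := Si_ge iN.
have T0 := Ti_ge0 iN.
have e0 : 0 <= 3 * K * (M * eps) * Ti i.
  by rewrite !mulr_ge0// ?(ltW K0) ?(ltW eps0)//; plra.
have eps1 : eps <= theta by have := ler_peMl (ltW eps0) M1; plra.
have d0 : 0 <= B * d by rewrite mulr_ge0 ?(ltW B_gt0)// enorm_ge0.
have S0 : 0 <= Si i by apply: le_trans h6; rewrite mulr_ge0// ltW.
have th0 : 0 <= theta by plra.
rewrite /c1 mulrAC ler_pdivlMr; last by rewrite mulr_gt0// subr_gt0.
(* Optimality with [h1] and [h3] gives [Si i <= g b - g (p 0) + B * d + 2 * theta]. Following the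
   polygon to [p i] and then going to [b] gives, through [h2], a bound of [g b - g (p 0)] by [nu]
   times the cost of that path. The terms in [Si i] are then gathered. *)
have h7 : (1 - nu) * Si i <= 3 * theta + 2 * (B * d).
  have : nu * (3 * K * (M * eps) * Ti i + B * d) <= theta + B * d.
    apply: (@le_trans _ _ (1 * (3 * K * (M * eps) * Ti i + B * d))); last by plra.
    by rewrite ler_wpM2r//; plra.
  move: h2 h1 h3 h4 h5; plra.
have h8 : (1 - nu) * (alpha * Ti i) <= (1 - nu) * Si i by rewrite ler_wpM2l//; plra.
have Bt : 0 <= B * theta by rewrite mulr_ge0 ?(ltW B_gt0).
have dd : 0 <= d by exact: enorm_ge0.
by plra.
Qed.

Lemma disp i k : (i <= k)%N -> (k <= N)%N ->
  enorm (p k - p i) <= M * (Ti k - Ti i).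
Proof.
elim: k => [|k IH]; first by rewrite leqn0 => /eqP -> _; rewrite !subrr enorm0 mulr0.
rewrite leq_eqVlt => /predU1P[-> _|]; first by rewrite !subrr enorm0 mulr0.
rewrite ltnS => ik kN; have {}IH := IH ik (ltnW kN).
have [_ /(_ k kN)[/andP[t0 te] vM -> cl]] := poly.
rewrite addrAC; apply: (le_trans (enormD _ _)).
rewrite enormZ ger0_norm// TiS; have := ler_wpM2l t0 vM; lra.
Qed.

(** The radial projection of [p k] on the ball is outside [Om], so a frontier point lies within
    [r - rho] of [p k], and [Ti_dist] makes [r - rho] at least [Ti k / (2 * c1)]. Expanding [r ^+ 2]
    around [p 0] turns this into a lower bound on the scalar product, the square of the displacement
    being absorbed because [Ti k] is small. *)
Lemma transversal k x0 : (k <= N)%N -> enorm (p 0 - x0) <= rho ->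
  eclosed_ball x0 rho `<=` ~` Om -> 0 < Ti k ->
  theta <= Ti k / (2 * c1) -> Ti k <= rho / (2 * c1 * M ^+ 2) ->
  [/\ enorm (p 0 - x0) = rho, enorm (p k - p 0) <= M * Ti k &
      rho / (4 * c1) * Ti k <= dotp (p k - p 0) (p 0 - x0)].
Proof.
move=> kN h0 sub T0 thT TT0; have cp := c1_gt0.
have pE : enorm (p 0 - x0) = rho.
  by apply/eqP; rewrite eq_le h0 (closure_out_ball sub (p_closure (leq0n N))).
have pkM : enorm (p k - p 0) <= M * Ti k.
  by have := disp (leq0n k) kN; rewrite {2}/Ti big_ord0 subr0.
split => //.
set r := enorm (p k - x0).
have rr : rho <= r := closure_out_ball sub (p_closure kN).
have r0 : 0 < r by apply: lt_le_trans rr.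
pose y := x0 + (rho / r) *: (p k - x0).
have ny : ~ Om y.
  apply: sub; rewrite /eclosed_ball /= /y addrAC subrr add0r enormZ -/r.
  by rewrite gtr0_norm ?divr_gt0// divfK// gt_eqF.
have [b [fb bd bcl _]] := seg_exit_dist oOm (p_closure kN) ny.
have yE : enorm (p k - y) = r - rho.
  have -> : p k - y = (1 - rho / r) *: (p k - x0).
    by rewrite /y scalerBl scale1r opprD addrA.
  rewrite enormZ -/r ger0_norm; last by rewrite subr_ge0 ler_pdivrMr// mul1r.
  by rewrite mulrBl mul1r divfK// gt_eqF.
have := Ti_dist kN fb bcl.
have h1 : Ti k / (2 * c1) * (2 * c1) = Ti k by rewrite divfK// gt_eqF// mulr_gt0.
have h2 : theta * (2 * c1) <= Ti k by rewrite -h1 ler_wpM2r//; lra.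
have h3 : c1 * enorm (p k - b) <= c1 * (r - rho).
  by rewrite ler_pM2l//; apply: (le_trans bd); rewrite yE.
move=> h4; have h5 : Ti k <= 2 * c1 * (r - rho) by lra.
have h6 : Ti k / (2 * c1) <= r - rho.
  by rewrite ler_pdivrMr; [rewrite mulrC|rewrite mulr_gt0].
have h7 : r ^+ 2 = enorm (p k - p 0) ^+ 2 + 2 * dotp (p k - p 0) (p 0 - x0) + rho ^+ 2.
  by rewrite /r -pE -sqr_enormD addrA subrK.
have h8 : (rho + Ti k / (2 * c1)) ^+ 2 <= r ^+ 2.
  have hh : 0 <= rho + Ti k / (2 * c1).
    have : 0 < Ti k / (2 * c1) by rewrite divr_gt0// mulr_gt0.
    by plra.
  by rewrite ler_pXn2r ?nnegrE ?(ltW r0)//; lra.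
have h9 : enorm (p k - p 0) ^+ 2 <= M ^+ 2 * Ti k * Ti k.
  rewrite -mulrA -expr2 -exprMn ler_pXn2r ?nnegrE ?enorm_ge0//.
  by rewrite mulr_ge0 ?(ltW T0)//; plra.
have M20 : 0 < M ^+ 2 by rewrite exprn_gt0//; plra.
have h10 : M ^+ 2 * Ti k <= rho / (2 * c1).
  have : M ^+ 2 * Ti k <= M ^+ 2 * (rho / (2 * c1 * M ^+ 2)) by rewrite ler_pM2l.
  have -> // : M ^+ 2 * (rho / (2 * c1 * M ^+ 2)) = rho / (2 * c1).
  by field; rewrite !gt_eqF//; plra.
have h11 : M ^+ 2 * Ti k * Ti k <= rho / (2 * c1) * Ti k by rewrite ler_wpM2r// ltW.
have h12 : 0 <= (Ti k / (2 * c1)) ^+ 2 by exact: sqr_ge0.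
have h13 : rho * (Ti k / (2 * c1)) = 2 * (rho / (4 * c1) * Ti k).
  by field; rewrite gt_eqF.
have h14 : rho / (2 * c1) * Ti k = 2 * (rho / (4 * c1) * Ti k).
  by field; rewrite gt_eqF.
have h15 : (rho + Ti k / (2 * c1)) ^+ 2 =
  rho ^+ 2 + 2 * (rho * (Ti k / (2 * c1))) + (Ti k / (2 * c1)) ^+ 2 by ring.
by lra.
Qed.

(* Last exit of a perturbed polygon: the part before it is dropped, at the cost
   of a second-order change of [g]. *)
Lemma exit_poly (kap : R) (p' : nat -> 'rV[R]_n) k (d eta : R)
    (X := d + eta + M * (c1 * (d + eta + theta))) : (k <= N)%N -> 0 < kap ->
  ~ Om (p' 0) -> (forall i, (i < k)%N -> p' i.+1 = p' i + (kap * tau i) *: v i) ->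
  (forall i, (i <= k)%N -> enorm (p' i - p i) <= d) -> d <= 1 ->
  kap * (M * eps) <= eta -> eta <= 1 ->
  forall i, (i <= k)%N -> closure Om (p' i) ->
  u (p' i) <= g (p 0) + C2 * X ^+ 2 + \sum_(j < i) kap * tau j *
    (L (p j, v j) + dotp (q (p j) (v j)) (p' j - p j) + K * (3 * eta + 2 * d ^+ 2)).
Proof.
move=> kN kap0 np0 pS pd d1 ke e1.
have cp := c1_gt0.
have d0 : 0 <= d by apply: le_trans (pd 0 _); rewrite ?enorm_ge0.
have eta0 : 0 <= eta.
  by apply: le_trans ke; rewrite !mulr_ge0 ?(ltW kap0) ?(ltW eps0)//; plra.
have th0 : 0 <= theta.
  by apply: le_trans epsM; rewrite mulr_ge0 ?(ltW eps0)//; plra.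
have cc : 0 <= c1 * (d + eta + theta) by rewrite mulr_ge0// ?(ltW cp)//; lra.
have M0 : 0 <= M by plra.
have cM : 0 <= M * (c1 * (d + eta + theta)) by exact: mulr_ge0.
have X0 : 0 <= X by rewrite /X; lra.
have gX b : frontier Om b -> enorm (b - p 0) <= X ->
    g b <= g (p 0) + C2 * X ^+ 2.
  move=> fb hb; have [f0 _] := poly; apply: (le_trans (gflat fb f0)).
  by rewrite lerD2l ler_wpM2l// ler_pXn2r ?nnegrE ?enorm_ge0.
have cost j (s : R) : (j < k)%N -> 0 <= s <= kap * tau j ->
    L (p' j + s *: v j, v j) <= L (p j, v j) + dotp (q (p j) (v j)) (p' j - p j)
      + K * (3 * eta + 2 * d ^+ 2).
  move=> jk /andP[s0 st]; have jN := leq_trans jk kN.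
  have [_ /(_ j jN)[/andP[t0 te] vM _ _]] := poly.
  have := @seg_cost (p j) (v j) (p' j - p j) s d eta (p_closure (ltnW jN)) vM
            (pd j (ltnW jk)) d1 s0.
  rewrite subrKC; apply => //; apply: le_trans ke.
  rewrite (mulrC M) mulrA ler_wpM2r//.
  by apply: (le_trans st); rewrite ler_pM2l.
have cost0 j : (j < k)%N -> 0 <= L (p j, v j) +
    dotp (q (p j) (v j)) (p' j - p j) + K * (3 * eta + 2 * d ^+ 2).
  move=> jk; apply: le_trans (cost j 0 jk _); last first.
    by rewrite lexx mulr_ge0 ?(ltW kap0)// tau_ge0// (leq_trans jk).
  by apply: le_trans (LA _ _); exact: ltW.
(* [p' 0] is not in [Om], so if it is in the closure it is on the frontier. An edge contained in the
   closure extends the previous bound. On any other edge the estimate restarts from a frontier point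
   [b] after which the edge stays in the closure, the sum over the earlier edges being
   nonnegative. *)
elim=> [_ cl|i IH ik cl].
  rewrite big_ord0 addr0 ufr; last exact: frontierP.
  apply: gX; first exact: frontierP.
  by apply: (le_trans (pd 0 _)) => //; rewrite /X; lra.
rewrite big_ord_recr /=.
set Q := L _ + _ + _; set Sg := \sum_(_ < _) _.
have Sg0 : 0 <= Sg.
  apply: sumr_ge0 => j _; have jk : (j < k)%N := ltn_trans (ltn_ord j) ik.
  rewrite mulr_ge0 ?cost0// mulr_ge0 ?(ltW kap0)// tau_ge0//.
  exact: leq_trans kN.
have iN := leq_trans ik kN.
have t0 := tau_ge0 iN.
have kt0 : 0 <= kap * tau i by rewrite mulr_ge0// ltW.
have Q0 : 0 <= Q := cost0 i ik.
have [cls|/existsNP[s /not_implyP[s01 ns]]] := pselect (forall s : R,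
    0 <= s <= kap * tau i -> closure Om (p' i + s *: v i)).
  have cli : closure Om (p' i).
    by have := cls 0; rewrite scale0r addr0; apply; rewrite lexx.
  have := ustep kt0 cls (fun s => @cost i s ik); rewrite -/Q -pS//.
  by have := IH (ltnW ik) cli; rewrite -/Sg; lra.
case/andP: s01 => s0 s1.
have nOs : ~ Om (p' i + s *: v i) by move=> /subset_closure.
have [t [/andP[t0' t1] fb bcl _]] := seg_exit oOm cl nOs.
pose s' := s + t * (kap * tau i - s).
have bE (r : R) : p' i + s *: v i + r *: (p' i.+1 - (p' i + s *: v i)) =
    p' i + (s + r * (kap * tau i - s)) *: v i.
  by rewrite pS//; apply/rowP => j; rewrite !mxE; ring.
rewrite bE -/s' in fb bcl.
have ks0 : 0 <= kap * tau i - s by lra.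
have s's : s <= s' by rewrite lerDl mulr_ge0.
have s'1 : s' <= kap * tau i.
  by have := mulr_ge0 (_ : 0 <= 1 - t) ks0; rewrite subr_ge0 /s' => /(_ t1); lra.
set b := p' i + s' *: v i in fb.
have pE : p' i.+1 = b + (kap * tau i - s') *: v i.
  by rewrite pS// /b; apply/rowP => j; rewrite !mxE; ring.
have [_ /(_ i iN)[/andP[_ te] vM _ _]] := poly.
have bpi : enorm (b - p i) <= d + eta.
  have -> : b - p i = (p' i - p i) + s' *: v i by rewrite /b addrAC.
  apply: (le_trans (enormD _ _)); apply: lerD; first exact: pd (ltnW ik).
  rewrite enormZ ger0_norm; last by lra.
  apply: le_trans ke; rewrite (mulrC M) mulrA; apply: ler_pM => //.
  - by lra.
  - exact: enorm_ge0.
  - by apply: (le_trans s'1); rewrite ler_pM2l.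
(* Since [b] is close to [p i], [Ti_dist] makes the elapsed time [Ti i] small, and the speed bound
   brings [p i] back near [p 0]. The point [b0] replaces [b] because [Ti_dist] asks for a segment in
   the closure. *)
have [b0 [fb0 b0d b0cl _]] := seg_exit_dist oOm (p_closure (ltnW iN)) (frontier_notin fb).
have Ti_b := Ti_dist (ltnW iN) fb0 b0cl.
have Ti_b' : Ti i <= c1 * (d + eta + theta).
  apply: (le_trans Ti_b); rewrite ler_pM2l// lerD2r.
  by apply: (le_trans b0d); rewrite enormBC.
have bX : enorm (b - p 0) <= X.
  apply: (le_trans (enorm_tri (p i) _ _)); apply: lerD => //.
  have := disp (leq0n i) (ltnW iN); rewrite {2}/Ti big_ord0 subr0.
  by move=> /le_trans; apply; rewrite ler_wpM2l.
rewrite pE.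
have : u (b + (kap * tau i - s') *: v i) <= u b + (kap * tau i - s') * Q.
  apply: ustep; first by rewrite subr_ge0.
  - move=> r /andP[r0 r1].
    have [ks|ks] := eqVneq (kap * tau i - s) 0.
      have -> : r = 0 by apply/eqP; rewrite eq_le r0 andbT; move: r1 s's ks; lra.
      by rewrite scale0r addr0; exact: frontier_closure.
    have ks' : 0 < kap * tau i - s by rewrite lt_neqAle eq_sym ks.
    have := bcl (t + r / (kap * tau i - s)).
    rewrite bE mulrDl divfK// addrA -/s' scalerDl addrA; apply.
    apply/andP; split; first by rewrite lerDl divr_ge0.
    rewrite -(ler_pM2r ks') mulrDl divfK// mul1r; by move: r1; rewrite /s'; lra.
  - move=> r /andP[r0 r1].
    have := cost i (s' + r) ik; rewrite scalerDl addrA; apply.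
    by apply/andP; split; lra.
rewrite (ufr fb); have := gX b fb bX.
have : (kap * tau i - s') * Q <= kap * tau i * Q by rewrite ler_wpM2r//; lra.
lra.
Qed.

(** First-order coefficients of the cost: [Pi] for a translation of the vertices, and [Zi k] for a
    dilation about [p k]. *)
Definition Pi i := \sum_(j < i) tau j *: q (p j) (v j).
Definition Zi k := \sum_(j < k) tau j * dotp (q (p j) (v j)) (p j - p k).

Lemma PiS i : Pi i.+1 = Pi i + tau i *: q (p i) (v i).
Proof. by rewrite /Pi big_ord_recr. Qed.

Lemma Pi_le i : (i <= N)%N -> enorm (Pi i) <= K * Ti i.
Proof.
elim: i => [_|i IH iN]; first by rewrite /Pi /Ti !big_ord0 enorm0 mulr0.
have [_ /(_ i iN)[/andP[t0 te] vM _ _]] := poly.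
rewrite PiS TiS mulrDr; apply: (le_trans (enormD _ _)).
apply: lerD; first exact: IH (ltnW iN).
rewrite enormZ ger0_norm// mulrC ler_wpM2r//; apply: qK => //.
exact: p_closure (ltnW iN).
Qed.

Lemma Si_le i : (i <= N)%N -> Si i <= B * Ti i.
Proof.
elim: i => [_|i IH iN]; first by rewrite /Si /Ti !big_ord0 mulr0.
have [_ /(_ i iN)[/andP[t0 te] vM _ _]] := poly.
rewrite SiS TiS mulrDr; apply: lerD; first exact: IH (ltnW iN).
by rewrite mulrC ler_wpM2r// LB.
Qed.

Lemma Zi_le k : (k <= N)%N -> `|Zi k| <= K * M * Ti k ^+ 2.
Proof.
move=> kN; apply: (le_trans (ler_norm_sum _ _ _)).
have Tk := Ti_ge0 kN.
rewrite expr2 mulrA {2}/Ti mulr_sumr.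
have MT : 0 <= M * Ti k by rewrite mulr_ge0//; plra.
apply: ler_sum => j _.
have jN := leq_trans (ltn_ord j) kN.
have [_ /(_ j jN)[/andP[t0 te] vM _ _]] := poly.
rewrite normrM ger0_norm// mulrC ler_wpM2r//.
apply: (le_trans (ler_norm_dotp _ _)); rewrite -mulrA.
apply: ler_pM; rewrite ?enorm_ge0//.
  by apply: qK => //; exact: p_closure (ltnW jN).
rewrite enormBC; apply: (le_trans (disp (ltnW (ltn_ord j)) kN)).
by have := ler_wpM2l (_ : 0 <= M) (Ti_ge0 (ltnW jN)); rewrite mulr0; plra.
Qed.

(** [exit_poly] is applied to the dilated polygon, whose start [tangent_dilation] puts in the
    exterior ball. The quotient of scalar products is the first-order change of the durations. *)
Lemma phase1 k h : (k <= N)%N -> 0 < Ti k -> Ti k <= T0 ->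
  theta <= Ti k / (2 * c1) -> (1 + c6 / Ti k) * (M * eps) <= theta ->
  closure Om (p k + h) -> 0 < enorm h ->
  2 * cc / c3 * M * enorm h <= 1 -> c7 * enorm h <= 1 ->
  forall N0 x0, N0 = p 0 - x0 -> enorm N0 <= rho ->
  eclosed_ball x0 rho `<=` ~` Om ->
  u (p k + h) <= g (p 0) + Si k +
    (dotp (Pi k) h + (Si k + Zi k) * (dotp h N0 / dotp (p k - p 0) N0))
    + E1 * enorm h ^+ 2 + E2 * theta.
Proof.
move=> kN Tk0 TkT thT eT clh h0 hs hs7 N0 x0 N0E N0r sub.
have [cp c30 cc1 C40 T00] := consts_gt0.
have [c60 c71 x10 x20 M0] := consts2.
have K0' := K0.
rewrite N0E in N0r *.
have [EN wM wN] := transversal kN N0r sub Tk0 thT TkT.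
rewrite -/c3 in wN; rewrite -N0E in EN wN *.
set w := p k - p 0 in wM wN *.
have out : rho <= enorm (N0 + w + h).
  have -> : N0 + w + h = p k + h - x0.
    by rewrite N0E /w; apply/rowP => i; rewrite !mxE; ring.
  exact: closure_out_ball sub clh.
have [] := tangent_dilation rho0 M1 c30 Tk0 EN wN wM h0 hs out.
rewrite -/cc -/C4; set bet := dotp h N0 / dotp w N0.
set gam := C4 * enorm h ^+ 2 / Ti k; set kap := 1 + bet + gam.
move=> kap0 inball betT.
have gamT : gam * Ti k = C4 * enorm h ^+ 2 by rewrite /gam divfK// gt_eqF.
have gam0 : 0 <= gam.
  apply: divr_ge0; last exact: ltW.
  by apply: mulr_ge0; [exact: ltW|exact: sqr_ge0].
have h1 : enorm h <= 1.
  exact: le_trans (ler_peMl (enorm_ge0 h) c71) hs7.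
(* The factor [kap] alone is not controlled when [Ti k] is small compared with [|h|]; this product
   is, uniformly. *)
have kT : `|kap - 1| * Ti k <= c6 * enorm h.
  have -> : kap - 1 = bet + gam by rewrite /kap; ring.
  apply: (@le_trans _ _ ((`|bet| + `|gam|) * Ti k)).
    by rewrite ler_wpM2r ?ler_normD// ltW.
  have hh2 : C4 * enorm h ^+ 2 <= C4 * enorm h.
    by rewrite ler_pM2l// expr2 ler_piMr ?enorm_ge0.
  by rewrite mulrDl (ger0_norm gam0) gamT /c6; lra.
(* Dilation about [p k] followed by the translation by [h]: the velocities are kept, [p k] goes to
   [p k + h], and [p 0] goes into the ball. *)
pose p' i := p k + h + kap *: (p i - p k).
have np0 : ~ Om (p' 0).
  apply: sub; rewrite /eclosed_ball /=.
  have -> // : p' 0 - x0 = N0 + w + h - kap *: w.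
  by rewrite /p' N0E /w; apply/rowP => i; rewrite !mxE; ring.
have pS i : (i < k)%N -> p' i.+1 = p' i + (kap * tau i) *: v i.
  move=> ik; have [_ /(_ i (leq_trans ik kN))[_ _ pE _]] := poly.
  by rewrite /p' pE; apply/rowP => j; rewrite !mxE; ring.
have pD i : p' i - p i = h + (kap - 1) *: (p i - p k).
  by rewrite /p'; apply/rowP => j; rewrite !mxE; ring.
have pd i : (i <= k)%N -> enorm (p' i - p i) <= c7 * enorm h.
  move=> ik; rewrite pD; apply: (le_trans (enormD _ _)).
  rewrite /c7 mulrDl mul1r lerD2l enormZ enormBC.
  have : enorm (p k - p i) <= M * Ti k.
    apply: (le_trans (disp ik kN)); rewrite ler_wpM2l ?(ltW M0)//.
    by have := Ti_ge0 (leq_trans ik kN); lra.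
  move=> /(ler_wpM2l (normr_ge0 (kap - 1))) /le_trans; apply.
  by rewrite mulrCA -mulrA ler_wpM2l// ltW.
have kapT : kap <= 1 + c6 / Ti k.
  have : kap - 1 <= c6 / Ti k.
    rewrite ler_pdivlMr//; apply: (@le_trans _ _ (`|kap - 1| * Ti k)).
      by rewrite ler_wpM2r ?ler_norm// ltW.
    by apply: (le_trans kT); rewrite ler_piMr// ltW.
  by lra.
have ke : kap * (M * eps) <= theta.
  apply: le_trans eT; rewrite ler_wpM2r// mulr_ge0 ?(ltW M0)//.
  exact: ltW eps0.
have pk : p' k = p k + h by rewrite /p' subrr scaler0 addr0.
have := @exit_poly kap p' k (c7 * enorm h) theta kN kap0 np0 pS pd hs7 ke theta1
          k (leqnn k).
rewrite pk => /(_ clh) /le_trans; apply.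
set X := c7 * enorm h + theta + _.
set e := K * (3 * theta + _).
have sumE : \sum_(j < k) kap * tau j * (L (p j, v j)
    + dotp (q (p j) (v j)) (p' j - p j) + e) =
    kap * (Si k + (dotp (Pi k) h + (kap - 1) * Zi k) + Ti k * e).
  rewrite /Si /Zi /Ti mulr_suml dotpC dotp_sumr !mulr_sumr -!big_split /=.
  rewrite mulr_sumr; apply: eq_bigr => j _.
  by rewrite pD dotpDr !dotpZr (dotpC h); ring.
rewrite sumE.
have Xle : X ^+ 2 <= 2 * x1 ^+ 2 * enorm h ^+ 2 + 2 * x2 ^+ 2 * theta.
  have -> : X = x1 * enorm h + x2 * theta by rewrite /X /x1 /x2; ring.
  have th0 : 0 <= theta by apply: le_trans epsM; rewrite mulr_ge0 ?(ltW M0)// ltW.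
  have tt : theta ^+ 2 <= theta by rewrite expr2 ler_piMr.
  have := ler_wpM2l (sqr_ge0 x2) tt.
  by have := sqr_ge0 (x1 * enorm h - x2 * theta); lra.
have {}Xle := ler_wpM2l C20 Xle.
have hh := enorm_ge0 h.
have Tk0' := ltW Tk0.
(* The second-order terms. [S1] and [S2] come from the correction, as [gam * Ti k] equals [C4] times
   the square of [|h|]; [S3] is a product of two first-order quantities; [S4] is the Taylor
   remainder over a total duration of at most [T0 + c6]. *)
have S1 : gam * Si k <= B * C4 * enorm h ^+ 2.
  rewrite -mulrA -gamT mulrCA; apply: ler_wpM2l => //.
  exact: Si_le.
have Zk := Zi_le kN.
have S2 : gam * Zi k <= C4 * K * M * T0 * enorm h ^+ 2.
  apply: (@le_trans _ _ (gam * (K * M * Ti k ^+ 2))).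
    by rewrite ler_wpM2l//; apply: le_trans Zk; exact: ler_norm.
  have -> : gam * (K * M * Ti k ^+ 2) = C4 * K * M * enorm h ^+ 2 * Ti k.
    by rewrite [LHS](_ : _ = gam * Ti k * (K * M * Ti k)); [rewrite gamT; ring|ring].
  rewrite [leRHS]mulrAC; apply: ler_wpM2l => //.
  apply: mulr_ge0; last exact: sqr_ge0.
  by apply: mulr_ge0; [apply: mulr_ge0; exact: ltW|exact: ltW].
have S3 : (kap - 1) * (dotp (Pi k) h + (kap - 1) * Zi k) <=
    (K * c6 + K * M * c6 ^+ 2) * enorm h ^+ 2.
  apply: (@le_trans _ _ (`|kap - 1| * (K * Ti k * enorm h + `|kap - 1| * (K * M * Ti k ^+ 2)))).
    apply: le_trans (ler_norm _) _; rewrite normrM ler_wpM2l//.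
    apply: (le_trans (ler_normD _ _)); apply: lerD; last first.
      by rewrite normrM ler_wpM2l.
    apply: (le_trans (ler_norm_dotp _ _)).
    by rewrite ler_wpM2r//; exact: Pi_le.
  have a1 := ler_wpM2l (mulr_ge0 (ltW K0) hh) kT.
  have a2 : (`|kap - 1| * Ti k) ^+ 2 <= (c6 * enorm h) ^+ 2.
    by rewrite ler_pXn2r ?nnegrE ?mulr_ge0// ltW.
  have := ler_wpM2l (mulr_ge0 (ltW K0) (ltW M0)) a2.
  by lra.
have S4 : kap * (Ti k * e) <= (T0 + c6) * e.
  have e0 : 0 <= e.
    have th0 : 0 <= theta by apply: le_trans epsM; rewrite mulr_ge0 ?(ltW M0)// ltW.
    apply: mulr_ge0; first exact: ltW.
    by apply: addr_ge0; apply: mulr_ge0 => //; exact: sqr_ge0.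
  rewrite mulrA ler_wpM2r//.
  have : (kap - 1) * Ti k <= c6.
    apply: (@le_trans _ _ (`|kap - 1| * Ti k)); first by rewrite ler_wpM2r// ler_norm.
    by apply: (le_trans kT); rewrite ler_piMr// ltW.
  by lra.
have eE : (T0 + c6) * e = 2 * (T0 + c6) * K * c7 ^+ 2 * enorm h ^+ 2 + 3 * K * (T0 + c6) * theta.
  by rewrite /e; ring.
have E1E : E1 * enorm h ^+ 2 = 2 * C2 * x1 ^+ 2 * enorm h ^+ 2 + B * C4 * enorm h ^+ 2
   + C4 * K * M * T0 * enorm h ^+ 2 + (K * c6 + K * M * c6 ^+ 2) * enorm h ^+ 2
   + 2 * (T0 + c6) * K * c7 ^+ 2 * enorm h ^+ 2 by rewrite /E1; ring.
have E2E : E2 * theta = 2 * C2 * x2 ^+ 2 * theta + 3 * K * (T0 + c6) * theta.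
  by rewrite /E2; ring.
rewrite eE in S4; rewrite E1E E2E.
have kE : kap * (Si k + (dotp (Pi k) h + (kap - 1) * Zi k) + Ti k * e) =
  Si k + (dotp (Pi k) h + (Si k + Zi k) * bet) + gam * Si k + gam * Zi k +
  (kap - 1) * (dotp (Pi k) h + (kap - 1) * Zi k) + kap * (Ti k * e).
  by rewrite /kap; ring.
rewrite kE; move: S1 S2 S3 S4 Xle.
set t1 := gam * Si k; set t2 := gam * Zi k; set t3 := (kap - 1) * (_ + _).
set t4 := kap * (Ti k * e); set t5 := dotp (Pi k) h + _.
lra.
Qed.

(** Otherwise a frontier point would lie within [|h| + theta] of [p i], and [Ti_dist] would make
    [Ti i] smaller than [Ti k]. The alternative [s == 0] covers the last vertex, which starts no
    edge. *)
Lemma phase2_closure k i h (s : R) : (k <= i)%N -> (i <= N)%N -> 0 <= s ->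
  (s == 0) || (i < N)%N && (s <= tau i) ->
  c1 * (enorm h + 2 * theta) < Ti k -> closure Om (p i + s *: v i + h).
Proof.
move=> ki iN s0 ss big; have cp := c1_gt0; apply: contrapT => ncl.
have nO : ~ Om (p i + s *: v i + h) by move=> /subset_closure.
have [b [fb bd bcl _]] := seg_exit_dist oOm (p_closure iN) nO.
have := Ti_dist iN fb bcl.
have : c1 * (enorm (p i - b) + theta) <= c1 * (enorm h + 2 * theta).
  rewrite ler_pM2l//.
  have : enorm (p i - b) <= enorm h + theta; last by lra.
  apply: (le_trans bd).
  have -> : p i - (p i + s *: v i + h) = - (h + s *: v i).
    by apply/rowP => j; rewrite !mxE; ring.
  rewrite enormN; apply: (le_trans (enormD _ _)); rewrite lerD2l.
  have th0 : 0 <= theta.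
    by apply: le_trans epsM; rewrite mulr_ge0 ?(ltW eps0)//; plra.
  case/orP: ss => [/eqP ->|/andP[iN' st]]; first by rewrite scale0r enorm0.
  have [_ /(_ i iN')[/andP[t0 te] vM _ _]] := poly.
  apply: le_trans epsM; rewrite enormZ ger0_norm// mulrC.
  by apply: ler_pM; rewrite ?enorm_ge0//; lra.
by have := Ti_mono ki iN; lra.
Qed.

Lemma phase2 k i h : (k <= i)%N -> (i <= N)%N -> enorm h <= 1 ->
  c1 * (enorm h + 2 * theta) < Ti k ->
  u (p i + h) <= u (p k + h) + (Si i - Si k) + dotp (Pi i - Pi k) h +
    (Ti i - Ti k) * (K * (3 * theta + 2 * enorm h ^+ 2)).
Proof.
move=> ki; elim: i ki => [|i IH].
  by rewrite leqn0 => /eqP -> *; rewrite !subrr dotpC dotp0r mul0r !addr0.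
rewrite leq_eqVlt => /predU1P[-> *|].
  by rewrite !subrr dotpC dotp0r mul0r !addr0.
rewrite ltnS => ki iN h1 big; have {}IH := IH ki (ltnW iN) h1 big.
have [_ /(_ i iN)[/andP[t0 te] vM pE _]] := poly.
have -> : p i.+1 + h = p i + h + tau i *: v i by rewrite pE addrAC.
have := @ustep (p i + h) (v i) (tau i) (L (p i, v i) + dotp (q (p i) (v i)) h
   + K * (3 * theta + 2 * enorm h ^+ 2)) t0.
have st1 (s : R) : 0 <= s <= tau i -> closure Om (p i + h + s *: v i).
  move=> /andP[s0 st]; rewrite addrAC.
  by apply: (@phase2_closure k) => //; rewrite ?iN ?st ?orbT// ltnW.
have st2 (s : R) : 0 <= s <= tau i -> L (p i + h + s *: v i, v i) <=
    L (p i, v i) + dotp (q (p i) (v i)) h + K * (3 * theta + 2 * enorm h ^+ 2).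
  move=> /andP[s0 st].
  apply: (@seg_cost (p i) (v i) h s (enorm h) theta) => //.
  - exact: p_closure (ltnW iN).
  - apply: le_trans epsM; rewrite mulrC ler_wpM2l//; last by lra.
    by plra.
move=> /(_ st1 st2); rewrite SiS TiS PiS.
have -> : dotp (Pi i + tau i *: q (p i) (v i) - Pi k) h =
   dotp (Pi i - Pi k) h + tau i * dotp (q (p i) (v i)) h.
  by rewrite addrAC dotpDl dotpZl.
move: IH; set e := K * _; lra.
Qed.

(** Dilation up to [k], then translation of the rest, which is empty when [k = N]. The linear term
    collects the momenta of all edges, plus a multiple of the radius [p 0 - x0] due to the change of
    durations. *)
Lemma touch_poly k h x0 : (k <= N)%N -> 0 < Ti k -> Ti k <= T0 ->
  theta <= Ti k / (2 * c1) -> (1 + c6 / Ti k) * (M * eps) <= theta ->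
  closure Om (p N + h) -> 0 < enorm h ->
  2 * cc / c3 * M * enorm h <= 1 -> c7 * enorm h <= 1 ->
  enorm (p 0 - x0) <= rho -> eclosed_ball x0 rho `<=` ~` Om ->
  k = N \/ c1 * (enorm h + 2 * theta) < Ti k ->
  u (p N + h) <= u (p N) + dotp (Pi N + ((Si k + Zi k) /
     dotp (p k - p 0) (p 0 - x0)) *: (p 0 - x0)) h
   + (E1 + 2 * K * Tmax) * enorm h ^+ 2 + (E2 + 1 + 3 * K * Tmax) * theta.
Proof.
move=> kN Tk0 TkT thT eT clh h0 hs hs7 N0r sub kNT.
have [c60 c71 x10 x20 M0] := consts2.
have h1 : enorm h <= 1.
  by have := ler_peMl (enorm_ge0 h) c71; lra.
have clk : closure Om (p k + h).
  case: kNT => [->//|big].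
  have := @phase2_closure k k h 0 (leqnn k) kN (lexx 0) _ big.
  by rewrite scale0r addr0; apply; rewrite eqxx.
have := phase1 kN Tk0 TkT thT eT clk h0 hs hs7 erefl N0r sub.
have ph2 : u (p N + h) <= u (p k + h) + (Si N - Si k) + dotp (Pi N - Pi k) h +
    (Ti N - Ti k) * (K * (3 * theta + 2 * enorm h ^+ 2)).
  case: kNT => [->|big]; last exact: phase2.
  by rewrite !subrr dotpC dotp0r mul0r !addr0.
have th0 : 0 <= theta by apply: le_trans epsM; rewrite mulr_ge0 ?(ltW M0)// ltW.
have Ee : (Ti N - Ti k) * (K * (3 * theta + 2 * enorm h ^+ 2)) <=
    Tmax * (K * (3 * theta + 2 * enorm h ^+ 2)).
  apply: ler_wpM2r.
    by apply: mulr_ge0; [exact: ltW|have := sqr_ge0 (enorm h); lra].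
  by have := TN_le; lra.
have eps1 : eps <= theta by have := ler_peMl (ltW eps0) M1; plra.
rewrite [dotp (Pi N + _) h]dotpDl [dotp (_ *: _) h]dotpZl.
have -> : (Si k + Zi k) / dotp (p k - p 0) (p 0 - x0) * dotp (p 0 - x0) h =
  (Si k + Zi k) * (dotp h (p 0 - x0) / dotp (p k - p 0) (p 0 - x0)).
  by rewrite (dotpC _ h); ring.
rewrite dotpBl in ph2.
have := opt; move: ph2 Ee.
set b1 := (Si k + Zi k) * (dotp h (p 0 - x0) / dotp (p k - p 0) (p 0 - x0)).
lra.
Qed.

End Path.

Hypothesis path_ex : forall z, Om z -> forall eps : R, 0 < eps ->
  exists (p : nat -> 'rV[R]_n) (tau : nat -> R) (v : nat -> 'rV[R]_n) N, [/\ polygon Om M eps p tau v N, p N = z &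
    g (p 0) + Si p v tau N <= u z + eps].

(** The cut is the first vertex reached at time [a] or later, or else the last one; an edge lasts at
    most [eps <= a], hence the factor 2. *)
Lemma ex_cut (eps : R) p tau (v : nat -> 'rV[R]_n) N (a : R) : polygon Om M eps p tau v N ->
  0 < a -> eps <= a -> 0 < Ti tau N ->
  exists k, [/\ (k <= N)%N, 0 < Ti tau k, Ti tau k <= 2 * a &
    Ti tau k = Ti tau N \/ a <= Ti tau k] /\ (k = N \/ a <= Ti tau k).
Proof.
move=> [_ poly] a0 ea TN.
have exk : exists k, (k == N) || (a <= Ti tau k) by exists N; rewrite eqxx.
case: (ex_minnP exk) => -[|k] kP kmin.
  case/orP: kP => [/eqP N0|]; first by rewrite -N0 /Ti big_ord0 ltxx in TN.
  by rewrite /Ti big_ord0 leNgt a0.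
have kN : (k.+1 <= N)%N by apply: kmin; rewrite eqxx.
have kT : Ti tau k < a.
  rewrite ltNge; apply/negP => h.
  by have := kmin k; rewrite h orbT => /(_ isT); rewrite ltnn.
have [/andP[t0 te] _ _ _] := poly k kN.
have TkS : Ti tau k.+1 = Ti tau k + tau k by rewrite /Ti big_ord_recr.
exists k.+1; split; last first.
  by case/orP: kP => [/eqP ->|]; [left|right].
have Tp : Ti tau k.+1 = Ti tau N \/ a <= Ti tau k.+1.
  by case/orP: kP => [/eqP ->|]; [left|right].
split => //; last by rewrite TkS; lra.
by case: Tp => [->//|]; apply: lt_le_trans.
Qed.

(** [C] and [h0] are fixed before [z] and [err], while [Q] depends on both. When [z] is so close to
    the boundary that the polygon ends before the cutting time, all of it is dilated. *)
Lemma touch : exists C h0 : R, [/\ 0 < C, 0 < h0 & forall z, Om z ->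
  forall err : R, 0 < err -> exists Q, forall h, enorm h <= h0 ->
    closure Om (z + h) ->
    u (z + h) <= u z + err + dotp Q h + C * enorm h ^+ 2].
Proof.
have [cp c30 cc1 C40 T00] := consts_gt0.
have [c60 c71 x10 x20 M0] := consts2.
pose C := `|E1 + 2 * K * Tmax| + 1.
(* Three smallness conditions on [|h|]: [a1] for [tangent_dilation], [a2] to keep displacements
   below 1, [a3] to keep the translated part in the closure. The inverse of their sum meets all
   three. *)
pose a1 := 2 * cc / c3 * M; pose a2 := c7; pose a3 := 8 * c1 / T0.
have a1p : 0 < a1.
  apply: mulr_gt0 => //; apply: divr_gt0 => //; apply: mulr_gt0 => //; lra.
have a2p : 0 < a2 by rewrite /a2; lra.
have a3p : 0 < a3 by apply: divr_gt0 => //; exact: mulr_gt0.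
have ha1 : a1 <= a1 + a2 + a3 by lra.
have ha2 : a2 <= a1 + a2 + a3 by lra.
have ha3 : a3 <= a1 + a2 + a3 by lra.
pose h0 := (a1 + a2 + a3)^-1.
have h00 : 0 < h0 by rewrite invr_gt0; lra.
have hb (a h : R) : 0 <= h <= h0 -> a <= a1 + a2 + a3 -> a * h <= 1.
  move=> /andP[hp hh] aa; apply: (@le_trans _ _ ((a1 + a2 + a3) * h0)).
    apply: (@le_trans _ _ ((a1 + a2 + a3) * h)); first exact: ler_wpM2r.
    by rewrite ler_wpM2l//; lra.
  by rewrite /h0 divff// gt_eqF//; lra.
exists C, h0; split => //.
  by rewrite /C; have := normr_ge0 (E1 + 2 * K * Tmax); lra.
move=> z Oz err err0.
have [d d0 dO] := open_enorm oOm Oz.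
(* A lower bound for the time of the cut. It depends on [z], through the radius [d] of a ball of
   [Om] around it, and influences only [theta] and [eps]. *)
pose Tlow := Num.min (d / M) (T0 / 2).
have Tlow0 : 0 < Tlow by rewrite lt_min; apply/andP; split; apply: divr_gt0.
have TlowT : Tlow <= T0 / 2 by rewrite ge_min lexx orbT.
have Tlowd : Tlow <= d / M by rewrite ge_min lexx.
pose E3 := `|E2 + 1 + 3 * K * Tmax| + 1.
have E30 : 0 < E3 by rewrite /E3; have := normr_ge0 (E2 + 1 + 3 * K * Tmax); lra.
pose theta := Num.min (Num.min 1 (Tlow / (16 * c1))) (err / E3).
have th0 : 0 < theta.
  have c16 : 0 < 16 * c1 by exact: mulr_gt0.
  rewrite !lt_min ltr01 /=; apply/andP; split; last exact: divr_gt0.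
  exact: divr_gt0.
have th1 : theta <= 1 by rewrite !ge_min lexx.
have th2 : theta <= Tlow / (16 * c1) by rewrite !ge_min lexx orbT.
have th3 : E3 * theta <= err.
  by rewrite mulrC -ler_pdivlMr// !ge_min lexx orbT.
(* [eps] is chosen after [theta]: [A] dominates both the bound [1 + c6 / Tlow] on the dilation
   factor and the factor of the total freezing error. *)
pose A := 1 + c6 / Tlow + 3 * K * `|Tmax|.
have q0 : 0 < c6 / Tlow by rewrite divr_gt0.
have q1 : 0 <= 3 * K * `|Tmax| by rewrite mulr_ge0// mulr_ge0// ltW.
have A1 : 1 <= A by rewrite /A; lra.
have AM : 0 < M * A by apply: mulr_gt0 => //; exact: lt_le_trans A1.
pose eps := Num.min (T0 / 2) (theta / (M * A)).
have eps0 : 0 < eps by rewrite lt_min; apply/andP; split; apply: divr_gt0.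
have epsT : eps <= T0 / 2 by rewrite ge_min lexx.
have epsA : (M * eps) * A <= theta.
  rewrite mulrAC mulrC -ler_pdivlMr//; first by rewrite ge_min lexx orbT.
have Me0 : 0 < M * eps by exact: mulr_gt0.
have epsM : M * eps <= theta.
  by apply: le_trans epsA; rewrite ler_peMr// ltW.
have smallerr : 3 * K * (M * eps) * Tmax <= theta.
  apply: le_trans epsA; rewrite [leLHS](_ : _ = M * eps * (3 * K * Tmax)); last by ring.
  rewrite ler_pM2l//; apply: (@le_trans _ _ (3 * K * `|Tmax|)); last by rewrite /A; lra.
  by rewrite ler_wpM2l ?ler_norm// mulr_ge0// ltW.
have [p [tau [v [N [poly pN]]]]] := path_ex Oz eps0.
rewrite -{1}pN => opt.
have [f0 _] := poly.
have TN : d / M <= Ti tau N.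
  rewrite ler_pdivrMr// mulrC.
  have := disp poly (leq0n N) (leqnn N).
  rewrite {2}/Ti big_ord0 subr0 pN; apply: le_trans.
  rewrite leNgt; apply/negP; rewrite enormBC => /dO.
  exact: frontier_notin.
have TN0 : 0 < Ti tau N by apply: lt_le_trans TN; exact: divr_gt0.
have T2 : 0 < T0 / 2 by rewrite divr_gt0.
have [k [[kN Tk0 TkT TkN] kNT]] := ex_cut poly T2 epsT TN0.
have TlowK : Tlow <= Ti tau k.
  by case: TkN => [->|h]; [exact: le_trans Tlowd TN|exact: le_trans TlowT h].
have [x0 [x0r x0s]] := ext f0.
exists (Pi p v tau N + ((Si p v tau k + Zi p v tau k) /
  dotp (p k - p 0) (p 0 - x0)) *: (p 0 - x0)) => h hh clh.
have [->|hn] := eqVneq h 0.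
  by rewrite !addr0 enorm0 dotp0r expr0n /= mulr0 !addr0 lerDl ltW.
have hp := enorm_gt0 hn.
have c1th : 16 * c1 * theta <= Tlow.
  by rewrite mulrC -ler_pdivlMr// mulr_gt0.
have hh' : 0 <= enorm h <= h0 by rewrite (ltW hp).
have big : k = N \/ c1 * (enorm h + 2 * theta) < Ti tau k.
  case: kNT => [->|kk]; [by left|right].
  have := hb a3 _ hh' ha3.
  rewrite /a3 mulrAC ler_pdivrMr// mul1r => h8.
  exact: lt_le_trans (small_shift T00 h8 (le_trans c1th TlowT)) kk.
rewrite -pN in clh *.
have k1 : (1 + c6 / Ti tau k) * (M * eps) <= theta.
  apply: le_trans epsA; rewrite mulrC ler_pM2l//.
  rewrite /A -[leLHS]addr0; apply: lerD => //; rewrite lerD2l.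
  by rewrite ler_pM2l// lef_pV2 ?posrE.
have k2 : theta <= Ti tau k / (2 * c1).
  have c2 : 0 < 2 * c1 by exact: mulr_gt0.
  rewrite ler_pdivlMr//.
  exact: small_time (mulr_ge0 (ltW cp) (ltW th0)) c1th TlowK.
have k3 : Ti tau k <= T0 by move: TkT; rewrite mulrC divfK.
have k4 : 2 * cc / c3 * M * enorm h <= 1 := hb a1 _ hh' ha1.
have k5 : c7 * enorm h <= 1 := hb a2 _ hh' ha2.
have := touch_poly poly epsM th1 eps0 smallerr opt kN Tk0 k3 k2 k1 clh hp k4 k5
  x0r x0s big.
move=> /le_trans; apply.
have g1 : (E1 + 2 * K * Tmax) * enorm h ^+ 2 <= C * enorm h ^+ 2.
  rewrite ler_wpM2r ?sqr_ge0//; apply: (le_trans (ler_norm _)).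
  by rewrite /C lerDl ler01.
have g2 : (E2 + 1 + 3 * K * Tmax) * theta <= err.
  apply: le_trans th3; rewrite ler_wpM2r ?(ltW th0)//.
  by apply: (le_trans (ler_norm _)); rewrite /E3 lerDl ler01.
exact: lerD_swap g1 g2.
Qed.

End Touching.

(** * C1 functions of one real variable, and a C1 transition function *)

Section C1_real.
Variable R : realType.
Implicit Types f g : R -> R.

Lemma C1_realP f : C1 f <-> (forall x, derivable f x 1) /\ continuous (derive1 f).
Proof.
have DE v x : differentiable f x -> 'D_v f x = v * (derive1 f) x.
  move=> df; rewrite derive1E' // deriveE//.
  by rewrite -{1}(mulr1 v) -[v * 1]/(v *: (1 : R)) linearZ.
split=> [[df cf]|[df cf]].
  split=> [x|]; first exact/derivable1_diffP.
  have -> : (derive1 f) = 'D_1 f by apply/funext => x; rewrite derive1E.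
  exact: cf.
have df' x : differentiable f x by exact/derivable1_diffP.
split; first exact: df'.
move=> v; have -> : 'D_v f = fun x => v * (derive1 f) x.
  by apply/funext => x; exact: DE.
by move=> x; apply: cvgM; [exact: cvg_cst|exact: cf].
Qed.

Lemma C1_of_derive f (df : R -> R) :
  (forall x : R, is_derive x (1 : R) f (df x)) -> continuous df -> C1 f.
Proof.
move=> h c; apply/C1_realP; split=> [x|]; first by have [] := h x.
suff -> : (derive1 f) = df by [].
by apply/funext => x; rewrite derive1E; have [_ ->] := h x.
Qed.

Lemma C1_is_derive f (x : R) : C1 f -> is_derive x (1 : R) f ((derive1 f) x).
Proof.
by move=> /C1_realP[df _]; split; [exact: df|rewrite derive1E].
Qed.

Lemma C1_continuous f : C1 f -> continuous f.
Proof. by move=> [df _] x; exact: differentiable_continuous. Qed.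

Lemma C1_continuous_derive f : C1 f -> continuous (derive1 f).
Proof. by move=> /C1_realP[]. Qed.

Lemma C1M f g : C1 f -> C1 g -> C1 (fun x => f x * g x) /\
  forall x, derive1 (fun x => f x * g x) x = (derive1 f) x * g x + f x * (derive1 g) x.
Proof.
move=> Cf Cg.
have d x : is_derive x (1 : R) (fun x => f x * g x) ((derive1 f) x * g x + f x * (derive1 g) x).
  have := is_deriveM (C1_is_derive x Cf) (C1_is_derive x Cg).
  by move/is_derive_eq; apply; rewrite addrC /GRing.scale /= (mulrC (g x)).
split; last by move=> x; rewrite derive1E; have [_ ->] := d x.
apply: C1_of_derive d _ => x; apply: cvgD; apply: cvgM.
- exact: C1_continuous_derive.
- exact: C1_continuous.
- exact: C1_continuous.
- exact: C1_continuous_derive.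
Qed.

Definition posp (x : R) : R := Num.max x 0.
Definition hsq (x : R) : R := posp x ^+ 2 / 2.

Lemma continuous_posp : continuous posp.
Proof.
move=> x; rewrite /posp.
apply: (@continuous_max _ _ (fun x : R => x) (fun=> 0)); first exact: cvg_id.
exact: cvg_cst.
Qed.

Lemma hsq_derive (x : R) : is_derive x (1 : R) hsq (posp x).
Proof.
have posN (y : R) : y <= 0 -> posp y = 0 by move=> ?; rewrite /posp; apply/max_idPr.
have posP (y : R) : 0 <= y -> posp y = y by move=> ?; rewrite /posp; apply/max_idPl.
(* A quadratic remainder covers the kink at 0 together with the smooth points, by cases on the signs
   of [x] and [h + x]. *)
have bnd (h : R) : `|hsq (h + x) - hsq x - h * posp x| <= h ^+ 2.
  have h2 := sqr_ge0 h; have x2 := sqr_ge0 x; have hx2 := sqr_ge0 (h + x).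
  rewrite /hsq ler_norml.
  have [x0|/ltW x0] := lerP x 0; [rewrite (posN x)//|rewrite (posP x)//];
    (have [hx|/ltW hx] := lerP (h + x) 0; [rewrite (posN _ hx)|rewrite (posP _ hx)]).
  - by apply/andP; split; lra.
  - have : 0 <= (h + x) * (- x) by apply: mulr_ge0; lra.
    have : 0 <= h * (- x) by apply: mulr_ge0; lra.
    by move=> *; apply/andP; split; lra.
  - have : 0 <= (- h - x) * (- h + x) by apply: mulr_ge0; lra.
    have : 0 <= x * (- h - x) by apply: mulr_ge0; lra.
    by move=> *; apply/andP; split; lra.
  - by apply/andP; split; lra.
have cv : (fun h : R => h^-1 *: ((hsq \o shift x) (h *: (1 : R)) - hsq x)) @ 0^' --> posp x.
  apply/cvgrPdist_le => e e0; near=> h.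
  have h0 : h != 0 by near: h; exact: nbhs_dnbhs_neq.
  rewrite /= -[_%:A]/(h * 1) mulr1 -[_ *: _]/(h^-1 * _).
  have -> : posp x - h^-1 * (hsq (h + x) - hsq x) =
     - (h^-1 * (hsq (h + x) - hsq x - h * posp x)).
    by field.
  rewrite normrN normrM normfV ler_pdivrMl ?normr_gt0//.
  apply: (le_trans (bnd h)); rewrite -real_normK ?num_real// expr2.
  rewrite ler_wpM2l//; near: h; apply: dnbhs0_le e0.
split; last exact: cvg_lim cv.
by apply/cvg_ex; exists (posp x).
Unshelve. all: by end_near.
Qed.

(** A second difference of the primitive [hsq] of the positive part: a C1 transition from 0 to 1 on
    [[0, 2]], with the hat function [tent] as derivative. *)
Definition ramp (x : R) : R := hsq x - 2 * hsq (x - 1) + hsq (x - 2).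
Definition tent (x : R) : R := posp x - 2 * posp (x - 1) + posp (x - 2).

Lemma ramp_le0 (x : R) : x <= 0 -> ramp x = 0.
Proof.
move=> x0; rewrite /ramp /hsq /posp.
rewrite (_ : Num.max x 0 = 0); last exact/max_idPr.
rewrite (_ : Num.max (x - 1) 0 = 0); last by apply/max_idPr; lra.
rewrite (_ : Num.max (x - 2) 0 = 0); last by apply/max_idPr; lra.
by lra.
Qed.

Lemma ramp_ge2 (x : R) : 2 <= x -> ramp x = 1.
Proof.
move=> x0; rewrite /ramp /hsq /posp.
rewrite (_ : Num.max x 0 = x); last by apply/max_idPl; lra.
rewrite (_ : Num.max (x - 1) 0 = x - 1); last by apply/max_idPl; lra.
rewrite (_ : Num.max (x - 2) 0 = x - 2); last by apply/max_idPl; lra.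
by field.
Qed.

Lemma ramp01 (x : R) : 0 <= ramp x <= 1.
Proof.
have [x0|x0] := lerP x 0; first by rewrite ramp_le0// lexx ler01.
have [x2|x2] := lerP 2 x; first by rewrite ramp_ge2// lexx ler01.
rewrite /ramp /hsq /posp.
rewrite (_ : Num.max x 0 = x); last by apply/max_idPl; lra.
rewrite (_ : Num.max (x - 2) 0 = 0); last by apply/max_idPr; lra.
have [x1|x1] := lerP (x - 1) 0.
  have : 0 <= (1 - x) * (1 + x) by apply: mulr_ge0; lra.
  by have := sqr_ge0 x => *; apply/andP; split; lra.
have := sqr_ge0 (2 - x); have : 0 <= (2 - x) * x by apply: mulr_ge0; lra.
by move=> h1 h2; apply/andP; split; lra.
Qed.

Lemma tent_ge0 (x : R) : 0 <= tent x.
Proof.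
rewrite /tent /posp.
by have [x0|x0] := lerP x 0; have [x1|x1] := lerP (x - 1) 0;
  have [x2|x2] := lerP (x - 2) 0; lra.
Qed.

Lemma tent_le0 (x : R) : x <= 0 -> tent x = 0.
Proof.
rewrite /tent /posp.
by have [x0|x0] := lerP x 0; have [x1|x1] := lerP (x - 1) 0;
  have [x2|x2] := lerP (x - 2) 0; lra.
Qed.

Lemma tent_ge2 (x : R) : 2 <= x -> tent x = 0.
Proof.
rewrite /tent /posp.
by have [x0|x0] := lerP x 0; have [x1|x1] := lerP (x - 1) 0;
  have [x2|x2] := lerP (x - 2) 0; lra.
Qed.

Lemma continuous_tent : continuous tent.
Proof.
have cs (c : R) : continuous (fun x : R => posp (x - c)).
  move=> x; apply: (@continuous_comp R R R (fun y => y - c) posp x).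
    by apply: cvgB; [exact: cvg_id|exact: cvg_cst].
  exact: continuous_posp.
move=> x; apply: cvgD; last exact: cs.
apply: cvgB; first exact: continuous_posp.
by apply: cvgM; [exact: cvg_cst|exact: cs].
Qed.

Lemma ramp_derive (c d x : R) :
  is_derive x (1 : R) (fun x => ramp ((x - c) / d)) (tent ((x - c) / d) / d).
Proof.
have sc (e : R) : is_derive x (1 : R) (fun x => hsq ((x - c) / d - e))
    (posp ((x - c) / d - e) / d).
  have da : is_derive x (1 : R) (fun x : R => (x - c) / d - e) d^-1.
    have h : is_derive x (1 : R) (fun x : R => (d^-1 * x) - (c / d + e)) d^-1.
      have h := is_deriveB (is_deriveZ d^-1 (is_derive_id x (1 : R)))
        (is_derive_cst (c / d + e) x (1 : R)).
      by apply: (is_derive_eq h); rewrite subr0 /GRing.scale /= mulr1.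
    have -> // : (fun x : R => (x - c) / d - e) = (fun x => d^-1 * x - (c / d + e)).
    by apply/funext => y; ring.
  have := @is_derive1_comp _ hsq _ x _ _ (hsq_derive _) da.
  by move/is_derive_eq; apply; rewrite mulrC /GRing.scale /=.
have -> : (fun x => ramp ((x - c) / d)) = (fun x => hsq ((x - c) / d - 0)
   - 2 * hsq ((x - c) / d - 1) + hsq ((x - c) / d - 2)).
  by apply/funext => y; rewrite subr0.
have h := is_deriveD (is_deriveB (sc 0) (is_deriveZ 2 (sc 1))) (sc 2).
apply: (is_derive_eq h).
by rewrite /tent subr0 /GRing.scale /=; ring.
Qed.

End C1_real.

(** * Integration by parts for weak derivatives, with boundary terms *)

Section Weak.
Variable R : realType.
Notation mu := (@lebesgue_measure R).
Implicit Types (f g x y phi : R -> R) (a b s t : R).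

Lemma within_integrable f a b : {within `[a, b], continuous f} ->
  mu.-integrable `[a, b] (EFin \o f).
Proof.
by move=> cf; apply: continuous_compact_integrable => //; exact: segment_compact.
Qed.

Lemma within_contM f g (A : set R) : {within A, continuous f} -> continuous g ->
  {within A, continuous (fun z => f z * g z)}.
Proof.
move=> cf cg z; apply: continuousM; first exact: cf.
exact: continuous_subspaceT.
Qed.

Lemma within_subitv f a b s t : s <= a -> b <= t ->
  {within `[s, t], continuous f} -> {within `[a, b], continuous f}.
Proof.
move=> sa bt; apply: continuous_subspaceW => z /=; rewrite !in_itv/=.
by move=> /andP[az zb]; rewrite (le_trans sa az) (le_trans zb bt).
Qed.

Lemma integrable_subitv f a b s t : s <= a -> b <= t ->
  mu.-integrable `[s, t] (EFin \o f) -> mu.-integrable `[a, b] (EFin \o f).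
Proof.
move=> sa bt; apply: integrableS => // z /=; rewrite !in_itv/=.
by move=> /andP[az zb]; rewrite (le_trans sa az) (le_trans zb bt).
Qed.

Lemma integrable_mul_cont f g a b : mu.-integrable `[a, b] (EFin \o f) ->
  continuous g -> mu.-integrable `[a, b] (EFin \o (fun z => f z * g z)).
Proof.
move=> fi cg.
have cgw : {within `[a, b], continuous g} by exact: continuous_subspaceT.
have := @integrableMl _ _ _ mu `[a, b]%classic _ (EFin \o f) g fi.
apply => //.
- by apply: subspace_continuous_measurable_fun => //.
- have := compact_bounded (continuous_compact cgw (@segment_compact _ a b)).
  move=> [M [Mr MB]]; exists M; split => // z /MB h u /= uab.
  by apply: h; exists u.
Qed.

Lemma Rintegral_supp (A B : set R) f : A `<=` B ->
  (forall z, B z -> ~ A z -> f z = 0) ->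
  \int[mu]_(z in B) f z = \int[mu]_(z in A) f z.
Proof.
move=> AB f0; rewrite Rintegral_mkcond [RHS]Rintegral_mkcond.
apply: eq_Rintegral => z _; rewrite /patch.
have [zA|zA] := boolP (z \in A).
  by rewrite mem_set//; apply: AB; exact: set_mem.
case: ifPn => // zB; apply: f0; first exact: set_mem.
by move=> /mem_set; rewrite (negbTE zA).
Qed.

Lemma continuous_tent_scaled (c d : R) :
  continuous (fun z : R => tent ((z - c) / d) / d).
Proof.
move=> z; apply: cvgM; last exact: cvg_cst.
apply: (@continuous_comp R R R (fun z => (z - c) / d) (@tent R) z).
  apply: cvgM; last exact: cvg_cst.
  by apply: cvgB; [exact: cvg_id|exact: cvg_cst].
exact: continuous_tent.
Qed.

Lemma tent_mass a b (c d : R) : a < b -> 0 < d -> a <= c -> c + 2 * d <= b ->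
  \int[mu]_(z in `[a, b]) (tent ((z - c) / d) / d) = 1.
Proof.
move=> ab d0 ac cb.
pose F z := ramp ((z - c) / d).
have dF (z : R) : is_derive z (1 : R) F (tent ((z - c) / d) / d).
  exact: ramp_derive.
have cF : continuous F.
  move=> z; apply: differentiable_continuous; apply/derivable1_diffP.
  by have [] := dF z.
rewrite /Rintegral.
rewrite (@continuous_FTC2 R (fun z => tent ((z - c) / d) / d) F)//.
- rewrite /F ramp_ge2; last by rewrite ler_pdivlMr//; lra.
  rewrite ramp_le0; last by rewrite pmulr_lle0 ?invr_gt0//; lra.
  by rewrite sube0.
- by apply: continuous_subspaceT; exact: continuous_tent_scaled.
- split; first by move=> z _; have [] := dF z.
  + exact: cvg_at_right_filter (cF a).
  + exact: cvg_at_left_filter (cF b).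
- by move=> z _; rewrite derive1E; have [_ ->] := dF z.
Qed.

(** The scaled tent has unit mass and vanishes outside [[c, c + 2 * d]]: it is an approximate Dirac
    mass. *)
Lemma tent_avg f a b (c d e w : R) : a < b -> 0 < d -> a <= c -> c + 2 * d <= b ->
  {within `[a, b], continuous f} ->
  (forall z, c <= z <= c + 2 * d -> `|f z - w| <= e) ->
  `|\int[mu]_(z in `[a, b]) (f z * (tent ((z - c) / d) / d)) - w| <= e.
Proof.
move=> ab d0 ac cb cf fe.
have ct := @continuous_tent_scaled c d.
pose rho z := tent ((z - c) / d) / d.
have i1 : mu.-integrable `[a, b] (EFin \o (fun z => f z * rho z)).
  by apply: within_integrable; exact: within_contM.
have ir : mu.-integrable `[a, b] (EFin \o rho).
  by apply: within_integrable; exact: continuous_subspaceT.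
have iw : mu.-integrable `[a, b] (EFin \o (fun z => w * rho z)).
  apply: within_integrable; apply: continuous_subspaceT => z.
  by apply: cvgM; [exact: cvg_cst|exact: ct].
have ie : mu.-integrable `[a, b] (EFin \o (fun z => e * rho z)).
  apply: within_integrable; apply: continuous_subspaceT => z.
  by apply: cvgM; [exact: cvg_cst|exact: ct].
have -> : w = \int[mu]_(z in `[a, b]) (w * rho z).
  by rewrite RintegralZl// tent_mass// mulr1.
have -> : e = \int[mu]_(z in `[a, b]) (e * rho z).
  by rewrite RintegralZl// tent_mass// mulr1.
rewrite -RintegralB//.
have iB : mu.-integrable `[a, b] (EFin \o (fun z => f z * rho z - w * rho z)).
  have -> : (fun z => f z * rho z - w * rho z) = (fun z => (f z - w) * rho z).
    by apply/funext => z; rewrite mulrBl.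
  apply: within_integrable; apply: within_contM => // z.
  by apply: continuousB; [exact: cf|exact: cst_continuous].
apply: (le_trans (le_normr_Rintegral _ iB)) => //.
apply: le_Rintegral => //.
  exact: integrable_norm iB.
move=> z /= zab; rewrite -mulrBl normrM.
have r0 : 0 <= rho z by rewrite divr_ge0 ?tent_ge0// ltW.
rewrite (ger0_norm r0).
have [z1|z1] := lerP z c.
  rewrite /rho tent_le0 ?mul0r ?mulr0//.
  by rewrite pmulr_lle0 ?invr_gt0//; lra.
have [z2|z2] := lerP (c + 2 * d) z.
  rewrite /rho tent_ge2 ?mul0r ?mulr0//.
  by rewrite ler_pdivlMr//; lra.
by apply: ler_wpM2r => //; apply: fe; lra.
Qed.

(** Rises on [[a + d, a + 3 * d]] and falls on [[b - 3 * d, b - d]]; the margin [d] at each end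
    gives the strict inclusion of supports that [test_fun] demands. *)
Definition cutoff (a b d : R) (z : R) : R :=
  ramp ((z - (a + d)) / d) - ramp ((z - (b - 3 * d)) / d).
Definition dcutoff (a b d : R) (z : R) : R :=
  tent ((z - (a + d)) / d) / d - tent ((z - (b - 3 * d)) / d) / d.

Lemma cutoff_derive (a b d z : R) : is_derive z (1 : R) (cutoff a b d) (dcutoff a b d z).
Proof. exact: (is_deriveB (ramp_derive _ _ _) (ramp_derive _ _ _)). Qed.

Lemma continuous_dcutoff (a b d : R) : continuous (dcutoff a b d).
Proof.
by move=> z; apply: cvgB; exact: continuous_tent_scaled.
Qed.

Lemma cutoff_C1 (a b d : R) : C1 (cutoff a b d).
Proof.
by apply: C1_of_derive (@continuous_dcutoff a b d) => z; exact: cutoff_derive.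
Qed.

Lemma derive1_cutoff (a b d : R) : derive1 (cutoff a b d) = dcutoff a b d.
Proof.
by apply/funext => z; rewrite derive1E; have [_ ->] := cutoff_derive a b d z.
Qed.

Lemma cutoff_out a b d z : 0 < d -> 6 * d <= b - a ->
  z <= a + d \/ b - d <= z -> cutoff a b d z = 0.
Proof.
move=> d0 dab [za|zb]; rewrite /cutoff.
  by rewrite !ramp_le0 ?subr0// pmulr_lle0 ?invr_gt0//; lra.
by rewrite !ramp_ge2 ?subrr// ler_pdivlMr//; lra.
Qed.

Lemma cutoff_in a b d z : 0 < d -> a + 3 * d <= z <= b - 3 * d ->
  cutoff a b d z = 1.
Proof.
move=> d0 /andP[za zb]; rewrite /cutoff ramp_ge2 ?ler_pdivlMr//; last by lra.
by rewrite ramp_le0 ?subr0// pmulr_lle0 ?invr_gt0//; lra.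
Qed.

Lemma cutoff_norm_le1 a b d z : `|cutoff a b d z| <= 1.
Proof.
rewrite /cutoff ler_norml.
have /andP[h1 h2] := ramp01 ((z - (a + d)) / d).
have /andP[h3 h4] := ramp01 ((z - (b - 3 * d)) / d).
by apply/andP; split; lra.
Qed.

Lemma cut_step a b (k : nat) : a < b -> 6 * ((b - a) / 6 / k.+1%:R) <= b - a.
Proof.
move=> ab; have -> : 6 * ((b - a) / 6 / k.+1%:R) = (b - a) / k.+1%:R.
  by field; rewrite addrC natr1 pnatr_eq0.
by rewrite ler_pdivrMr ?ltr0n// ler_peMr ?subr_ge0 ?(ltW ab)// ler1n.
Qed.

Lemma Rintegral_cutoff_cvg h a b : a < b -> mu.-integrable `[a, b] (EFin \o h) ->
  \int[mu]_(z in `[a, b]) (h z * cutoff a b ((b - a) / 6 / k.+1%:R) z)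
    @[k --> \oo] --> \int[mu]_(z in `[a, b]) h z.
Proof.
move=> ab ih.
(* The cutoffs vanish at [a] and [b], so pointwise convergence to 1 holds only on the open interval,
   where dominated convergence is applied. *)
have ih' : mu.-integrable `]a, b[ (EFin \o h).
  by apply: integrableS ih => //; exact: subset_itv_oo_cc.
have mh := measurable_int _ ih'.
pose ck k := cutoff a b ((b - a) / 6 / k.+1%:R).
have mc k : measurable_fun `]a, b[ (ck k).
  apply: subspace_continuous_measurable_fun => //.
  by apply: continuous_subspaceT; apply: C1_continuous; exact: cutoff_C1.
have d0 (k : nat) : 0 < (b - a) / 6 / k.+1%:R by rewrite !divr_gt0 ?subr_gt0 ?ltr0n.
have toopen f : mu.-integrable `[a, b] (EFin \o f) ->
    \int[mu]_(z in `[a, b]) f z = fine (\int[mu]_(z in `]a, b[) (f z)%:E)%E.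
  move=> fi; have fi' : mu.-integrable `]a, b[ (EFin \o f).
    by apply: integrableS fi => //; exact: subset_itv_oo_cc.
  have hh := measurable_int _ fi'.
  by congr fine; exact: integral_itv_bndoo.
have mhc k : measurable_fun `]a, b[ (EFin \o (fun z => h z * ck k z)).
  by apply/measurable_EFinP; apply: measurable_funM => //; exact/measurable_EFinP.
have cvae : {ae mu, forall z, `]a, b[%classic z ->
    (EFin \o (fun z => h z * ck k z)) z @[k --> \oo] --> (EFin \o h) z}.
  apply: aeW => z; rewrite /= in_itv/= => /andP[az zb].
  apply: cvg_near_cst.
  have e0 : 0 < Num.min (z - a) (b - z) by rewrite lt_min !subr_gt0 az.
  near=> k; rewrite /= /ck cutoff_in ?mulr1//.
  have : 3 * ((b - a) / 6 / k.+1%:R) <= Num.min (z - a) (b - z).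
    have -> : 3 * ((b - a) / 6 / k.+1%:R) = (b - a) / 2 / k.+1%:R.
      by field; rewrite addrC natr1 pnatr_eq0.
    rewrite ler_pdivrMr ?ltr0n// -ler_pdivrMl//.
    have kk : k%:R <= k.+1%:R :> R by rewrite ler_nat.
    apply: le_trans kk.
    by near: k; exact: nbhs_infty_ger.
  rewrite le_min; set D := _ / k.+1%:R.
  by move=> /andP[? ?]; apply/andP; split; lra.
have dom : {ae mu, forall z (k : nat), `]a, b[%classic z ->
    (`|((h z * ck k z)%R)%:E| <= (abse \o (EFin \o h)) z)%E}.
  apply: aeW => z k _; rewrite /= lee_fin normrM ler_piMr//.
  exact: cutoff_norm_le1.
have iah := integrable_abse ih'.
have [_ _] := @dominated_convergence _ _ R mu `]a, b[%classic (measurable_itv _)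
  (fun k => EFin \o (fun z => h z * ck k z)) (EFin \o h) (abse \o (EFin \o h))
  mhc mh cvae iah dom.
move=> cv; rewrite (toopen h ih).
have -> : (fun k : nat => \int[mu]_(z in `[a, b]) (h z * cutoff a b ((b - a) / 6 / k.+1%:R) z))
   = (fun k => fine (\int[mu]_(z in `]a, b[) (h z * ck k z)%:E)%E).
  apply/funext => k; apply: toopen; apply: integrable_mul_cont => //.
  by apply: C1_continuous; exact: cutoff_C1.
apply: fine_cvg; rewrite fineK//.
exact: integrable_fin_num ih'.
Unshelve. all: by end_near.
Qed.

(** The derivative of the cutoff is a unit mass near [a] minus a unit mass near [b]; the boundary
    terms of the integration by parts arise here. *)
Lemma Rintegral_dcutoff_cvg f a b : a < b -> {within `[a, b], continuous f} ->
  \int[mu]_(z in `[a, b]) (f z * dcutoff a b ((b - a) / 6 / k.+1%:R) z)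
    @[k --> \oo] --> f a - f b.
Proof.
move=> ab cf; apply/cvgrPdist_le => e e0.
have d0 (k : nat) : 0 < (b - a) / 6 / k.+1%:R by rewrite !divr_gt0 ?subr_gt0 ?ltr0n.
have [r r0 [ra rb]] : exists2 r, 0 < r & (forall z, a <= z <= a + r -> z <= b -> `|f z - f a| <= e / 2) /\
    (forall z, b - r <= z <= b -> a <= z -> `|f z - f b| <= e / 2).
  have e2 : 0 < e / 2 by rewrite divr_gt0.
  have /subspace_continuousP h := cf.
  have /h /cvgrPdist_le /(_ _ e2) : `[a, b]%classic a by rewrite /= in_itv/= lexx ltW.
  move=> /nbhs_ballP[r1 r10 sub1].
  have /h /cvgrPdist_le /(_ _ e2) : `[a, b]%classic b by rewrite /= in_itv/= lexx ltW.
  move=> /nbhs_ballP[r2 r20 sub2].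
  exists (Num.min r1 r2 / 2); first by rewrite divr_gt0// lt_min r10.
  have m1 : Num.min r1 r2 <= r1 by rewrite ge_min lexx.
  have m2 : Num.min r1 r2 <= r2 by rewrite ge_min lexx orbT.
  rewrite /= in r10 r20.
  split=> z /andP[z1 z2] z3; rewrite distrC.
    apply: sub1; rewrite /= ?in_itv/= ?z1//.
    by rewrite -ball_normE /= ler0_norm; lra.
  apply: sub2; rewrite /= ?in_itv/= ?z2 ?z3//.
  by rewrite -ball_normE /= ger0_norm; lra.
near=> k.
set d := (b - a) / 6 / k.+1%:R.
have dp : 0 < d := d0 k.
have d6 : 6 * d <= b - a.
  exact: cut_step.
have dr : 3 * d <= r.
  rewrite /d.
  have -> : 3 * ((b - a) / 6 / k.+1%:R) = (b - a) / 2 / k.+1%:R.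
    by field; rewrite addrC natr1 pnatr_eq0.
  rewrite ler_pdivrMr ?ltr0n// -ler_pdivrMl//.
  have kk : k%:R <= k.+1%:R :> R by rewrite ler_nat.
  apply: le_trans kk.
  by near: k; exact: nbhs_infty_ger.
have i1 c : mu.-integrable `[a, b] (EFin \o (fun z => f z * (tent ((z - c) / d) / d))).
  by apply: within_integrable; apply: within_contM => //; exact: continuous_tent_scaled.
have -> : \int[mu]_(z in `[a, b]) (f z * dcutoff a b d z) =
   \int[mu]_(z in `[a, b]) (f z * (tent ((z - (a + d)) / d) / d)) -
   \int[mu]_(z in `[a, b]) (f z * (tent ((z - (b - 3 * d)) / d) / d)).
  rewrite -RintegralB//.
  by apply: eq_Rintegral => z _; rewrite /dcutoff mulrBr.
have := @tent_avg f a b (a + d) d (e / 2) (f a) ab dp _ _ cf.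
move=> /(_ _ _ _) h1.
have {}h1 := h1 ltac:(lra) ltac:(lra) ltac:(by move=> z /andP[? ?]; apply: ra; lra).
have h2 := @tent_avg f a b (b - 3 * d) d (e / 2) (f b) ab dp ltac:(lra) ltac:(lra) cf
  ltac:(by move=> z /andP[? ?]; apply: rb; lra).
move: h1 h2; rewrite !ler_norml.
by move=> /andP[? ?] /andP[? ?]; apply/andP; split; lra.
Unshelve. all: by end_near.
Qed.

(* The weak derivative is tested against [phi] times a cutoff at both ends. *)
Lemma weak_ibp s t x y phi a b : {within `[s, t], continuous x} ->
  mu.-integrable `[s, t] (EFin \o y) ->
  (forall psi, test_fun s t psi ->
    \int[mu]_(z in `[s, t]) (x z * derive1 psi z) =
    - \int[mu]_(z in `[s, t]) (y z * psi z)) ->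
  C1 phi -> s <= a -> a < b -> b <= t ->
  \int[mu]_(z in `[a, b]) (x z * derive1 phi z + y z * phi z) =
    x b * phi b - x a * phi a.
Proof.
have aux (u v w : R) : u + v = - w -> u + w = - v by lra.
move=> cx iy wk Cphi sa ab bt.
have cxab := within_subitv sa bt cx; have iyab := integrable_subitv sa bt iy.
have cphi := C1_continuous Cphi; have cdphi := C1_continuous_derive Cphi.
have ix : mu.-integrable `[a, b] (EFin \o (fun z => x z * derive1 phi z)).
  by apply: within_integrable; exact: within_contM.
have iyp : mu.-integrable `[a, b] (EFin \o (fun z => y z * phi z)).
  exact: integrable_mul_cont.
have ih : mu.-integrable `[a, b] (EFin \o (fun z => x z * derive1 phi z + y z * phi z)).
  exact: (integrableD _ ix iyp).
(* An exact identity for each width: the product of [phi] with the cutoff is a test function on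
   [[s, t]] supported in [[a, b]]. Both sides are then passed to the limit as the width tends to
   0. *)
have key (d : R) : 0 < d -> 6 * d <= b - a ->
    \int[mu]_(z in `[a, b]) ((x z * derive1 phi z + y z * phi z) * cutoff a b d z) =
    - \int[mu]_(z in `[a, b]) (x z * phi z * dcutoff a b d z).
  move=> d0 d6.
  have [Cpc dpc] := C1M Cphi (cutoff_C1 a b d).
  have cc := C1_continuous (cutoff_C1 a b d).
  have cdc := @continuous_dcutoff a b d.
  have dout z : z <= a + d \/ b - d <= z -> dcutoff a b d z = 0.
    case=> hz; rewrite /dcutoff.
      by rewrite !tent_le0 ?mul0r ?subrr// pmulr_lle0 ?invr_gt0//; lra.
    by rewrite !tent_ge2 ?mul0r ?subrr// ler_pdivlMr//; lra.
  have sub : `[a, b] `<=` `[s, t].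
    by move=> z /=; rewrite !in_itv/= => /andP[az zb]; rewrite (le_trans sa az) (le_trans zb bt).
  have outz z : ~ `[a, b]%classic z -> z <= a + d \/ b - d <= z.
    rewrite /= in_itv/= => /negP; rewrite negb_and -!ltNge => /orP[h|h]; [left|right]; lra.
  have := wk (fun z => phi z * cutoff a b d z).
  have tf : test_fun s t (fun z => phi z * cutoff a b d z).
    split => //; exists (a + d), (b - d); split; try lra.
    move=> z; rewrite in_itv/= negb_and -!ltNge => hz.
    by rewrite cutoff_out ?mulr0//; case/orP: hz => hz; [left|right]; exact: ltW.
  move=> /(_ tf).
  rewrite (@Rintegral_supp `[a, b] `[s, t])//; last first.
    move=> z _ /outz hz; rewrite dpc derive1_cutoff cutoff_out// dout//.
    by rewrite !mulr0 addr0 mulr0.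
  rewrite (@Rintegral_supp `[a, b] `[s, t] (fun z => y z * _))//; last first.
    by move=> z _ /outz hz; rewrite cutoff_out// !mulr0.
  have e1 : mu.-integrable `[a, b] (EFin \o (fun z => x z * derive1 phi z * cutoff a b d z)).
    by apply: within_integrable; apply: within_contM => //; exact: within_contM.
  have e2 : mu.-integrable `[a, b] (EFin \o (fun z => x z * phi z * dcutoff a b d z)).
    by apply: within_integrable; apply: within_contM => //; exact: within_contM.
  have e3 : mu.-integrable `[a, b] (EFin \o (fun z => y z * phi z * cutoff a b d z)).
    exact: integrable_mul_cont.
  have E1 : \int[mu]_(z in `[a, b]) (x z * derive1 (fun z => phi z * cutoff a b d z) z) =
      \int[mu]_(z in `[a, b]) (x z * derive1 phi z * cutoff a b d z) +
      \int[mu]_(z in `[a, b]) (x z * phi z * dcutoff a b d z).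
    rewrite -RintegralD//; apply: eq_Rintegral => z _.
    by rewrite dpc derive1_cutoff mulrDr !mulrA.
  have E2 : \int[mu]_(z in `[a, b]) (y z * (phi z * cutoff a b d z)) =
      \int[mu]_(z in `[a, b]) (y z * phi z * cutoff a b d z).
    by apply: eq_Rintegral => z _; rewrite mulrA.
  have E3 : \int[mu]_(z in `[a, b]) ((x z * derive1 phi z + y z * phi z) * cutoff a b d z) =
      \int[mu]_(z in `[a, b]) (x z * derive1 phi z * cutoff a b d z) +
      \int[mu]_(z in `[a, b]) (y z * phi z * cutoff a b d z).
    by rewrite -RintegralD//; apply: eq_Rintegral => z _; rewrite mulrDl.
  by rewrite E1 E2 E3 => /aux.
have l1 := Rintegral_cutoff_cvg ab ih.
have l2 := Rintegral_dcutoff_cvg ab (within_contM cxab cphi).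
have -> : x b * phi b - x a * phi a = - (x a * phi a - x b * phi b) by ring.
apply: (cvg_unique _ l1) => //.
have -> : (fun k : nat => \int[mu]_(z in `[a, b]) ((x z * derive1 phi z + y z * phi z)
     * cutoff a b ((b - a) / 6 / k.+1%:R) z)) =
   (fun k : nat => - \int[mu]_(z in `[a, b]) (x z * phi z * dcutoff a b ((b - a) / 6 / k.+1%:R) z)).
  apply/funext => k; apply: key.
    by rewrite !divr_gt0 ?subr_gt0 ?ltr0n.
  exact: cut_step.
exact: cvgN l2.
Qed.

End Weak.

(** * Sobolev curves: measurability of the Lagrangian, restriction, pasting, affine pieces *)

Section Curves.
Variables (R : realType) (n : nat).
Notation mu := (@lebesgue_measure R).
Implicit Types (xi eta : R -> 'rV[R]_n) (s t a b : R).

(* The open set [L > c] is a countable union of rational boxes. *)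
Lemma measurable_comp2 (L : 'rV[R]_n * 'rV[R]_n -> R) xi eta (D : set R) :
  continuous L -> measurable D ->
  (forall i, measurable_fun D (fun z => xi z 0 i)) ->
  (forall i, measurable_fun D (fun z => eta z 0 i)) ->
  measurable_fun D (fun z => L (xi z, eta z)).
Proof.
move=> cL mD mxi meta.
apply: (measurability _ (RGenOInfty.measurableE R)) => _ [_ [c ->] <-].
pose U := ('rV[rat]_n * 'rV[rat]_n * nat)%type.
pose box (u : U) (x v : 'rV[R]_n) := forall i,
  [/\ ratr (u.1.1 0 i) - u.2.+1%:R^-1 < x 0 i, x 0 i < ratr (u.1.1 0 i) + u.2.+1%:R^-1,
      ratr (u.1.2 0 i) - u.2.+1%:R^-1 < v 0 i & v 0 i < ratr (u.1.2 0 i) + u.2.+1%:R^-1].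
pose inO (u : U) := forall x v, box u x v -> c < L (x, v).
pose F (u : U) : set R := if `[< inO u >] then
  D `&` \bigcap_(i in [set: 'I_n])
   ((D `&` (fun z => xi z 0 i) @^-1`
      `]ratr (u.1.1 0 i) - u.2.+1%:R^-1, ratr (u.1.1 0 i) + u.2.+1%:R^-1[) `&`
    (D `&` (fun z => eta z 0 i) @^-1`
      `]ratr (u.1.2 0 i) - u.2.+1%:R^-1, ratr (u.1.2 0 i) + u.2.+1%:R^-1[))
  else set0.
have -> : D `&` (fun z => L (xi z, eta z)) @^-1` `]c, +oo[ = \bigcup_u F u.
  apply/seteqP; split => [z [Dz /=]|z [u _]]; last first.
    rewrite /F; case: asboolP => // uO [Dz Bz]; split => //=.
    rewrite in_itv/= andbT; apply: uO => i.
    have [[_ /=]] := Bz i I; rewrite in_itv/= => /andP[h1 h2] [_ /=].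
    by rewrite in_itv/= => /andP[h3 h4]; split.
  rewrite in_itv/= andbT => cz.
  have /cvgrPdist_lt := cL (xi z, eta z).
  have e0 : 0 < L (xi z, eta z) - c by rewrite subr_gt0.
  move=> /(_ _ e0) /nbhs_ballP[r /= r0 sub].
  (* A box of half-width [w < r / 2], centred at a rational point within [w] of the given one in
     each coordinate, contains that point and stays in the ball of radius [r]. *)
  pose m := Num.truncn (2 / r).
  have [w [wE w0 mr]] : exists w : R, [/\ m.+1%:R^-1 = w, 0 < w & w < r / 2].
    exists m.+1%:R^-1; split => //.
    by rewrite invf_plt ?posrE ?divr_gt0 ?ltr0n// invf_div truncnS_gt.
  have ratx (y : R) : exists q : rat, y - w < ratr q < y + w.
    have [|q] := @rat_in_itvoo R (y - w) (y + w); first by lra.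
    by rewrite in_itv/= => h; exists q.
  have /choice[f fP] := ratx.
  pose u : U := (\row_i f (xi z 0 i), \row_i f (eta z 0 i), m).
  exists u => //; rewrite /F asboolT.
    split=> // i _; split; split => //=; rewrite in_itv/= /u mxE wE.
      by have /andP[h1 h2] := fP (xi z 0 i); apply/andP; split; lra.
    by have /andP[h1 h2] := fP (eta z 0 i); apply/andP; split; lra.
  move=> x v xv.
  have : ball (xi z, eta z) r (x, v).
    split => /=; rewrite -ball_normE /=.
      apply: (@le_lt_trans _ _ (2 * w)); last by lra.
      have m0 : 0 <= w by exact: ltW.
      rewrite [leLHS]/Num.norm /= mx_normrE; apply: bigmax_le => [|[i j] _ /=].
        by rewrite mulr_ge0.
      rewrite ord1 !mxE; have [] := xv j; rewrite /u /= !mxE wE.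
      have /andP[h1 h2] := fP (xi z 0 j) => *; rewrite ler_norml.
      by apply/andP; split; lra.
    apply: (@le_lt_trans _ _ (2 * w)); last by lra.
    have m0 : 0 <= w by exact: ltW.
    rewrite [leLHS]/Num.norm /= mx_normrE; apply: bigmax_le => [|[i j] _ /=].
      by rewrite mulr_ge0.
    rewrite ord1 !mxE; have [] := xv j; rewrite /u /= !mxE wE.
    have /andP[h1 h2] := fP (eta z 0 j) => *; rewrite ler_norml.
    by apply/andP; split; lra.
  by move=> /sub /=; rewrite ltr_norml => /andP[_]; lra.
apply: countable_bigcupT_measurable; first exact: countableP.
move=> u; rewrite /F; case: asboolP => // _.
apply: measurableI => //; apply: fin_bigcap_measurable => // i _.
by apply: measurableI; [apply: mxi|apply: meta].
Qed.

Lemma within_coord xi s t i : {within `[s, t], continuous xi} ->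
  {within `[s, t], continuous (fun z => xi z 0 i)}.
Proof.
move/subspace_continuousP => c; apply/subspace_continuousP => z /c cz.
apply: (cvg_comp _ (fun x : 'rV[R]_n => x 0 i) cz).
exact: coord_continuous.
Qed.

Lemma W11_integrable s t xi eta i : W11 s t xi eta ->
  mu.-integrable `[s, t] (EFin \o (fun z => eta z 0 i)).
Proof. by move=> [_ /(_ i)[]]. Qed.

Lemma W11_ibp s t xi eta i phi a b : W11 s t xi eta -> C1 phi ->
  s <= a -> a < b -> b <= t ->
  \int[mu]_(z in `[a, b]) (xi z 0 i * derive1 phi z + eta z 0 i * phi z) =
    xi b 0 i * phi b - xi a 0 i * phi a.
Proof.
move=> [cxi /(_ i)[ie wk]] Cphi sa ab bt.
apply: (@weak_ibp _ s t (fun z => xi z 0 i) (fun z => eta z 0 i)) => //.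
exact: within_coord.
Qed.

Lemma C1_cst (c : R) : C1 (fun _ : R => c).
Proof.
apply: (@C1_of_derive _ _ (fun=> 0)); exact: cst_continuous.
Qed.

Lemma W11_incr s t xi eta i a b : W11 s t xi eta ->
  s <= a -> a < b -> b <= t ->
  \int[mu]_(z in `[a, b]) (eta z 0 i) = xi b 0 i - xi a 0 i.
Proof.
move=> W sa ab bt; have := @W11_ibp s t xi eta i (fun=> 1) a b W (C1_cst 1) sa ab bt.
rewrite !mulr1 => <-; apply: eq_Rintegral => z _.
by rewrite mulr1 derive1_cst mulr0 add0r.
Qed.

Lemma W11_mono s t xi eta a b : W11 s t xi eta -> s <= a -> a < b -> b <= t ->
  W11 a b xi eta.
Proof.
move=> W sa ab bt; have [cxi h] := W; split.
  apply: continuous_subspaceW cxi => z /=; rewrite !in_itv/=.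
  by move=> /andP[az zb]; rewrite (le_trans sa az) (le_trans zb bt).
move=> i; have iab := integrable_subitv sa bt (W11_integrable i W); split => //.
move=> phi [Cphi [a' [b' [aa' b'b out]]]].
have := W11_ibp i W Cphi sa ab bt.
have phia : phi a = 0 by apply: out; rewrite in_itv/= negb_and -!ltNge aa'.
have phib : phi b = 0 by apply: out; rewrite in_itv/= negb_and -!ltNge b'b orbT.
rewrite phia phib !mulr0 subr0 RintegralD//.
- by move/eqP; rewrite addr_eq0 => /eqP.
- apply: within_integrable; apply: within_contM; last exact: C1_continuous_derive.
  by apply: within_coord; apply: continuous_subspaceW cxi => z /=; rewrite !in_itv/=;
    move=> /andP[az zb]; rewrite (le_trans sa az) (le_trans zb bt).
- by apply: integrable_mul_cont => //; exact: C1_continuous.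
Qed.

Lemma Rintegral_split (f : R -> R) s t r : s <= t -> t <= r ->
  mu.-integrable `[s, r] (EFin \o f) ->
  \int[mu]_(z in `[s, r]) f z =
  \int[mu]_(z in `[s, t]) f z + \int[mu]_(z in `]t, r]) f z.
Proof.
move=> st tr fi; have := @Rintegral_itvB R f (BLeft s) (BRight r) t fi.
by rewrite !bnd_simp => /(_ st tr) <-; rewrite addrC subrK.
Qed.

Lemma itv_split s t r : s <= t -> t <= r ->
  `[s, r]%classic = `[s, t]%classic `|` `]t, r]%classic.
Proof. by move=> st tr; apply: itv_bndbnd_setU; rewrite bnd_simp. Qed.

Lemma itv_split_disj s t r : [disjoint `[s, t]%classic & `]t, r]%classic].
Proof.
apply/disj_setPS => z [] /=; rewrite !in_itv/= => /andP[_ zt] /andP[tz _].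
by move: zt; rewrite leNgt tz.
Qed.

Lemma integrable_paste (f1 f2 : R -> R) s t r : s <= t -> t <= r ->
  mu.-integrable `[s, t] (EFin \o f1) -> mu.-integrable `[t, r] (EFin \o f2) ->
  mu.-integrable `[s, r] (EFin \o (fun z => if z <= t then f1 z else f2 z)).
Proof.
move=> st tr i1 i2; pose f z := if z <= t then f1 z else f2 z.
rewrite -/f.
have i1' : mu.-integrable `[s, t] (EFin \o f).
  apply: eq_integrable i1 => // z; rewrite inE /= in_itv/= => /andP[_ zt].
  by rewrite /f zt.
have i2' : mu.-integrable `]t, r] (EFin \o f).
  have i3 : mu.-integrable `]t, r] (EFin \o f2).
    by apply: integrableS i2 => //; exact: subset_itv_oc_cc.
  apply: eq_integrable i3 => // z; rewrite inE /= in_itv/= => /andP[tz _].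
  by rewrite /f leNgt tz.
have /integrableP[m1 f1oo] := i1'; have /integrableP[m2 f2oo] := i2'.
have mf : measurable_fun (`[s, t] `|` `]t, r]) (EFin \o f).
  by apply/(measurable_funU (EFin \o f) (measurable_itv _) (measurable_itv _)).
apply/integrableP; split; first by rewrite (itv_split st tr).
rewrite (itv_split st tr) ge0_integral_setU//=.
- by apply: lte_add_pinfty; [exact: f1oo|exact: f2oo].
- apply/measurable_EFinP; apply: measurableT_comp => //; exact/measurable_EFinP.
- exact: itv_split_disj.
Qed.

Definition paste (T : Type) t (f1 f2 : R -> T) := fun z : R => if z <= t then f1 z else f2 z.

(** Matching at [t] gives continuity. For the weak derivative, integration by parts on each side
    leaves boundary terms at [t], which cancel for the same reason. *)
Lemma W11_paste s t r xi1 eta1 xi2 eta2 : s < t -> t < r ->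
  W11 s t xi1 eta1 -> W11 t r xi2 eta2 -> xi1 t = xi2 t ->
  W11 s r (paste t xi1 xi2) (paste t eta1 eta2).
Proof.
move=> st tr W1 W2 E.
have [c1 h1] := W1; have [c2 h2] := W2.
have cx : {within `[s, r], continuous (paste t xi1 xi2)}.
  apply/within_cont_enorm => z /andP[sz zr] e e0.
  have [zt|tz|zt] := ltgtP z t.
  - have [|d d0 hd] := (within_cont_enorm xi1 s t).1 c1 z _ e e0.
      by rewrite sz ltW.
    exists (Num.min d (t - z)); first by rewrite lt_min d0 subr_gt0.
    move=> w /andP[sw wr]; rewrite lt_min => /andP[wd wt].
    have wt' : w <= t by move: wt; rewrite ltr_norml => /andP[_]; lra.
    by rewrite /paste wt' (ltW zt); apply: hd => //; rewrite sw.
  - have [|d d0 hd] := (within_cont_enorm xi2 t r).1 c2 z _ e e0.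
      by rewrite zr ltW.
    exists (Num.min d (z - t)); first by rewrite lt_min d0 subr_gt0.
    move=> w /andP[sw wr]; rewrite lt_min => /andP[wd wt].
    have wt' : t < w by move: wt; rewrite ltr_norml => /andP[+ _]; lra.
    rewrite /paste !leNgt wt' tz /=; apply: hd => //.
    by rewrite (ltW wt') wr.
  - have [|d1 d10 hd1] := (within_cont_enorm xi1 s t).1 c1 t _ e e0.
      by rewrite lexx ltW.
    have [|d2 d20 hd2] := (within_cont_enorm xi2 t r).1 c2 t _ e e0.
      by rewrite lexx ltW.
    exists (Num.min d1 d2); first by rewrite lt_min d10.
    move=> w /andP[sw wr]; rewrite zt lt_min => /andP[wd1 wd2].
    rewrite /paste lexx; have [wt|tw] := lerP w t.
      by apply: hd1 => //; rewrite sw.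
    by rewrite E; apply: hd2 => //; rewrite (ltW tw) wr.
split => // i.
have ie : mu.-integrable `[s, r] (EFin \o (fun z => paste t eta1 eta2 z 0 i)).
  have := integrable_paste (ltW st) (ltW tr) (W11_integrable i W1) (W11_integrable i W2).
  by apply: eq_integrable => // z _; rewrite /paste /=; case: ifP.
split => // phi [Cphi [a [b [sa br out]]]].
have phis : phi s = 0 by apply: out; rewrite in_itv/= negb_and -!ltNge sa.
have phir : phi r = 0 by apply: out; rewrite in_itv/= negb_and -!ltNge br orbT.
have cphi := C1_continuous Cphi; have cdphi := C1_continuous_derive Cphi.
pose f z := paste t xi1 xi2 z 0 i * derive1 phi z + paste t eta1 eta2 z 0 i * phi z.
have i1 : mu.-integrable `[s, r] (EFin \o (fun z => paste t xi1 xi2 z 0 i * derive1 phi z)).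
  by apply: within_integrable; apply: within_contM => //; exact: within_coord.
have i2 : mu.-integrable `[s, r] (EFin \o (fun z => paste t eta1 eta2 z 0 i * phi z)).
  by apply: integrable_mul_cont.
have fi : mu.-integrable `[s, r] (EFin \o f) by exact: (integrableD _ i1 i2).
suff : \int[mu]_(z in `[s, r]) f z = 0.
  by rewrite /f RintegralD// => /eqP; rewrite addr_eq0 => /eqP.
rewrite (Rintegral_split (ltW st) (ltW tr) fi).
have -> : \int[mu]_(z in `[s, t]) f z = xi1 t 0 i * phi t.
  have := W11_ibp i W1 Cphi (lexx s) st (lexx t); rewrite phis mulr0 subr0 => <-.
  apply: eq_Rintegral => z; rewrite inE /= in_itv/= => /andP[_ zt].
  by rewrite /f /paste zt.
have -> : \int[mu]_(z in `]t, r]) f z = - (xi2 t 0 i * phi t).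
  have := W11_ibp i W2 Cphi (lexx t) tr (lexx r); rewrite phir mulr0 sub0r => <-.
  rewrite -[RHS]Rintegral_itv_obnd_cbnd.
    apply: eq_Rintegral => z; rewrite inE /= in_itv/= => /andP[tz _].
    by rewrite /f /paste leNgt tz.
  have j1 : mu.-integrable `[t, r] (EFin \o (fun z => xi2 z 0 i * derive1 phi z)).
    by apply: within_integrable; apply: within_contM => //; exact: within_coord.
  have j2 : mu.-integrable `[t, r] (EFin \o (fun z => eta2 z 0 i * phi z)).
    by apply: integrable_mul_cont => //; exact: W11_integrable W2.
  have j3 : mu.-integrable `[t, r] (EFin \o
      (fun z => xi2 z 0 i * derive1 phi z + eta2 z 0 i * phi z)).
    exact: (integrableD _ j1 j2).
  by apply: integrableS j3 => //; exact: subset_itv_oc_cc.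
by rewrite E subrr.
Qed.

Lemma affine_cont (x v : 'rV[R]_n) s : continuous (fun z : R => x + (z - s) *: v).
Proof.
move=> z; apply: cvgD; first exact: cvg_cst.
by apply: cvgZr_tmp; apply: cvgB; [exact: cvg_id|exact: cvg_cst].
Qed.

Lemma W11_affine (x v : 'rV[R]_n) s t : s < t ->
  W11 s t (fun z => x + (z - s) *: v) (fun=> v).
Proof.
move=> st; split.
  by apply: continuous_subspaceT; exact: affine_cont.
move=> i; split.
  apply: (@within_integrable _ (fun=> v 0 i)).
  by apply: continuous_subspaceT; exact: cst_continuous.
move=> phi [Cphi [a [b [sa bt out]]]].
have phis : phi s = 0 by apply: out; rewrite in_itv/= negb_and -!ltNge sa.
have phit : phi t = 0 by apply: out; rewrite in_itv/= negb_and -!ltNge bt orbT.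
have cphi := C1_continuous Cphi; have cdphi := C1_continuous_derive Cphi.
have dx (z : R) : is_derive z (1 : R) (fun z : R => (x + (z - s) *: v) 0 i) (v 0 i).
  have h := is_deriveD (is_derive_cst (x 0 i - s * v 0 i) z (1 : R))
    (is_deriveZ (v 0 i) (is_derive_id z (1 : R))).
  have -> : (fun z : R => (x + (z - s) *: v) 0 i) =
      (fun z => x 0 i - s * v 0 i + v 0 i * z).
    by apply/funext => w; rewrite !mxE; ring.
  by apply: (is_derive_eq h); rewrite add0r /GRing.scale /= mulr1.
have cx : continuous (fun z : R => (x + (z - s) *: v) 0 i).
  move=> z; apply: differentiable_continuous; apply/derivable1_diffP.
  by have [] := dx z.
rewrite (@Rintegration_by_parts R (fun z => (x + (z - s) *: v) 0 i) phi
  (fun=> v 0 i) (derive1 phi) s t st).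
- by rewrite phis phit !mulr0 subrr sub0r.
- by apply: continuous_subspaceT; exact: cst_continuous.
- split; first by move=> z _; have [] := dx z.
  + exact: cvg_at_right_filter (cx s).
  + exact: cvg_at_left_filter (cx t).
- by move=> z _; rewrite derive1E; have [_ ->] := dx z.
- exact: continuous_subspaceT.
- split; first by move=> z _; have [] := C1_is_derive z Cphi.
  + exact: cvg_at_right_filter (cphi s).
  + exact: cvg_at_left_filter (cphi t).
- by [].
Qed.

Lemma action_measurable (L : 'rV[R]_n * 'rV[R]_n -> R) s t xi eta :
  continuous L -> W11 s t xi eta ->
  measurable_fun `[s, t] (fun z => L (xi z, eta z)).
Proof.
move=> cL W; have [cxi _] := W; apply: measurable_comp2 => // i.
  apply: subspace_continuous_measurable_fun => //.
  exact: within_coord.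
by have /measurable_int /measurable_EFinP := W11_integrable i W.
Qed.

End Curves.

(** * Taylor expansion along lines *)

Lemma is_derive_line (R : realType) (U : normedModType R) (f : U -> R)
    (z w : U) (s : R) : derivable f (z + s *: w) w ->
  is_derive s (1 : R) (fun s => f (z + s *: w)) ('D_w f (z + s *: w)).
Proof.
move=> dv.
have E : (fun h : R => h^-1 *: (((fun s => f (z + s *: w)) \o shift s) (h *: (1 : R))
      - f (z + s *: w))) =
    (fun h => h^-1 *: ((f \o shift (z + s *: w)) (h *: w) - f (z + s *: w))).
  apply/funext => h /=; congr (_ *: (f _ - _)).
  by rewrite -[h%:A]/(h * 1) mulr1 scalerDl addrCA.
by split; rewrite /derivable /derive E.
Qed.

Section Calculus.
Variables (R : realType) (n : nat).
Notation V := 'rV[R]_n.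
Implicit Types (f : V * V -> R) (z w : V * V) (D x v : V).

Lemma continuous_line (z w : V * V) : continuous (fun s : R => z + s *: w).
Proof.
move=> s; apply: cvgD; first exact: cvg_cst.
by apply: cvgZr_tmp; exact: cvg_id.
Qed.

Lemma line_mvt f z w : C1 f -> exists2 c : R, 0 <= c <= 1 &
  f (z + w) - f z = 'D_w f (z + c *: w).
Proof.
move=> Cf; have [df _] := Cf.
have dl (s : R) : derivable f (z + s *: w) w by exact: diff_derivable.
have [|c c01] := @MVT_segment R (fun s => f (z + s *: w))
    (fun s => 'D_w f (z + s *: w)) 0 1 ler01
    (fun s _ => is_derive_line (dl s)).
  apply: continuous_subspaceT => s.
  apply: (@continuous_comp _ _ _ (fun s : R => z + s *: w) f s).
    exact: continuous_line.
  by apply: differentiable_continuous; case: Cf.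
rewrite subr0 mulr1 scale1r scale0r addr0 => E.
by exists c; rewrite ?E// -in_itv.
Qed.

(** Two mean value theorems, the second on the increment [c *: w]. The coefficient [c] in place of
    one half is harmless: later only the size of the remainder or its sign is used. *)
Lemma second_order f z w : C1 f -> (forall w, C1 ('D_w f)) -> exists2 r : R, 0 <= r <= 1 &
  exists2 c : R, 0 <= c <= 1 &
  f (z + w) = f z + 'D_w f z + c * 'D_w ('D_w f) (z + r *: w).
Proof.
move=> Cf Cf2; have [c c01 E] := line_mvt z w Cf.
have [r r01 Er] := line_mvt z (c *: w) (Cf2 w).
exists (r * c).
  by case/andP: c01 => ? ?; case/andP: r01 => ? ?; rewrite mulr_ge0//= mulr_ile1.
exists c => //.
have -> : 'D_w f z = 'D_w f (z + c *: w) - c * 'D_w ('D_w f) (z + (r * c) *: w).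
  rewrite -scalerA.
  have <- : 'D_(c *: w) ('D_w f) (z + r *: (c *: w)) =
      c * 'D_w ('D_w f) (z + r *: (c *: w)).
    have [d _] := Cf2 w; rewrite !deriveE//.
    by rewrite linearZ.
  by rewrite -Er opprB addrC subrK.
by rewrite -E addrA subrK addrC subrK.
Qed.

(** An embedding of [V] as one factor of [V * V], known through its expansion in the basis, so that
    positions ([injx]) and velocities ([injv]) are treated together. *)
Variable iota : V -> V * V.
Hypothesis iotaE : forall D, iota D = \sum_i D 0 i *: iota (delta_mx 0 i).

Lemma derive_iota f z D : C1 f ->
  'D_(iota D) f z = \sum_i D 0 i * 'D_(iota (delta_mx 0 i)) f z.
Proof.
move=> [df _]; rewrite deriveE// iotaE linear_sum; apply: eq_bigr => i _.
by rewrite linearZ /= deriveE.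
Qed.

Lemma derive2_iota f z D : C1 f -> (forall w, C1 ('D_w f)) ->
  'D_(iota D) ('D_(iota D) f) z =
  \sum_i \sum_j D 0 i * D 0 j *
    'D_(iota (delta_mx 0 i)) ('D_(iota (delta_mx 0 j)) f) z.
Proof.
move=> Cf Cf2; apply: etrans (derive_iota z D (Cf2 (iota D))) _; apply: eq_bigr => i _.
set w := iota (delta_mx 0 i).
have E : 'D_(iota D) f = \sum_j (fun z => D 0 j *: 'D_(iota (delta_mx 0 j)) f z).
  apply/funext => y; apply: etrans (derive_iota y D Cf) _.
  by elim/big_rec2: _ => // j a b _ ->.
have dj j : is_derive z w (fun z => D 0 j *: 'D_(iota (delta_mx 0 j)) f z)
    (D 0 j *: 'D_w ('D_(iota (delta_mx 0 j)) f) z).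
  apply: is_deriveZ; split => //.
  by have [d _] := Cf2 (iota (delta_mx 0 j)); exact: diff_derivable.
have [_ Ed] := is_derive_sum dj.
apply: etrans (congr1 (fun F => D 0 i * 'D_w F z) E) _; rewrite Ed.
by rewrite mulr_sumr; apply: eq_bigr => j _; rewrite mulrA.
Qed.

End Calculus.

Section Bounds.
Variables (R : realType) (n : nat).
Notation V := 'rV[R]_n.

Lemma continuous_bounded (h : V * V -> R) (r : R) : continuous h ->
  exists2 K : R, 0 < K & forall x v : V, enorm x <= r -> enorm v <= r ->
    `|h (x, v)| <= K.
Proof.
move=> ch.
pose A := [set x : V | forall i, `[- r, r]%classic (x ord0 i)].
have cA : compact A.
  by apply: (@rV_compact _ _ (fun=> `[- r, r]%classic)) => i; exact: segment_compact.
have AE x : enorm x <= r -> A x.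
  move=> xr i; rewrite /= in_itv/= -ler_norml.
  exact: le_trans (enorm_coord x i) xr.
have := compact_bounded (continuous_compact (continuous_subspaceT ch) (compact_setX cA cA)).
move=> [K0 [_ hK]]; exists (`|K0| + 1); first by have := normr_ge0 K0; lra.
move=> x v xr vr; apply: hK; first by have := ler_norm K0; lra.
by exists (x, v) => //; split; exact: AE.
Qed.

Lemma continuous_bounded_fin (I : finType) (h : I -> V * V -> R) (r : R) :
  (forall i, continuous (h i)) ->
  exists2 K : R, 0 < K & forall i (x v : V), enorm x <= r -> enorm v <= r ->
    `|h i (x, v)| <= K.
Proof.
move=> ch; have /choice[K hK] : forall i, exists K : R, 0 < K /\ forall x v : V,
    enorm x <= r -> enorm v <= r -> `|h i (x, v)| <= K.
  by move=> i; have [K K0 hK] := continuous_bounded r (ch i); exists K.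
exists (1 + \sum_i K i).
  have : 0 <= \sum_i K i by apply: sumr_ge0 => i _; have [/ltW] := hK i.
  by lra.
move=> i x v xr vr; have [_ h1] := hK i; apply: (le_trans (h1 x v xr vr)).
rewrite (bigD1 i)//=; have : 0 <= \sum_(j | j != i) K j.
  by apply: sumr_ge0 => j _; have [/ltW] := hK j.
by lra.
Qed.

End Bounds.

(** * Taylor bound, convexity and linear lower bounds for a Tonelli Lagrangian *)

Section Lagrangian.
Variables (R : realType) (n : nat).
Notation V := 'rV[R]_n.
Variable L : V * V -> R.
Hypothesis CL : C2 L.

Let CL1 : C1 L. Proof. by case: CL. Qed.
Let CL2 w : C1 ('D_w L). Proof. by case: CL. Qed.

Definition injx (D : V) : V * V := (D, 0).
Definition injv (D : V) : V * V := (0, D).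

Lemma injxE D : injx D = \sum_i D 0 i *: injx (delta_mx 0 i).
Proof.
rewrite {1}/injx; apply: (@etrans _ _ (\sum_i D 0 i *: (delta_mx 0 i : V), 0)).
  by rewrite -row_sum_delta.
elim/big_rec2: _ => // i a b _ <-.
by congr pair; rewrite /= scaler0 addr0.
Qed.

Lemma injvE D : injv D = \sum_i D 0 i *: injv (delta_mx 0 i).
Proof.
rewrite {1}/injv; apply: (@etrans _ _ (0, \sum_i D 0 i *: (delta_mx 0 i : V))).
  by rewrite -row_sum_delta.
elim/big_rec2: _ => // i a b _ <-.
by congr pair; rewrite /= scaler0 addr0.
Qed.

Definition gradx x v : V := \row_i 'D_(injx (delta_mx 0 i)) L (x, v).
Definition gradv x v : V := \row_i 'D_(injv (delta_mx 0 i)) L (x, v).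

Lemma gradxE x v D : 'D_(injx D) L (x, v) = dotp (gradx x v) D.
Proof.
apply: etrans (derive_iota injxE (x, v) D CL1) _.
by apply: eq_bigr => i _; rewrite mxE mulrC.
Qed.

Lemma gradvE x v D : 'D_(injv D) L (x, v) = dotp (gradv x v) D.
Proof.
apply: etrans (derive_iota injvE (x, v) D CL1) _.
by apply: eq_bigr => i _; rewrite mxE mulrC.
Qed.

Lemma L_continuous : continuous L.
Proof. by move=> z; apply: differentiable_continuous; case: CL1. Qed.

Lemma lagr_taylor (r : R) : exists2 K : R, 0 < K & forall x v D : V,
  enorm x <= r -> enorm v <= r -> enorm D <= r ->
  enorm (gradx x v) <= K /\
  `|L (x + D, v) - L (x, v) - dotp (gradx x v) D| <= K * enorm D ^+ 2.
Proof.
have c1 (i : 'I_n) : continuous ('D_(injx (delta_mx 0 i)) L) by case: CL1.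
have [K1 K10 hK1] := continuous_bounded_fin (2 * r) c1.
have c2 (ij : 'I_n * 'I_n) : continuous
    ('D_(injx (delta_mx 0 ij.1)) ('D_(injx (delta_mx 0 ij.2)) L)).
  by have [_] := CL2 (injx (delta_mx 0 ij.2)).
(* The remainder is evaluated at [x + s *: D], whose norm may reach [2 * r]. *)
have [K2 K20 hK2] := continuous_bounded_fin (2 * r) c2.
exists (n.+1%:R * K1 + n%:R ^+ 2 * K2).
  apply: ltr_pwDl; first by rewrite mulr_gt0// ltr0n.
  by rewrite mulr_ge0 ?exprn_ge0 ?ler0n// ltW.
move=> x v D xr vr Dr.
have r0 : 0 <= r by apply: le_trans xr; exact: enorm_ge0.
have n2 : 0 <= n%:R ^+ 2 * K2 by rewrite mulr_ge0 ?exprn_ge0 ?ler0n// ltW.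
have n1 : 0 <= n.+1%:R * K1 by rewrite mulr_ge0 ?ler0n// ltW.
split.
  apply: (le_trans (enorm_le_norm _)).
  apply: (@le_trans _ _ (n.+1%:R * K1)); last by lra.
  rewrite ler_wpM2l ?ler0n// [leLHS]/Num.norm /= mx_normrE.
  apply: bigmax_le => [|[i j] _ /=]; first exact: ltW.
  by rewrite mxE hK1//; lra.
have [s s01 [c c01]] := second_order (x, v) (injx D) CL1 CL2.
have -> : (x, v) + injx D = (x + D, v) by congr pair; rewrite /= ?addr0.
have -> : (x, v) + s *: injx D = (x + s *: D, v).
  by congr pair; rewrite /= ?scaler0 ?addr0.
rewrite gradxE => ->; rewrite addrAC [_ - dotp _ _]addrAC addrK addrC addKr.
case/andP: s01 => s0 s1; case/andP: c01 => c0 c1'.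
rewrite (derive2_iota injxE _ _ CL1 CL2) normrM (ger0_norm c0).
apply: (@le_trans _ _ (n%:R ^+ 2 * K2 * enorm D ^+ 2)); last first.
  by rewrite ler_wpM2r ?sqr_ge0//; lra.
apply: (@le_trans _ _ (1 * (n%:R ^+ 2 * K2 * enorm D ^+ 2))); last by rewrite mul1r.
apply: ler_pM => //.
apply: (le_trans (ler_norm_sum _ _ _)).
have -> : n%:R ^+ 2 * K2 * enorm D ^+ 2 = \sum_(i < n) n%:R * (K2 * enorm D ^+ 2).
  by rewrite sumr_const card_ord -[RHS]mulr_natl expr2 !mulrA.
apply: ler_sum => i _; apply: (le_trans (ler_norm_sum _ _ _)).
have -> : n%:R * (K2 * enorm D ^+ 2) = \sum_(j < n) K2 * enorm D ^+ 2.
  by rewrite sumr_const card_ord mulr_natl.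
apply: ler_sum => j _; rewrite normrM mulrC.
apply: ler_pM => //.
  apply: (hK2 (i, j)); last by lra.
  apply: (le_trans (enormD _ _)); rewrite enormZ ger0_norm//.
  by have := ler_piMl (enorm_ge0 D) s1; lra.
rewrite normrM expr2; apply: ler_pM => //; exact: enorm_coord.
Qed.

Hypothesis Hpos : forall x v, positive_definite (hess_v L x v).

Lemma lagr_convex x v w : L (x, v) + dotp (gradv x v) (w - v) <= L (x, w).
Proof.
have [s _ [c /andP[c0 _]]] := second_order (x, v) (injv (w - v)) CL1 CL2.
have -> : (x, v) + injv (w - v) = (x, w).
  by congr pair; rewrite /= ?addr0// subrKC.
have -> : (x, v) + s *: injv (w - v) = (x, v + s *: (w - v)).
  by congr pair; rewrite /= scaler0 addr0.
rewrite gradvE => ->; rewrite lerDl mulr_ge0//.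
rewrite (derive2_iota injvE _ _ CL1 CL2).
have [->|w0] := eqVneq (w - v) 0.
  by rewrite big1// => i _; rewrite big1// => j _; rewrite mxE !mul0r.
have := Hpos x (v + s *: (w - v)) w0; move/ltW; congr (0 <= _).
rewrite mxE exchange_big; apply: eq_bigr => j _ /=; rewrite !mxE mulr_suml.
by apply: eq_bigr => i _; rewrite !mxE mulrAC.
Qed.

Variables (theta1 theta2 : R -> R) (c0 alpha : R).
Hypothesis th1 : nondecreasing_superlinear theta1.
Hypothesis th2 : nondecreasing_superlinear theta2.
Hypothesis growth : forall x v, theta1 (enorm v) - c0 <= L (x, v) <= theta2 (enorm v).
Hypothesis alpha0 : 0 < alpha.
Hypothesis LA : forall z, alpha <= L z.

Lemma superlinear_ge (A : R) : exists2 M : R, 1 <= M & forall r, M <= r -> A * r <= theta1 r.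
Proof.
have [_ _ /cvgryPge /(_ A) [M0 [_ hM]]] := th1.
exists (Num.max 1 (M0 + 1)); first by rewrite le_max lexx.
move=> r; rewrite ge_max => /andP[r1 rM].
have r0 : 0 < r by lra.
have h : A <= theta1 r / r by apply: hM; lra.
by move: h; rewrite ler_pdivlMr.
Qed.

(** Convexity is tested on a unit step in the direction of the gradient. The bound is uniform in [x]
    because [theta2] is, and the value of [L] at [v] is dropped since it is positive. *)
Lemma gradv_le x v r : enorm v <= r -> enorm (gradv x v) <= theta2 (r + 1).
Proof.
move=> vr; have [th2p th2m _] := th2.
have v0 := enorm_ge0 v.
have [p0|p0] := eqVneq (gradv x v) 0.
  by rewrite p0 enorm0; apply: th2p; lra.
have pp := enorm_gt0 p0; set p := gradv x v in p0 pp *.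
have := lagr_convex x v (v + (enorm p)^-1 *: p).
rewrite addrAC subrr add0r dotpZr -/p -sqr_enorm expr2 mulrA mulVf ?gt_eqF// mul1r.
have : L (x, v + (enorm p)^-1 *: p) <= theta2 (r + 1).
  have /andP[_] := growth x (v + (enorm p)^-1 *: p).
  move=> /le_trans; apply; apply: th2m; first exact: enorm_ge0.
  apply: (le_trans (enormD _ _)); rewrite enormZ gtr0_norm ?invr_gt0//.
  by rewrite mulVf ?gt_eqF//; lra.
by have := LA (x, v); move: alpha0; lra.
Qed.

(* The energy [L_v . v - L] vanishes somewhere on each ray: this is the speed
   at which a segment is travelled at least cost. *)
Lemma zero_energy (M : R) : 1 < M -> M * theta2 1 < theta1 M - c0 ->
  forall x e : V, enorm e = 1 -> exists2 r : R, 0 < r <= M &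
    L (x, r *: e) = dotp (gradv x (r *: e)) (r *: e).
Proof.
move=> M1 hM x e e1.
pose E (r : R) := r * 'D_(injv e) L (x, r *: e) - L (x, r *: e).
have cl : continuous (fun r : R => (x, r *: e)).
  have := @continuous_line R n (x, 0) (injv e).
  have -> : (fun s : R => (x, 0) + s *: injv e) = (fun r : R => (x, r *: e)); last by [].
  by apply/funext => r; congr pair; rewrite /= ?scaler0 ?addr0 ?add0r.
have cE : continuous E.
  move=> r; apply: cvgB.
    apply: cvgM; first exact: cvg_id.
    have [_ cd] := CL1.
    exact: (cvg_comp _ _ (cl r) (cd (injv e) (x, r *: e))).
  have h := cvg_comp _ _ (cl r) (@L_continuous (x, r *: e)).
  exact: h.
have E0 : E 0 < 0.
  by rewrite /E mul0r sub0r oppr_lt0; apply: lt_le_trans (LA _); exact: alpha0.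
(* The tangent at velocity [M *: e], evaluated at [e], gives [(M - 1) * E M >= L (x, M *: e) - M * L
   (x, e)], which is positive by the growth condition. *)
have EM : 0 < E M.
  have /andP[hL _] := growth x (M *: e).
  have /andP[_ hU] := growth x e.
  rewrite enormZ e1 mulr1 gtr0_norm in hL; last by lra.
  rewrite e1 in hU.
  have := lagr_convex x (M *: e) e.
  have -> : e - M *: e = (1 - M) *: e by rewrite scalerBl scale1r.
  rewrite dotpZr /E gradvE; set d := dotp _ _ => hc.
  have M0 : 0 < M by lra.
  have : M * L (x, e) <= M * theta2 1 by rewrite ler_pM2l.
  have M1' : 0 < M - 1 by lra.
  rewrite -(pmulr_rgt0 _ M1').
  have := ler_wpM2l (ltW M0) hc; lra.
have M0 : 0 <= M by lra.
have [|r r0M Er] := @IVT R E 0 M 0 M0 (continuous_subspaceT cE).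
  have h := lt_trans E0 EM.
  by rewrite (min_idPl (ltW h)) (max_idPr (ltW h)) (ltW E0) (ltW EM).
have r0 : 0 < r.
  move: r0M; rewrite in_itv/= => /andP[]; rewrite le_eqVlt => /predU1P[r0|//].
  by move: E0; rewrite [X in E X]r0 Er ltxx.
exists r; first by rewrite r0; move: r0M; rewrite in_itv/= => /andP[].
by rewrite dotpZr -gradvE; move/eqP: Er; rewrite subr_eq0 => /eqP <-.
Qed.

(* [p] is the momentum of the zero-energy velocity in the direction [w]. *)
Lemma lagr_support (rad : R) : exists M P : R, [/\ 1 <= M, 0 < P &
  forall kap, 0 < kap -> exists2 del, 0 < del &
  forall x0 w : V, enorm x0 <= rad -> w != 0 -> exists tau v p,
   [/\ 0 < tau, w = tau *: v, enorm v <= M, tau <= P * enorm w &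
    dotp p w = tau * L (x0, v) /\
    forall x v', enorm x <= rad -> enorm (x - x0) <= del ->
      dotp p v' <= (1 + kap) * L (x, v')]].
Proof.
have [th1p th1m _] := th1; have [th2p th2m _] := th2.
have [Ma Ma1 hMa] := superlinear_ge (`|theta2 1| + `|c0| + 1).
pose M1 := Ma + 1.
have M11 : 1 < M1 by rewrite /M1; lra.
have hM1 : M1 * theta2 1 < theta1 M1 - c0.
  have h : (`|theta2 1| + `|c0| + 1) * M1 <= theta1 M1 by apply: hMa; rewrite /M1; lra.
  have h1 : theta2 1 * M1 <= `|theta2 1| * M1.
    by rewrite ler_wpM2r ?ler_norm//; lra.
  have h2 : `|c0| <= `|c0| * M1 by rewrite ler_peMr//; lra.
  by have := ler_norm c0; lra.
pose P := theta2 (M1 + 1) + 1.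
have P0 : 0 < P by have : 0 <= theta2 (M1 + 1) by [apply: th2p; lra]; rewrite /P; lra.
have [Mb Mb1 hMb] := superlinear_ge (P + `|c0|).
pose rr := Num.max (Num.max Mb (2 * `|rad|)) 1.
have rr1 : 1 <= rr by rewrite !le_max lexx !orbT.
have rrb : Mb <= rr by rewrite !le_max lexx.
have rrr : 2 * `|rad| <= rr by rewrite !le_max lexx orbT.
have [K K0 hK] := lagr_taylor rr.
exists M1, (P / alpha); split; first exact: ltW.
  by rewrite divr_gt0.
move=> kap kap0.
have ka : 0 < kap * alpha by rewrite mulr_gt0.
have K20 : 0 < 2 * K by rewrite mulr_gt0.
(* Moving from [x0] to [x] costs at most [2 * K] times their distance. The choice makes this at most
   [kap * alpha], hence at most [kap * L (x, v')]: the lower bound [alpha] turns an absolute error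
   into a relative one. *)
exists (Num.min 1 (kap * alpha / (2 * K))).
  by rewrite lt_min ltr01 divr_gt0.
move=> x0 w x0r w0.
have wp := enorm_gt0 w0.
pose e := (enorm w)^-1 *: w.
have e1 : enorm e = 1 by rewrite enormZ gtr0_norm ?invr_gt0// mulVf// gt_eqF.
have [r /andP[r0 rM] Er] := zero_energy M11 hM1 x0 e1.
set p := gradv x0 (r *: e) in Er.
have re : enorm (r *: e) <= M1 by rewrite enormZ e1 mulr1 gtr0_norm.
have pP : enorm p <= P by have := gradv_le x0 re; rewrite -/p /P; lra.
have wE : w = (enorm w / r) *: (r *: e).
  by rewrite scalerA divfK ?gt_eqF// /e scalerA divff ?gt_eqF// scale1r.
(* Zero energy bounds the speed from below, [L] being then [dotp p (r *: e)]; this gives the bound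
   on the duration. *)
have ar : alpha <= P * r.
  apply: (le_trans (LA (x0, r *: e))); rewrite Er dotpZr mulrC.
  rewrite ler_wpM2r ?(ltW r0)//.
  by apply: (le_trans (dotp_le _ _)); rewrite e1 mulr1.
exists (enorm w / r), (r *: e), p; split => //; first by rewrite divr_gt0.
  rewrite ler_pdivrMr//.
  have -> : P / alpha * enorm w * r = P * r / alpha * enorm w by ring.
  by rewrite ler_peMl ?(ltW wp)// ler_pdivlMr// mul1r.
split; first by rewrite {1}wE dotpZr Er.
move=> x v' xr; rewrite le_min => /andP[xx1 xx2].
have Lp := LA (x, v').
(* For large velocities [theta1] dominates [(P + |c0|) * |v'|] and superlinearity alone concludes.
   The others lie in a ball where the Taylor bound in the position is uniform. *)
have [v'M|v'M] := lerP (enorm v') rr; last first.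
  have /andP[h _] := growth x v'.
  have h2 := hMb (enorm v') (le_trans rrb (ltW v'M)).
  have h3 : dotp p v' <= P * enorm v'.
    by apply: (le_trans (dotp_le _ _)); rewrite ler_wpM2r ?enorm_ge0.
  have h4 : `|c0| <= `|c0| * enorm v' by rewrite ler_peMr//; lra.
  have h5 := mulr_ge0 (ltW kap0) (le_trans (ltW alpha0) Lp).
  by have := ler_norm c0; lra.
(* At zero energy the tangent of [L] at [r *: e] has no constant term, so the lower bound given by
   convexity is linear in [v']. *)
have h1 : dotp p v' <= L (x0, v').
  have := lagr_convex x0 (r *: e) v'; rewrite -/p dotpBr -Er; lra.
have radp : rad <= `|rad| := ler_norm rad.
have rad0 := normr_ge0 rad.
have [h2 h3] : enorm (gradx x v') <= K /\
  `|L (x + (x0 - x), v') - L (x, v') - dotp (gradx x v') (x0 - x)| <= K * enorm (x0 - x) ^+ 2.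
  apply: hK => //; first by lra.
  by rewrite enormBC; lra.
rewrite subrKC in h3.
have d0 := enorm_ge0 (x0 - x).
rewrite enormBC in xx1 xx2.
have h4 : dotp (gradx x v') (x0 - x) <= K * enorm (x0 - x).
  by apply: (le_trans (dotp_le _ _)); rewrite ler_wpM2r.
have h5 : K * enorm (x0 - x) ^+ 2 <= K * enorm (x0 - x).
  by rewrite ler_pM2l// expr2 ler_piMr.
have h6 : 2 * (K * enorm (x0 - x)) <= kap * alpha.
  by rewrite mulrA mulrC -ler_pdivlMr.
have h7 : kap * alpha <= kap * L (x, v') by rewrite ler_pM2l.
by move: h3; rewrite ler_norml => /andP[_ h3]; lra.
Qed.

End Lagrangian.

(** * Dynamic programming inequalities for [Phi] and for the value *)

Section Value.
Variables (R : realType) (n : nat).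
Notation V := 'rV[R]_n.
Notation mu := (@lebesgue_measure R).
Variables (L : V * V -> R) (Om : set V) (alpha : R).
Hypothesis cL : continuous L.
Hypothesis alpha0 : 0 < alpha.
Hypothesis LA : forall z, alpha <= L z.

Let L0 z : 0 <= L z. Proof. exact: le_trans (ltW alpha0) (LA z). Qed.

Lemma Phi_le (t : R) (y x : V) c : 0 < t -> curves Om 0 t y x c ->
  (Phi L Om y x <= \int[mu]_(z in `[0%R, t]) (L (c.1 z, c.2 z))%:E)%E.
Proof.
move=> t0 cc; apply: (@le_trans _ _ (action L Om t y x)).
  by apply: ereal_inf_lbound; exists t.
by apply: ereal_inf_lbound; exists c.
Qed.

Lemma Phi_glb (y x : V) (e : \bar R) :
  (forall t c, 0 < t -> curves Om 0 t y x c ->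
    (e <= \int[mu]_(z in `[0%R, t]) (L (c.1 z, c.2 z))%:E)%E) ->
  (e <= Phi L Om y x)%E.
Proof.
move=> h; apply: le_ereal_inf_tmp => _ [t t0 <-].
by apply: le_ereal_inf_tmp => _ [c cc <-]; exact: h.
Qed.

Lemma Phi_ge0 (y x : V) : (0 <= Phi L Om y x)%E.
Proof. by apply: Phi_glb => t c _ _; apply: integral_ge0 => z _; rewrite lee_fin. Qed.

(** Standing still at [y] costs [t * L (y, 0)], where [t > 0] is as small as wanted. *)
Lemma Phi_refl (y : V) : closure Om y -> (Phi L Om y y <= 0)%E.
Proof.
move=> cy; apply/lee_addgt0Pr => e e0; rewrite add0e.
have Lp : 0 < L (y, 0) by apply: lt_le_trans (LA _).
pose t := e / L (y, 0).
have t0 : 0 < t by rewrite divr_gt0.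
have cc : curves Om 0 t y y (fun z => y + (z - 0) *: 0, fun=> 0).
  by split => /=; [exact: W11_affine|move=> z _| |]; rewrite ?scaler0 ?addr0.
apply: (le_trans (Phi_le t0 cc)).
rewrite (eq_integral (fun=> (L (y, 0))%:E)); last first.
  by move=> z _ /=; rewrite scaler0 addr0.
rewrite integral_cst//= lebesgue_measure_itv/= lte_fin t0 -EFinD -EFinM subr0.
by rewrite /t mulrCA divff ?mulr1// gt_eqF.
Qed.

Lemma Phi_step (y x v : V) (tau b : R) : 0 <= tau ->
  (forall s : R, 0 <= s <= tau -> closure Om (x + s *: v)) ->
  (forall s : R, 0 <= s <= tau -> L (x + s *: v, v) <= b) ->
  (Phi L Om y (x + tau *: v) <= Phi L Om y x + (tau * b)%:E)%E.
Proof.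
(* Zero duration is treated apart, since curves are pasted only on nondegenerate intervals. *)
rewrite le_eqVlt => /predU1P[<- _ _|tau0 cl Lb].
  by rewrite scale0r addr0 mul0r adde0.
rewrite -leeBlDr//; apply: Phi_glb => t c t0 [W cOm c0 ct]; rewrite leeBlDr//.
have t1 : t < t + tau by rewrite ltrDl.
pose xi2 z := x + (z - t) *: v.
have W2 := @W11_affine R n x v t (t + tau) t1.
have E : c.1 t = xi2 t by rewrite /xi2 subrr scale0r addr0.
have W' := W11_paste t0 t1 W W2 E.
have cc : curves Om 0 (t + tau) y (x + tau *: v)
    (paste t c.1 xi2, paste t c.2 (fun=> v)).
  split => //=; rewrite /paste.
  - move=> z /andP[z0 z1]; have [zt|zt] := lerP z t.
      by apply: cOm; rewrite z0.
    by apply: cl; lra.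
  - by rewrite ltW.
  - by rewrite leNgt t1 /= /xi2 addrAC subrr add0r.
apply: (le_trans (Phi_le (lt_trans t0 t1) cc)) => /=.
have mf := action_measurable cL W'.
rewrite (itv_split (ltW t0) (ltW t1)) ge0_integral_setU//=.
- apply: leeD.
    rewrite le_eqVlt; apply/orP; left; apply/eqP; apply: eq_integral => z.
    by rewrite inE /= in_itv/= /paste => /andP[_ ->].
  have -> : (tau * b)%:E = (\int[mu]_(z in `]t, (t + tau)%R]) b%:E)%E.
    rewrite integral_cst//= lebesgue_measure_itv/= lte_fin t1 -EFinD -EFinM.
    by rewrite addrAC subrr add0r mulrC.
  apply: ge0_le_integral => //.
  + by move=> z _; rewrite lee_fin.
  + apply/measurable_EFinP; apply: measurable_funS mf => //.
    by move=> z /=; rewrite !in_itv/= => /andP[tz ->]; rewrite (ltW (lt_trans t0 tz)).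
  + move=> z; rewrite /= in_itv/= => /andP[tz z1].
    by rewrite lee_fin /paste (leNgt z t) tz /= Lb//; lra.
- by apply/measurable_EFinP; rewrite -(itv_split (ltW t0) (ltW t1)).
- by move=> z _; rewrite lee_fin.
- exact: itv_split_disj.
Qed.

Variable g : V -> R.

Lemma value_step (x v : V) (tau b : R) : 0 <= tau ->
  (forall s : R, 0 <= s <= tau -> closure Om (x + s *: v)) ->
  (forall s : R, 0 <= s <= tau -> L (x + s *: v, v) <= b) ->
  (value L Om g (x + tau *: v) <= value L Om g x + (tau * b)%:E)%E.
Proof.
move=> t0 cl Lb; rewrite -leeBlDr//; apply: le_ereal_inf_tmp => _ [y fy <-].
rewrite leeBlDr//; apply: (@le_trans _ _ ((g y)%:E + Phi L Om y (x + tau *: v))%E).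
  by apply: ereal_inf_lbound; exists y.
by rewrite -addeA leeD2l// Phi_step.
Qed.

Lemma value_le (y x : V) : frontier Om y ->
  (value L Om g x <= (g y)%:E + Phi L Om y x)%E.
Proof. by move=> fy; apply: ereal_inf_lbound; exists y. Qed.

Lemma value_glb (x : V) (e : \bar R) :
  (forall y, frontier Om y -> (e <= (g y)%:E + Phi L Om y x)%E) ->
  (e <= value L Om g x)%E.
Proof. by move=> h; apply: le_ereal_inf_tmp => _ [y fy <-]; exact: h. Qed.

(** Compactness of [[a, b]] without a subdivision: [P] is carried across a neighbourhood of each
    time, so the supremum of the times where it holds cannot stop before [b]. In [path_ex] it
    appends one chord at a time. *)
Lemma real_induction (a b : R) (P : R -> Prop) : a <= b -> P a ->
  (forall s, a <= s <= b -> exists2 d, 0 < d & forall s1 s2, a <= s1 -> s1 <= s2 ->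
     s2 <= b -> `|s1 - s| < d -> `|s2 - s| < d -> P s1 -> P s2) -> P b.
Proof.
move=> ab Pa step.
pose S := [set s | a <= s <= b /\ P s].
have Sa : S a by split; rewrite ?lexx.
have supS : has_sup S by split; [exists a|exists b => s [/andP[]]].
set s := sup S.
have as_ : a <= s by apply: sup_upper_bound.
have sb : s <= b by apply: ge_sup; [exists a|move=> z [/andP[]]].
have [|d d0 hd] := step s; first by rewrite as_ sb.
have [s1 [/andP[as1 s1b] Ps1] s1s] := sup_adherent d0 supS.
have Ss1 : S s1 by split; rewrite ?as1.
have s1s' : s1 <= s by exact: sup_upper_bound.
pose s2 := Num.min b (s + d / 2).
have s2b : s2 <= b by rewrite ge_min lexx.
have s2s : s2 <= s + d / 2 by rewrite ge_min lexx orbT.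
have ss2 : s <= s2 by rewrite le_min sb lerDl divr_ge0// ltW.
have Ps2 : P s2.
  apply: (hd s1) => //; first exact: le_trans ss2.
    by move: s1s; rewrite -/s ler0_norm; lra.
  by rewrite ger0_norm; lra.
have s2S : S s2 by split; rewrite ?(le_trans as_ ss2).
have : s2 <= s by exact: sup_upper_bound.
move=> s2s'; have [bs|sb'] := lerP b s2.
  by have -> : b = s2 by apply/eqP; rewrite eq_le bs s2b.
have : s2 = s + d / 2.
  rewrite /s2 in sb' *; move: sb'; rewrite gt_min ltxx /= => h.
  by apply/min_idPr; exact: ltW.
by lra.
Qed.

Lemma polygon_snoc (M eps : R) p tau v N (x w : V) (t : R) :
  polygon Om M eps p tau v N -> 0 <= t <= eps -> enorm w <= M ->
  x = p N + t *: w -> (forall s : R, 0 <= s <= t -> closure Om (p N + s *: w)) ->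
  exists p' tau' v', [/\ polygon Om M eps p' tau' v' N.+1, p' N.+1 = x, p' 0 = p 0 &
    \sum_(j < N.+1) tau' j * L (p' j, v' j) =
    \sum_(j < N) tau j * L (p j, v j) + t * L (p N, w)].
Proof.
move=> [f0 h] te wM xE cl.
pose p' i := if (i <= N)%N then p i else x.
pose tau' i := if (i < N)%N then tau i else t.
pose v' i := if (i < N)%N then v i else w.
exists p', tau', v'; split => //.
- split => // i; rewrite ltnS leq_eqVlt => /predU1P[->|iN].
    by rewrite /p' /tau' /v' !ltnn leqnn; split.
  by rewrite /p' /tau' /v' iN (ltnW iN); exact: h.
- by rewrite /p' ltnn.
- rewrite big_ord_recr /= /p' /tau' /v' ltnn leqnn; congr (_ + _).
  by apply: eq_bigr => j _; rewrite ltn_ord (ltnW (ltn_ord j)).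
Qed.

Lemma dotp_Rintegral (a b : R) (xi eta : R -> V) (s t : R) (q : V) :
  W11 s t xi eta -> s <= a -> a < b -> b <= t ->
  mu.-integrable `[a, b] (EFin \o (fun z => dotp q (eta z))) /\
  \int[mu]_(z in `[a, b]) dotp q (eta z) = dotp q (xi b - xi a).
Proof.
move=> W sa ab bt.
have ii i : mu.-integrable `[a, b] (EFin \o (fun z => q 0 i * eta z 0 i)).
  have i1 := integrable_subitv sa bt (W11_integrable i W).
  have := @integrableZl _ _ _ mu _ (measurable_itv _) (q 0 i) _ i1.
  by [].
have ind (r : seq 'I_n) :
    mu.-integrable `[a, b] (EFin \o (fun z => \sum_(i <- r) q 0 i * eta z 0 i)) /\
    \int[mu]_(z in `[a, b]) (\sum_(i <- r) q 0 i * eta z 0 i) =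
    \sum_(i <- r) q 0 i * (xi b 0 i - xi a 0 i).
  elim: r => [|i r [IH1 IH2]].
    split.
      have -> : (EFin \o (fun z : R => \sum_(i <- [::]) q 0 i * eta z 0 i)) = cst 0%E.
        by apply/funext => z; rewrite /= big_nil.
      exact: integrable0.
    rewrite big_nil (@eq_Rintegral _ _ _ _ _ (fun=> 0)) ?Rintegral_cst ?mul0r//.
    by move=> z _; rewrite big_nil.
  have E : (fun z => \sum_(j <- i :: r) q 0 j * eta z 0 j) =
     (fun z => q 0 i * eta z 0 i + \sum_(j <- r) q 0 j * eta z 0 j).
    by apply/funext => z; rewrite big_cons.
  rewrite E; split; first exact: (integrableD _ (ii i) IH1).
  rewrite RintegralD// IH2 big_cons; congr (_ + _).
  rewrite RintegralZl//; first by rewrite (W11_incr i W sa ab bt).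
  exact: integrable_subitv sa bt (W11_integrable i W).
have [h1 h2] := ind (index_enum 'I_n).
split => //; rewrite /dotp h2.
by apply: eq_bigr => i _; rewrite !mxE.
Qed.

End Value.

Lemma open_frontier (T : topologicalType) (A : set T) x : open A -> frontier A x -> ~ A x.
Proof.
by move=> oA [_ h] Ax; apply: h; rewrite /interior; apply: open_nbhs_nbhs.
Qed.

Lemma enorm_tri2 (R : realType) (n : nat) (s x y : 'rV[R]_n) (r : R) :
  enorm (x - s) < r -> enorm (y - s) < r -> enorm (x - y) <= 2 * r.
Proof.
move=> xs ys; apply: (le_trans (enorm_tri s _ _)).
by rewrite (enormBC s); lra.
Qed.

Lemma enorm_convex (R : realType) (n : nat) (x y : 'rV[R]_n) (k r : R) :
  0 <= k <= 1 -> enorm x < r -> enorm y < r ->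
  enorm ((1 - k) *: x + k *: y) < r.
Proof.
move=> /andP[k0 k1] xr yr; apply: (le_lt_trans (enormD _ _)).
rewrite !enormZ !ger0_norm ?subr_ge0//.
move: k0; rewrite le_eqVlt => /predU1P[<-|k0].
  by rewrite subr0 mul1r mul0r addr0.
have h1 : (1 - k) * enorm x <= (1 - k) * r.
  by apply: ler_wpM2l; rewrite ?subr_ge0// ltW.
have h2 : k * enorm y < k * r by rewrite ltr_pM2l.
by lra.
Qed.

(** * Existence of almost optimal polygons *)

Section Paths.
Variables (R : realType) (n : nat).
Notation V := 'rV[R]_n.
Notation mu := (@lebesgue_measure R).
Variables (L : V * V -> R) (Om : set V) (alpha M B P C rad nu : R) (g u : V -> R).
Hypothesis cL : continuous L.
Hypothesis alpha0 : 0 < alpha.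
Hypothesis LA : forall z, alpha <= L z.
Hypothesis oOm : open Om.
Hypothesis M1 : 1 <= M.
Hypothesis P0 : 0 < P.
Hypothesis C0 : 0 <= C.
Hypothesis nu01 : 0 <= nu < 1.
Hypothesis LB : forall x v, enorm v <= M -> L (x, v) <= B.
Hypothesis Omrad : forall x, closure Om x -> enorm x <= rad.
Hypothesis support : forall kap, 0 < kap -> exists2 del, 0 < del &
  forall x0 w : V, enorm x0 <= rad -> w != 0 -> exists tau v p,
   [/\ 0 < tau, w = tau *: v, enorm v <= M, tau <= P * enorm w &
    dotp p w = tau * L (x0, v) /\
    forall x v', enorm x <= rad -> enorm (x - x0) <= del ->
      dotp p v' <= (1 + kap) * L (x, v')].
Hypothesis gflat : forall x y, frontier Om x -> frontier Om y ->
  g x <= g y + C * enorm (x - y) ^+ 2.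
Hypothesis G1 : forall y1 y2, frontier Om y1 -> frontier Om y2 ->
  ((g y1 - g y2)%:E <= nu%:E * Phi L Om y2 y1)%E.
Hypothesis uE : forall x, closure Om x -> value L Om g x = (u x)%:E.

Let L0 z : 0 <= L z. Proof. exact: le_trans (ltW alpha0) (LA z). Qed.

(* Almost optimal curves are replaced by polygons: on a short time interval the
   supporting momentum in the direction of the chord bounds the action from
   below by that of the chord. *)
Lemma path_ex z : Om z -> forall eps : R, 0 < eps ->
  exists (p : nat -> V) (tau : nat -> R) (v : nat -> V) N,
  [/\ polygon Om M eps p tau v N, p N = z &
    g (p 0) + \sum_(j < N) tau j * L (p j, v j) <= u z + eps].
Proof.
move=> Oz eps eps0; pose e := eps / 4.
have e0 : 0 < e by rewrite divr_gt0.
have cz : closure Om z := subset_closure Oz.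
have [|_ [y fy <-]] := @ereal_inf_lt _ [set ((g y)%:E + Phi L Om y z)%E | y in frontier Om] (u z + e)%:E.
  by rewrite -[X in (X < _)%E]/(value L Om g z) uE// lte_fin ltrDl.
rewrite addeC -lteBrDr// -EFinB => /ereal_inf_lt[_ [t t0 <-]].
move=> /ereal_inf_lt[_ [[xi eta] [/= W cOm xi0 xit] <-]] /=.
rewrite /= in t0.
pose f s := L (xi s, eta s); rewrite -/f => Jlt.
have f0 s : 0 <= f s := L0 _.
have mf := action_measurable cL W.
have fi : mu.-integrable `[0, t] (EFin \o f).
  apply/integrableP; split; first exact/measurable_EFinP.
  apply: le_lt_trans (lt_trans Jlt (ltry _)).
  rewrite le_eqVlt; apply/orP; left; apply/eqP; apply: eq_integral => s _.
  by rewrite /= ger0_norm.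
pose J a b := \int[mu]_(s in `[a, b]) f s.
have JE a b : 0 <= a -> b <= t ->
    (\int[mu]_(s in `[a, b]) (f s)%:E)%E = (J a b)%:E.
  move=> a0 bt; rewrite /J /Rintegral fineK//.
  exact: integrable_fin_num (integrable_subitv a0 bt fi).
have J0 a b : 0 <= J a b by apply: Rintegral_ge0 => s _.
have Jsplit a b c : 0 <= a -> a <= b -> b <= c -> c <= t -> J a c = J a b + J b c.
  move=> a0 ab bc ct; rewrite /J (Rintegral_split ab bc (integrable_subitv a0 ct fi)).
  congr (_ + _); apply: Rintegral_itv_obnd_cbnd.
  apply: integrableS fi => // s /=; rewrite !in_itv/= => /andP[bs sc].
  by rewrite (le_trans a0 (le_trans ab (ltW bs))) (le_trans sc ct).
have Jaa a : J a a = 0 by rewrite /J set_itv1 Rintegral_set1.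
rewrite JE// lte_fin in Jlt.
have [cxi _] := W.
have nOy : ~ Om y := open_frontier oOm fy.
have [|| s0 [s00 s0t fs0 Os0]] := last_exit oOm (ltW t0) cxi.
- by rewrite xi0.
- by rewrite xit.
(* Starting at the last boundary point does not raise the total: by (G1) the change of [g] is at
   most [nu] times the action that is dropped. *)
have cl1 : g (xi s0) + J s0 t <= u z + e.
  have [s0E|s0n] := eqVneq s0 0; first by rewrite s0E xi0; lra.
  have s0p : 0 < s0 by rewrite lt_neqAle eq_sym s0n.
  have cc : curves Om 0 s0 y (xi s0) (xi, eta).
    split => //=; first exact: W11_mono W (lexx 0) s0p (ltW s0t).
    by move=> s /andP[s1 s2]; apply: cOm; rewrite s1 (le_trans s2 (ltW s0t)).
  have := Phi_le L s0p cc; rewrite /= (JE 0 s0 (lexx 0) (ltW s0t)) => hPhi.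
  have hg := G1 fs0 fy.
  have hn : (nu%:E * Phi L Om y (xi s0) <= (J 0 s0)%:E)%E.
    apply: le_trans hPhi; rewrite -[leRHS]mul1e.
    apply: lee_wpmul2r; first exact: Phi_ge0 LA _ _.
    by rewrite lee_fin; case/andP: nu01 => _ /ltW.
  have := le_trans hg hn; rewrite lee_fin => h1.
  have Js := Jsplit 0 s0 t (lexx 0) s00 (ltW s0t) (lexx t).
  by move: h1 Jlt; rewrite Js; clear Js; move: (J 0 s0) (J s0 t) => a b; lra.
pose rr := Num.min (Num.min 1 eps) (e / (`|B| + 4 * C + 1)).
have den : 0 < `|B| + 4 * C + 1 by have := normr_ge0 B; move: C0; lra.
have rr0 : 0 < rr by rewrite !lt_min ltr01 eps0 divr_gt0.
have rr1 : rr <= 1 by rewrite !ge_min lexx.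
have rre : rr <= eps by rewrite !ge_min lexx orbT.
have rrB : (`|B| + 4 * C + 1) * rr <= e.
  by rewrite mulrC -ler_pdivlMr// !ge_min lexx orbT.
have cxi' := (within_cont_enorm xi 0 t).1 cxi.
have [|d d0 hd] := cxi' s0 _ rr rr0; first by rewrite s00 ltW.
(* Chords near [xi s0] may leave [Om], so they are used only after a slightly later time [s1]. The
   point [xi s1] is joined to the frontier by a short straight segment, and the flatness of [g]
   absorbs the change of starting point. *)
pose s1 := Num.min t (s0 + d / 2).
have s1t : s1 <= t by rewrite ge_min lexx.
have s1d : s1 <= s0 + d / 2 by rewrite ge_min lexx orbT.
have s01 : s0 < s1 by rewrite lt_min s0t ltrDl divr_gt0.
have s10 : 0 <= s1 := le_trans s00 (ltW s01).
have z1r : enorm (xi s1 - xi s0) < rr.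
  by apply: hd; [rewrite s10|rewrite ger0_norm; lra].
have Oz1 : Om (xi s1) by exact: Os0.
have nO0 : ~ Om (xi s0) := open_frontier oOm fs0.
have [b [fb bd bcl _]] := seg_exit_dist oOm (subset_closure Oz1) nO0.
set dd := enorm (xi s1 - b) in bd.
have ddr : dd <= rr := le_trans bd (ltW z1r).
have gb : g b <= g (xi s0) + 4 * C * rr.
  apply: (le_trans (gflat fb fs0)); rewrite lerD2l.
  have h1 : enorm (b - xi s0) <= 2 * rr.
    apply: (le_trans (enorm_tri (xi s1) _ _)).
    by rewrite (enormBC b) -/dd; lra.
  have h2 : enorm (b - xi s0) ^+ 2 <= (2 * rr) ^+ 2.
    by rewrite ler_pXn2r ?nnegrE ?enorm_ge0//; lra.
  have h3 : (2 * rr) ^+ 2 <= 4 * rr.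
    by have := ler_piMr (ltW rr0) rr1; lra.
  by have := ler_wpM2l C0 (le_trans h2 h3); lra.
have B0 : 0 <= B.
  apply: (le_trans (L0 (0, 0))); apply: LB.
  by rewrite enorm0; apply: le_trans M1.
pose J1 := J s1 t.
pose kap := e / (J1 + 1).
have J1p : 0 < J1 + 1 by have := J0 s1 t; rewrite -/J1; lra.
have kap0 : 0 < kap by rewrite divr_gt0.
pose c0 := g b + B * rr.
pose Q s := exists (p : nat -> V) (tau : nat -> R) (v : nat -> V) N,
  [/\ polygon Om M eps p tau v N, p N = xi s &
    g (p 0) + \sum_(j < N) tau j * L (p j, v j) <= c0 + (1 + kap) * J s1 s].
suff [p [tau [v [N [poly pN cost]]]]] : Q t.
  exists p, tau, v, N; split => //; first by rewrite pN.
  apply: (le_trans cost).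
  have h1 : kap * (J1 + 1) = e by rewrite divfK// gt_eqF.
  have h2 : J s0 t = J s0 s1 + J1 by apply: Jsplit => //; exact: ltW.
  have h3 := J0 s0 s1.
  have h4 : B * rr <= `|B| * rr by rewrite ler_wpM2r ?ler_norm// ltW.
  by rewrite /c0 -/J1; rewrite /e in cl1 h1 rrB *; lra.
apply: (@real_induction R s1 t Q s1t).
  rewrite /Q Jaa mulr0 addr0.
  have p0 : polygon Om M eps (fun=> b) (fun=> 0) (fun=> 0) 0 by split.
  pose w := dd^-1 *: (xi s1 - b).
  have dd0 : 0 < dd.
    apply: enorm_gt0; rewrite subr_eq0; apply/eqP => E.
    by apply: (open_frontier oOm fb); rewrite -E.
  have wE : xi s1 = b + dd *: w.
    by rewrite /w scalerA divff ?gt_eqF// scale1r subrKC.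
  have wM : enorm w <= M.
    by rewrite /w enormZ gtr0_norm ?invr_gt0// -/dd mulVf ?gt_eqF.
  have [||p [tau [v [poly pN p0E cost]]]] := polygon_snoc L p0 _ wM wE.
  - by rewrite (ltW dd0) (le_trans ddr rre).
  - move=> s /andP[sp sd]; rewrite /w scalerA; apply: bcl.
    by rewrite divr_ge0 ?(ltW dd0)//= ler_pdivrMr// mul1r.
  exists p, tau, v, 1; split => //.
  rewrite p0E cost big_ord0 add0r lerD2l.
  apply: (@le_trans _ _ (dd * B)); first by rewrite ler_wpM2l ?(ltW dd0)// LB.
  by rewrite mulrC ler_wpM2l.
move=> s /andP[s1s st].
have s0s : s0 < s := lt_le_trans s01 s1s.
have Os : Om (xi s) by exact: Os0.
have [del0 del00 hO] := open_enorm oOm Os.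
have [del del_0 hdel] := support kap0.
(* Three requirements: chords stay in a ball contained in [Om], any two points of the arc are within
   [del] for the support inequality, and the duration of a chord, at most [2 * P * r0], does not
   exceed [eps]. *)
pose r0 := Num.min del0 (Num.min (del / 2) (eps / (2 * P))).
have P2 : 0 < 2 * P by rewrite mulr_gt0.
have r00 : 0 < r0 by rewrite !lt_min del00 !divr_gt0.
have r01 : r0 <= del0 by rewrite ge_min lexx.
have r02 : r0 <= del / 2 by rewrite /r0 !ge_min lexx !orbT.
have r03 : 2 * P * r0 <= eps by rewrite mulrC -ler_pdivlMr// /r0 !ge_min lexx !orbT.
have [|d' d'0 hd'] := cxi' s _ r0 r00; first by rewrite (le_trans s10 s1s).
exists d' => // a c s1a ac ct ad cd [p [tau [v [N [poly pN cost]]]]].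
have a0 : 0 <= a := le_trans s10 s1a.
have xa : enorm (xi a - xi s) < r0 by apply: hd' => //; rewrite a0 (le_trans ac ct).
have xc : enorm (xi c - xi s) < r0 by apply: hd' => //; rewrite (le_trans a0 ac).
have Jac : J s1 c = J s1 a + J a c by exact: Jsplit.
have kp : 0 <= 1 + kap by rewrite addr_ge0 ?ler01// ltW.
have [w0|w0] := eqVneq (xi c - xi a) 0.
  exists p, tau, v, N; split => //.
    by rewrite pN; move/eqP: w0; rewrite subr_eq0 => /eqP ->.
  apply: (le_trans cost); rewrite lerD2l ler_wpM2l// Jac lerDl.
  exact: J0.
have ac' : a < c.
  rewrite lt_neqAle ac andbT; apply: contra w0 => /eqP ->.
  by rewrite subrr.
have cla : closure Om (xi a) by apply: cOm; rewrite a0 (le_trans ac ct).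
have [tt [ww [q [tt0 wE wM ttP [qE qle]]]]] := hdel (xi a) _ (Omrad cla) w0.
have wr : enorm (xi c - xi a) <= 2 * r0.
  exact: enorm_tri2 xc xa.
have tte : tt <= eps.
  apply: (le_trans ttP); apply: (le_trans (ler_wpM2l (ltW P0) wr)).
  by rewrite mulrCA mulrA.
have xcE : xi c = p N + tt *: ww by rewrite pN -wE subrKC.
have [||p' [tau' [v' [poly' pN' p0' cost']]]] := polygon_snoc L poly _ wM xcE.
- by rewrite (ltW tt0).
- move=> r /andP[r_0 r_1]; apply: subset_closure; apply: hO; rewrite pN.
  have E : xi a + r *: ww - xi s =
      (1 - r / tt) *: (xi a - xi s) + (r / tt) *: (xi c - xi s).
    have -> : r *: ww = (r / tt) *: (xi c - xi a).
      by rewrite wE scalerA divfK// gt_eqF.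
    by apply/rowP => i; rewrite !mxE; ring.
  have rt0 : 0 <= r / tt by rewrite divr_ge0// ltW.
  have rt1 : r / tt <= 1 by rewrite ler_pdivrMr// mul1r.
  rewrite E; apply: lt_le_trans r01; apply: enorm_convex => //.
  by rewrite rt0 rt1.
exists p', tau', v', N.+1; split => //.
rewrite p0' cost' addrA pN -qE Jac mulrDr addrA; apply: lerD => //.
(* The chord costs [dotp q] of the displacement, which is the integral of [dotp q] of the weak
   derivative; the support inequality bounds the integrand by [(1 + kap) * f]. *)
have [iq <-] := dotp_Rintegral q W a0 ac' ct.
have fiac := integrable_subitv a0 ct fi.
have ifk : mu.-integrable `[a, c] (EFin \o (fun s => (1 + kap) * f s)).
  have := @integrableZl _ _ _ mu _ (measurable_itv _) (1 + kap) _ fiac.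
  by [].
rewrite /J -RintegralZl//; apply: le_Rintegral => // s' /=.
rewrite in_itv/= => /andP[as' s'c].
have xs' : enorm (xi s' - xi s) < r0.
  apply: hd'; first by rewrite (le_trans a0 as') (le_trans s'c ct).
  move: ad cd; rewrite !ltr_norml => /andP[h1 _] /andP[_ h2].
  by rewrite (lt_le_trans h1) ?lerD2r// (le_lt_trans _ h2) ?lerD2r.
apply: qle.
  by apply: Omrad; apply: cOm; rewrite (le_trans a0 as') (le_trans s'c ct).
apply: (le_trans (enorm_tri2 xs' xa)); rewrite mulrC.
by rewrite -ler_pdivlMr.
Qed.

End Paths.

(** * Flatness of the boundary data, and from touching paraboloids to semiconcavity *)

Section Boundary.
Variables (R : realType) (n : nat).
Notation V := 'rV[R]_n.
Implicit Types (x y z h N : V).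

Lemma closed_frontier (T : topologicalType) (A : set T) : closed (frontier A).
Proof.
apply: closedI; first exact: closed_closure.
by apply: open_closedC; exact: open_interior.
Qed.

Lemma gradE (f : V -> R) x w : differentiable f x -> 'D_w f x = dotp (grad f x) w.
Proof.
move=> df; rewrite deriveE// {1}(row_sum_delta w) linear_sum /dotp.
by apply: eq_bigr => i _; rewrite linearZ /= mxE -deriveE// mulrC.
Qed.

Lemma closure_bounded (Om : set V) : bounded_set Om ->
  exists rad : R, forall x, closure Om x -> enorm x <= rad.
Proof.
move=> [M0 [_ hM]]; exists (n.+1%:R * (`|M0| + 1) + 1) => x /closure_enorm cx.
have [y Oy hy] := cx 1 ltr01.
have h1 : `|y| <= `|M0| + 1 by apply: hM => //; have := ler_norm M0; lra.
have h2 : enorm y <= n.+1%:R * (`|M0| + 1).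
  by apply: (le_trans (enorm_le_norm _)); rewrite ler_wpM2l ?ler0n.
by have := enormD (x - y) y; rewrite subrK (enormBC x); lra.
Qed.

(** For points closer than [delta] the segment lies in the tube, and the mean value theorem compares
    the gradient at an intermediate point with that at [x]. For distant points the segment may leave
    the tube, and the bound [Gb] on [g] yields the term [2 * Gb / delta ^+ 2]. *)
Lemma boundary_flat (Om : set V) (g G : V -> R) (delta : R) : bounded_set Om ->
  0 < delta -> C11_on (tube (frontier Om) delta) G ->
  (forall x, frontier Om x -> g x = G x) ->
  (exists2 C : R, 0 < C & forall x y, frontier Om x -> frontier Om y ->
     dotp (grad G x) (x - y) <= C * enorm (x - y) ^+ 2) ->
  exists Gb C : R, [/\ 0 <= C, forall x, frontier Om x -> `|g x| <= Gb &
    forall x y, frontier Om x -> frontier Om y ->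
     g x <= g y + C * enorm (x - y) ^+ 2].
Proof.
move=> bO d0 [dG [K hK]] gG [C C0 hC].
have [rad hrad] := closure_bounded bO.
have inT x : frontier Om x -> tube (frontier Om) delta x.
  by move=> fx; exists x => //; rewrite subrr enorm0.
have cF : compact (frontier Om).
  apply: bounded_closed_compact; last exact: closed_frontier.
  exists rad; split; first exact: num_real.
  move=> r rr x [cx _]; apply: (le_trans (norm_le_enorm x)).
  exact: le_trans (hrad x cx) (ltW rr).
have cG : {within frontier Om, continuous G}.
  apply/subspace_continuousP => x fx; apply: cvg_within_filter.
  by apply: differentiable_continuous; apply: dG; exact: inT.
have := compact_bounded (continuous_compact cG cF).
move=> [Gb0 [_ hGb]]; pose Gb := `|Gb0| + 1.
have gb x : frontier Om x -> `|g x| <= Gb.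
  move=> fx; rewrite gG//; apply: hGb; first by rewrite /Gb; have := ler_norm Gb0; lra.
  by exists x.
pose C' := C + `|K| + 2 * Gb / delta ^+ 2.
have Gb0' : 0 <= Gb by rewrite /Gb; have := normr_ge0 Gb0; lra.
have t0 : 0 <= 2 * Gb / delta ^+ 2 by apply: divr_ge0; [exact: mulr_ge0|exact: sqr_ge0].
have K0 := normr_ge0 K.
exists Gb, C'; split => //; first by rewrite /C'; lra.
move=> x y fx fy; have dd := sqr_ge0 (enorm (x - y)).
have [big|small] := lerP delta (enorm (x - y)).
  have h1 : 2 * Gb <= 2 * Gb / delta ^+ 2 * enorm (x - y) ^+ 2.
    rewrite mulrAC ler_pdivlMr ?exprn_gt0// ler_wpM2l//; first by lra.
    by rewrite ler_pXn2r ?nnegrE ?enorm_ge0// ltW.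
  have h2 : 2 * Gb / delta ^+ 2 * enorm (x - y) ^+ 2 <= C' * enorm (x - y) ^+ 2.
    by rewrite ler_wpM2r// /C'; lra.
  have := gb x fx; have := gb y fy; rewrite !ler_norml => /andP[? ?] /andP[? ?].
  by lra.
have seg (s : R) : 0 <= s <= 1 -> tube (frontier Om) delta (y + s *: (x - y)).
  move=> /andP[s0 s1]; exists y => //; rewrite addrAC subrr add0r enormZ ger0_norm//.
  by apply: le_lt_trans small; rewrite ler_piMl ?enorm_ge0.
have [||s] := @MVT_segment R (fun s => G (y + s *: (x - y)))
    (fun s => 'D_(x - y) G (y + s *: (x - y))) 0 1 ler01.
- move=> s; rewrite in_itv/= => /andP[s0 s1]; apply: is_derive_line.
  by apply: diff_derivable; apply: dG; apply: seg; rewrite !ltW.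
- apply/subspace_continuousP => s /=; rewrite in_itv/= => s01.
  apply: cvg_within_filter.
  have cl : (fun s : R => y + s *: (x - y)) r @[r --> s] --> y + s *: (x - y).
    by apply: cvgD; [exact: cvg_cst|apply: cvgZr_tmp; exact: cvg_id].
  apply: (cvg_comp _ G cl).
  exact: differentiable_continuous (dG _ (seg s s01)).
rewrite in_itv/= => s01; rewrite scale1r subrKC scale0r addr0 subr0 mulr1.
rewrite (gradE _ (dG _ (seg s s01))) -!gG// => E.
set z := y + s *: (x - y) in E.
have h1 := hC x y fx fy.
have h2 : dotp (grad G z - grad G x) (x - y) <= `|K| * enorm (x - y) ^+ 2.
  apply: (le_trans (dotp_le _ _)); rewrite expr2 mulrA.
  apply: ler_wpM2r; first exact: enorm_ge0.
  apply: (le_trans (hK z x (seg s s01) (inT x fx))).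
  apply: (@le_trans _ _ (`|K| * enorm (z - x))).
    by rewrite ler_wpM2r ?enorm_ge0// ler_norm.
  apply: ler_wpM2l => //.
  have -> : z - x = (s - 1) *: (x - y) by apply/rowP => i; rewrite !mxE; ring.
  rewrite enormZ ler_piMl ?enorm_ge0// ler_norml.
  by case/andP: s01 => ? ?; apply/andP; split; lra.
have h3 : (C + `|K|) * enorm (x - y) ^+ 2 <= C' * enorm (x - y) ^+ 2.
  by rewrite ler_wpM2r// /C'; lra.
by move: h2; rewrite dotpBl; lra.
Qed.

Lemma outward_dotp_ge0 (rho : R) N h : enorm N = rho ->
  (forall mu : R, 0 <= mu <= 1 -> rho <= enorm (N + mu *: h)) -> 0 <= dotp N h.
Proof.
move=> EN out; rewrite leNgt; apply/negP => d0.
set d := dotp N h in d0.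
have hh := sqr_ge0 (enorm h).
have e0 : 0 < enorm h ^+ 2 + 1 by lra.
(* Small enough for the linear term [2 * mu * d] to prevail over the quadratic one, so that
   [N + mu *: h] would enter the ball; the added 1 keeps the denominator positive. *)
pose mu := Num.min 1 (- d / (enorm h ^+ 2 + 1)).
have mu0 : 0 < mu by rewrite lt_min ltr01 divr_gt0// oppr_gt0.
have mu1 : mu <= 1 by rewrite ge_min lexx.
have mud : mu * (enorm h ^+ 2 + 1) <= - d.
  by rewrite -ler_pdivlMr// ge_min lexx orbT.
have rho0 : 0 <= rho by rewrite -EN enorm_ge0.
have := out mu; rewrite (ltW mu0) mu1 => /(_ isT).
rewrite -(@ler_pXn2r _ 2)// ?nnegrE ?enorm_ge0//.
rewrite sqr_enormD EN dotpZr -/d enormZ (gtr0_norm mu0) exprMn.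
have : 0 < mu * (- (2 * d) - mu * enorm h ^+ 2) by apply: mulr_gt0 => //; lra.
by lra.
Qed.

(** A tangent displacement leaves the ball by [O(|h|^2)] only: moving [z + h] back by [|h|^2 / rho]
    along the radius lands in the ball. The exit on the way gives a frontier point that close to
    [z + h] and within [2 * |h|] of [z], where flatness applies. *)
Lemma frontier_touch (Om : set V) (g u : V -> R) (B C rho : R) (z h x0 : V) :
  open Om -> 0 < rho -> 0 <= C -> 0 <= B ->
  (forall x y, frontier Om x -> frontier Om y -> g x <= g y + C * enorm (x - y) ^+ 2) ->
  (forall y, frontier Om y -> u y = g y) ->
  (forall x y, (forall s : R, 0 <= s <= 1 -> closure Om (x + s *: (y - x))) ->
     u y <= u x + B * enorm (y - x)) ->
  frontier Om z -> enorm (z - x0) = rho -> eclosed_ball x0 rho `<=` ~` Om ->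
  dotp (z - x0) h = 0 -> enorm h <= rho -> closure Om (z + h) ->
  u (z + h) <= u z + (4 * C + B / rho) * enorm h ^+ 2.
Proof.
move=> oOm rho0 C0 B0 gflat ufr uunit fz EN sub orth hrho clh.
pose t := enorm h ^+ 2 / rho ^+ 2.
have hp := enorm_ge0 h.
have r2 : 0 < rho ^+ 2 by rewrite exprn_gt0.
have t0 : 0 <= t by apply: divr_ge0; [exact: sqr_ge0|exact: ltW].
have t1 : t <= 1.
  by rewrite ler_pdivrMr// mul1r ler_pXn2r ?nnegrE// ltW.
have tr : t * rho ^+ 2 = enorm h ^+ 2 by rewrite divfK// gt_eqF.
pose q := z + h - t *: (z - x0).
have nq : ~ Om q.
  apply: sub; rewrite /eclosed_ball /=.
  have -> : q - x0 = (1 - t) *: (z - x0) + h.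
    by apply/rowP => i; rewrite !mxE; ring.
  rewrite -(@ler_pXn2r _ 2)// ?nnegrE ?enorm_ge0 ?(ltW rho0)//.
  rewrite sqr_enormD dotpZl orth enormZ EN mulr0 mulr0 addr0 exprMn.
  rewrite -normrX (ger0_norm (sqr_ge0 _)) -tr.
  have := ler_wpM2r (ltW r2) (ler_piMr t0 t1); lra.
have [b [fb bd bcl _]] := seg_exit_dist oOm clh nq.
have qd : enorm (z + h - q) = enorm h ^+ 2 / rho.
  rewrite /q opprB addrCA subrr addr0 enormZ EN ger0_norm// /t.
  by field; rewrite gt_eqF.
rewrite qd in bd.
have h1 := uunit b (z + h) bcl.
have hh : enorm h ^+ 2 / rho <= enorm h.
  by rewrite ler_pdivrMr// expr2 ler_wpM2l.
have bz : enorm (b - z) <= 2 * enorm h.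
  have -> : b - z = h - (z + h - b) by apply/rowP => i; rewrite !mxE; ring.
  by apply: (le_trans (enormB _ _)); lra.
have h2 := gflat b z fb fz.
have h3 : C * enorm (b - z) ^+ 2 <= C * (4 * enorm h ^+ 2).
  apply: ler_wpM2l => //.
  have -> : 4 * enorm h ^+ 2 = (2 * enorm h) ^+ 2 by ring.
  by rewrite ler_pXn2r ?nnegrE ?enorm_ge0 ?mulr_ge0.
have h4 : B * enorm (z + h - b) <= B * (enorm h ^+ 2 / rho) by rewrite ler_wpM2l.
by move: h1; rewrite (ufr b fb) (ufr z fz); lra.
Qed.

Lemma semiconcave_of_touch (Om : set V) (g u : V -> R) (B C rho : R) :
  open Om -> 0 < rho -> 0 <= C -> 0 <= B ->
  (forall x y, frontier Om x -> frontier Om y -> g x <= g y + C * enorm (x - y) ^+ 2) ->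
  (forall y, frontier Om y -> u y = g y) ->
  (forall x y, (forall s : R, 0 <= s <= 1 -> closure Om (x + s *: (y - x))) ->
     u y <= u x + B * enorm (y - x)) ->
  (forall x, frontier Om x -> exists x0,
    enorm (x - x0) <= rho /\ eclosed_ball x0 rho `<=` ~` Om) ->
  (exists C1 h0 : R, [/\ 0 < C1, 0 < h0 & forall z, Om z ->
    forall err : R, 0 < err -> exists Q, forall h, enorm h <= h0 ->
    closure Om (z + h) ->
    u (z + h) <= u z + err + dotp Q h + C1 * enorm h ^+ 2]) ->
  semiconcave (closure Om) u.
Proof.
move=> oOm rho0 C0 B0 gflat ufr uunit ext [C1 [h0 [C10 h00 touch]]].
pose hh := Num.min h0 rho.
have hh0 : 0 < hh by rewrite lt_min h00.
have hh1 : hh <= h0 by rewrite ge_min lexx.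
have hh2 : hh <= rho by rewrite ge_min lexx orbT.
pose Cf := 4 * C + B / rho.
have Cf0 : 0 <= Cf by rewrite addr_ge0 ?mulr_ge0// invr_ge0 ltW.
have Bh0 : 0 <= 2 * B / hh by rewrite divr_ge0 ?mulr_ge0// ltW.
exists (2 * (C1 + Cf + 2 * B / hh)); first by rewrite mulr_gt0//; lra.
move=> lam x y /andP[l0 l1] cx cy seg.
set z := lam *: x + (1 - lam) *: y; set d := enorm (x - y).
have [le|l0'] := eqVneq lam 0.
  rewrite /z le subr0 !mul0r mulr0 !mul0r !mul1r scale0r scale1r add0r.
  by rewrite add0r subrr.
have [le|l1'] := eqVneq lam 1.
  by rewrite /z le subrr !mul0r mulr0 !mul0r !mul1r scale0r scale1r !addr0 subrr.
have lp : 0 < lam by rewrite lt_neqAle eq_sym l0'.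
have lp1 : 0 < 1 - lam by rewrite subr_gt0 lt_neqAle l1'.
have d0 : 0 <= d := enorm_ge0 _.
pose A := lam * (1 - lam) * d ^+ 2.
have A0 : 0 <= A by apply: mulr_ge0; [apply: mulr_ge0 => //; exact: ltW|exact: sqr_ge0].
have xz : x = z + (1 - lam) *: (x - y) by apply/rowP => i; rewrite !mxE; ring.
have yz : y = z + (- lam) *: (x - y) by apply/rowP => i; rewrite !mxE; ring.
have nx : enorm ((1 - lam) *: (x - y)) = (1 - lam) * d.
  by rewrite enormZ gtr0_norm.
have ny : enorm ((- lam) *: (x - y)) = lam * d.
  by rewrite enormZ normrN gtr0_norm.
have clz : closure Om z by apply: seg; rewrite l0 l1.
have cls (m : R) : - lam <= m <= 1 - lam -> closure Om (z + m *: (x - y)).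
  move=> /andP[m0 m1]; have := seg (lam + m).
  have -> : (lam + m) *: x + (1 - (lam + m)) *: y = z + m *: (x - y).
    by apply/rowP => i; rewrite !mxE; ring.
  by apply; apply/andP; split; lra.
have Cle (k : R) : k <= C1 + Cf + 2 * B / hh -> k * A <=
    2 * (C1 + Cf + 2 * B / hh) / 2 * lam * (1 - lam) * d ^+ 2.
  move=> kk; have -> : 2 * (C1 + Cf + 2 * B / hh) / 2 * lam * (1 - lam) * d ^+ 2 =
    (C1 + Cf + 2 * B / hh) * A by rewrite /A; field; rewrite gt_eqF.
  exact: ler_wpM2r.
have comb (k : R) (p : R) : u x <= u z + (1 - lam) * p + k * ((1 - lam) * d) ^+ 2 ->
    u y <= u z - lam * p + k * (lam * d) ^+ 2 ->
    lam * u x + (1 - lam) * u y - u z <= k * A.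
  move=> hx hy; have h1 := ler_wpM2l l0 hx; have h2 := ler_wpM2l (ltW lp1) hy.
  have -> : k * A = lam * (k * ((1 - lam) * d) ^+ 2) + (1 - lam) * (k * (lam * d) ^+ 2).
    by rewrite /A; ring.
  by lra.
(* On long segments the Lipschitz bound is enough, because [d <= d ^+ 2 / hh]. *)
have [big|small] := lerP hh d.
  apply: le_trans (Cle (2 * B / hh) _); last by lra.
  have hx : u x <= u z + B * ((1 - lam) * d).
    have xmz : x - z = (1 - lam) *: (x - y) by apply/rowP => i; rewrite !mxE; ring.
    rewrite -nx -xmz; apply: uunit => s /andP[s0 s1]; rewrite xmz scalerA.
    apply: cls; apply/andP; split.
      by have := mulr_ge0 s0 (ltW lp1); lra.
    by rewrite ler_piMl// ltW.
  have hy : u y <= u z + B * (lam * d).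
    have ymz : y - z = (- lam) *: (x - y) by apply/rowP => i; rewrite !mxE; ring.
    rewrite -ny -ymz; apply: uunit => s /andP[s0 s1]; rewrite ymz scalerA.
    apply: cls; have := ler_piMl l0 s1; have := mulr_ge0 s0 l0.
    by move=> *; apply/andP; split; lra.
  have h1 := ler_wpM2l l0 hx; have h2 := ler_wpM2l (ltW lp1) hy.
  have h3 : 2 * B * (lam * (1 - lam)) * d <= 2 * B / hh * A.
    have -> : 2 * B / hh * A = (2 * B * (lam * (1 - lam)) * d) * (d / hh).
      by rewrite /A; ring.
    apply: ler_peMr; last by rewrite ler_pdivlMr// mul1r.
    by rewrite !mulr_ge0// ltW.
  by lra.
have sx : (1 - lam) * d <= hh.
  apply: le_trans (ltW small); rewrite ler_piMl//; lra.
have sy : lam * d <= hh by apply: le_trans (ltW small); rewrite ler_piMl.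
have [Oz|nz] := pselect (Om z).
  apply: le_trans (Cle C1 _); last by lra.
  apply/ler_addgt0Pr => err err0.
  (* With weights [lam] and [1 - lam] the terms in [Q] cancel, so [err] may be arbitrary although
     [Q] depends on it. *)
  have [Q hQ] := touch z Oz err err0.
  have := hQ ((1 - lam) *: (x - y)); rewrite nx -xz => /(_ (le_trans sx hh1) cx) hx.
  have := hQ ((- lam) *: (x - y)); rewrite ny -yz => /(_ (le_trans sy hh1) cy) hy.
  rewrite !dotpZr in hx hy.
  have h1 := ler_wpM2l l0 hx; have h2 := ler_wpM2l (ltW lp1) hy.
  have -> : C1 * A = lam * (C1 * ((1 - lam) * d) ^+ 2) + (1 - lam) * (C1 * (lam * d) ^+ 2).
    by rewrite /A; ring.
  by lra.
have fz : frontier Om z by split => // /interior_subset.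
apply: le_trans (Cle Cf _); last by lra.
have [x0 [x0r sub]] := ext z fz.
have EN : enorm (z - x0) = rho.
  by apply/eqP; rewrite eq_le x0r (closure_out_ball sub clz).
have out (m : R) (w : V) : closure Om (z + w) -> rho <= enorm (z - x0 + w).
  by move=> /(closure_out_ball sub); rewrite addrAC.
(* Both halves of the segment stay outside the ball, so both directions point outward and the
   segment is orthogonal to the radius. *)
have px : 0 <= dotp (z - x0) ((1 - lam) *: (x - y)).
  apply: (outward_dotp_ge0 EN) => m /andP[m0 m1]; apply: (out m).
  rewrite scalerA; apply: cls; apply/andP; split.
    by have := mulr_ge0 m0 (ltW lp1); lra.
  by rewrite ler_piMl// ltW.
have py : 0 <= dotp (z - x0) ((- lam) *: (x - y)).
  apply: (outward_dotp_ge0 EN) => m /andP[m0 m1]; apply: (out m).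
  rewrite scalerA; apply: cls; have := ler_piMl l0 m1; have := mulr_ge0 m0 l0.
  by move=> *; apply/andP; split; lra.
have p0 : dotp (z - x0) (x - y) = 0.
  rewrite dotpZr (pmulr_rge0 _ lp1) in px.
  rewrite dotpZr mulNr oppr_ge0 (pmulr_rle0 _ lp) in py.
  by apply/eqP; rewrite eq_le px py.
apply: (comb Cf 0).
  have := @frontier_touch Om g u B C rho z ((1 - lam) *: (x - y)) x0 oOm rho0 C0 B0
    gflat ufr uunit fz EN sub.
  rewrite dotpZr p0 !mulr0 nx -xz addr0; apply => //; exact: le_trans sx hh2.
have := @frontier_touch Om g u B C rho z ((- lam) *: (x - y)) x0 oOm rho0 C0 B0
  gflat ufr uunit fz EN sub.
by rewrite dotpZr p0 !mulr0 ny -yz subr0; apply => //; exact: le_trans sy hh2.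
Qed.

End Boundary.

(** * Assembly: finiteness of the value and verification of the abstract properties *)

Unset Implicit Arguments.
Set Strict Implicit.
Set Printing Implicit Defensive.

Theorem proposition5p3 (R : realType) (n : nat) (n_gt0 : (0 < n)%N)
  (L : 'rV[R]_n * 'rV[R]_n -> R) (HL : tonelli L)
  (alpha : R) (alpha_gt0 : 0 < alpha) (L_ge : forall z, alpha <= L z)
  (Om : set 'rV[R]_n) (Om_lip : lipschitz_domain Om)
  (Om_bounded : bounded_set Om) (Om_ext : exterior_sphere Om)
  (g : 'rV[R]_n -> R)
  (G1 : exists nu : R, 0 <= nu < 1 /\
     forall y1 y2, frontier Om y1 -> frontier Om y2 ->
       ((g y1 - g y2)%:E <= nu%:E * Phi L Om y2 y1)%E)
  (G2 : exists (delta : R) (G : 'rV[R]_n -> R),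
     [/\ 0 < delta,
         C11_on (tube (frontier Om) delta) G,
         forall x, frontier Om x -> g x = G x &
         exists2 C : R, 0 < C &
           forall x y, frontier Om x -> frontier Om y ->
             dotp (grad G x) (x - y) <= C * enorm (x - y) ^+ 2]) :
  (forall x, closure Om x -> value L Om g x \is a fin_num) /\
  semiconcave (closure Om) (fun x => fine (value L Om g x)).
Proof.
have [CL Hpos [theta1 [theta2 [c0 [th1 th2 c00 growth]]]]] := HL.
have cL := L_continuous CL.
have [oOm _ _ _] := Om_lip.
have [nu [nu01 G1']] := G1.
have [delta [G [d0 dG gG hC]]] := G2.
have [Gb [C [C0 gb gflat]]] := boundary_flat Om_bounded d0 dG gG hC.
have [rad Omrad] := closure_bounded Om_bounded.
have [M [P [M1 P0 supp]]] := lagr_support CL Hpos th1 th2 growth alpha_gt0 L_ge rad.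
(* One radius serves for positions in the closure, velocities bounded by [M] and displacements
   bounded by 2. *)
have [K K0 hK] := lagr_taylor CL (`|rad| + M + 2).
have [_ th2m _] := th2.
pose B := theta2 M.
have LB x v : enorm v <= M -> L (x, v) <= B.
  move=> vM; have /andP[_ h] := growth x v; apply: (le_trans h).
  by apply: th2m => //; exact: enorm_ge0.
have B0 : 0 <= B.
  apply: le_trans (LB 0 0 _); last by rewrite enorm0; lra.
  by apply: le_trans (L_ge _); exact: ltW.
have [rho rho0 ext0] := Om_ext.
have ext x : frontier Om x -> exists x0, enorm (x - x0) <= rho /\
    eclosed_ball x0 rho `<=` ~` Om.
  by move=> /ext0[x0 [_ h1 h2]]; exists x0.
have fcl x : frontier Om x -> closure Om x by case.
have vunit x y : (forall s : R, 0 <= s <= 1 -> closure Om (x + s *: (y - x))) ->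
    (value L Om g y <= value L Om g x + (enorm (y - x) * B)%:E)%E.
  move=> cl; have [v v1 [yE sv]] := unit_param x y.
  rewrite {1}yE; apply: (value_step cL alpha_gt0 L_ge); first exact: enorm_ge0.
    by move=> s /sv[r r01 ->]; exact: cl.
  by move=> s _; apply: LB; exact: le_trans v1 M1.
(* The value is at most [g y] by standing still, and at least [g y] by (G1), as [nu <= 1] and [Phi]
   is nonnegative. *)
have vfr y : frontier Om y -> value L Om g y = (g y)%:E.
  move=> fy; apply/eqP; rewrite eq_le; apply/andP; split.
    apply: (le_trans (value_le L g y fy)); rewrite -[leRHS]adde0 leeD2l//.
    exact: Phi_refl alpha_gt0 L_ge _ (fcl _ fy).
  apply: value_glb => y' fy'.
  have := G1' y y' fy fy'; rewrite EFinB leeBlDr// addeC => /le_trans; apply.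
  rewrite leeD2l// -[leRHS]mul1e; apply: lee_wpmul2r.
    exact: Phi_ge0 alpha_gt0 L_ge _ _.
  by rewrite lee_fin; case/andP: nu01 => _ /ltW.
pose Ub := Gb + B * (rad + `|rad| + 1).
have vlow x : ((- Gb)%:E <= value L Om g x)%E.
  apply: value_glb => y fy; rewrite -[leLHS]adde0; apply: leeD.
    by rewrite lee_fin; have := gb y fy; rewrite ler_norml => /andP[].
  exact: Phi_ge0 alpha_gt0 L_ge _ _.
have vup x : closure Om x -> (value L Om g x <= Ub%:E)%E.
  (* A point farther than [rad] from the origin, which exists as [0 < n], is outside [Om]. The exit
     on the way from it to [x] gives a frontier point from which [x] is reached at bounded cost. *)
  move=> cx; pose q : 'rV[R]_n := (`|rad| + 1) *: delta_mx 0 (Ordinal n_gt0).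
  have qE : enorm q = `|rad| + 1.
    by rewrite enormZ enorm_delta mulr1 ger0_norm// addr_ge0.
  have nq : ~ Om q.
    move=> /subset_closure/Omrad; rewrite qE => h.
    by have := ler_norm rad; lra.
  have [b [fb bd bcl _]] := seg_exit_dist oOm cx nq.
  apply: (le_trans (vunit b x bcl)); rewrite vfr// -EFinD lee_fin.
  have xq : enorm (x - b) <= rad + `|rad| + 1.
    apply: (le_trans bd); apply: (le_trans (enormB _ _)); rewrite qE addrA !lerD2r.
    exact: Omrad.
  rewrite /Ub mulrC; apply: lerD; last exact: ler_wpM2l.
  exact: le_trans (ler_norm _) (gb b fb).
have vfin x : closure Om x -> value L Om g x \is a fin_num.
  move=> cx; rewrite fin_numE; apply/andP; split.
    by apply/eqP => E; have := vlow x; rewrite E leeNy_eq.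
  by apply/eqP => E; have := vup x cx; rewrite E leye_eq.
split => //.
pose u x := fine (value L Om g x).
have uE x : closure Om x -> value L Om g x = (u x)%:E.
  by move=> cx; rewrite /u fineK//; exact: vfin.
have ufr y : frontier Om y -> u y = g y by move=> fy; rewrite /u vfr.
have uunit x y : (forall s : R, 0 <= s <= 1 -> closure Om (x + s *: (y - x))) ->
    u y <= u x + B * enorm (y - x).
  move=> cl; have := vunit x y cl.
  have cx : closure Om x by have := cl 0; rewrite scale0r addr0; apply; rewrite lexx ler01.
  have cy : closure Om y by have := cl 1; rewrite scale1r subrKC; apply; rewrite lexx ler01.
  by rewrite !uE// -EFinD lee_fin mulrC.
have uUb x : closure Om x -> `|u x| <= Ub.
  move=> cx; have := vlow x; have := vup x cx; rewrite uE// !lee_fin => h1 h2.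
  rewrite ler_norml h1 andbT; apply: le_trans h2; rewrite lerN2 /Ub lerDl.
  apply: mulr_ge0 => //.
  have := Omrad x cx; have := enorm_ge0 x; have := normr_ge0 rad; lra.
apply: (semiconcave_of_touch oOm rho0 C0 B0 gflat ufr uunit ext).
apply: (@touch R n Om L g u (fun y x c => (Phi L Om y x <= c%:E)%E)
  (gradx L) M B K alpha nu rho C Ub) => //.
- move=> x v D cx vM D2.
  have r0 : enorm x <= `|rad| + M + 2.
    by have := Omrad x cx; have := ler_norm rad; lra.
  have r1 : enorm v <= `|rad| + M + 2 by have := normr_ge0 rad; lra.
  have r2 : enorm D <= `|rad| + M + 2 by have := normr_ge0 rad; lra.
  have [_] := hK x v D r0 r1 r2; rewrite ler_norml => /andP[_]; lra.
- move=> x v cx vM.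
  have r0 : enorm x <= `|rad| + M + 2.
    by have := Omrad x cx; have := ler_norm rad; lra.
  have r1 : enorm v <= `|rad| + M + 2 by have := normr_ge0 rad; lra.
  have r2 : enorm (0 : 'rV[R]_n) <= `|rad| + M + 2.
    by rewrite enorm0; have := normr_ge0 rad; lra.
  by have [] := hK x v 0 r0 r1 r2.
- move=> x v t b t0 cl Lb.
  have := value_step cL alpha_gt0 L_ge g t0 cl Lb.
  have cx : closure Om x by have := cl 0; rewrite scale0r addr0; apply; rewrite lexx.
  have cy : closure Om (x + t *: v) by apply: cl; rewrite t0 lexx.
  by rewrite !uE// -EFinD lee_fin.
- by move=> y fy; exact: Phi_refl alpha_gt0 L_ge _ (fcl _ fy).
- move=> y x v c t b Wc t0 cl Lb.
  apply: (le_trans (Phi_step cL alpha_gt0 L_ge y t0 cl Lb)).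
  by rewrite EFinD leeD2r.
- move=> y1 y2 c f1 f2 Wc; rewrite -lerBlDl -lee_fin.
  apply: (le_trans (G1' y1 y2 f1 f2)); rewrite EFinM.
  by apply: lee_wpmul2l => //; rewrite lee_fin; case/andP: nu01.
- move=> z Oz eps eps0.
  exact: (path_ex cL alpha_gt0 L_ge oOm M1 P0 C0 nu01 LB Omrad supp gflat G1' uE Oz eps0).
Qed.
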